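(* There exists a graph $G$ of bounded degree such that the simple random walk on $G$ is transient and, almost surely, the path $\mathrm{PATH}$ of the simple random walk on $G$ has only finitely many cutpoints.
   Context: A simple random walk on a graph $G$ is the Markov chain $\{X_t\}_{t\ge 0}$ on the vertices of $G$ such that, given $X_t$, the vertex $X_{t+1}$ is uniformly distributed among the neighbors of $X_t$. The path $\mathrm{PATH}$ of the walk is the (random) subgraph of $G$ consisting of all vertices visited and all edges traversed by the walk. Given a rooted graph $(H,h_0)$, a vertex $x$ of $H$ is a cutpoint if it separates the root $h_0$ from infinity, i.e. if removing $x$ from $H$ would result in $h_0$ being in a finite connected component. A vertex is a cutpoint of the path of the walk if it is a cutpoint of the rooted graph $(\mathrm{PATH},X_0)$. *)

(* Defs.v *)
From HB Require Import structures.
From mathcomp Require Import all_boot all_order all_algebra.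
From mathcomp Require Import finmap.
From mathcomp Require Import all_classical all_reals all_analysis.
From Stdlib Require Import Relation_Operators.

Set Implicit Arguments.
Unset Strict Implicit.
Unset Printing Implicit Defensive.

Import Order.TTheory GRing.Theory Num.Theory.

Local Open Scope classical_set_scope.
Local Open Scope ring_scope.

(* A graph whose vertices form a subset of V.  In every use below [adj] is
   symmetric and only relates elements of [vertices].  No further condition is
   imposed because the path of a walk is a simple graph only almost surely. *)
Record graph (V : Type) := Graph {
  vertices : set V;
  adj : V -> V -> Prop
}.

Section Graphs.
Variable V : Type.
Implicit Type H : graph V.

(* Empty when h is not a vertex of H. *)
Definition component H (h : V) : set V :=
  [set v | vertices H h /\ clos_refl_trans V (adj H) h v].

Definition connected_graph H : Prop :=
  vertices H !=set0 /\
  forall u v, vertices H u -> vertices H v -> component H u v.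

Definition remove_vertex H (x : V) : graph V :=
  Graph (vertices H `\ x) (fun u v => [/\ adj H u v, u <> x & v <> x]).

(* The root itself always counts as a cutpoint: its component becomes empty.
   This affects the number of cutpoints by at most one. *)
Definition cutpoint H (h0 x : V) : Prop :=
  vertices H x /\ finite_set (component (remove_vertex H x) h0).

End Graphs.

Section SimpleGraphs.
Variable V : countType.
Implicit Type e : rel V.

Definition graph_of_rel e : graph V := Graph [set: V] e.

Definition neighbors e (x : V) : set V := [set y | e x y].

(* Only meaningful when [neighbors e x] is finite: [fset_set] sends infinite
   sets to the empty one. *)
Definition degree e (x : V) : nat := #|` fset_set (neighbors e x)|%fset.

Definition bounded_degree e : Prop :=
  exists D : nat, forall x, finite_set (neighbors e x) /\ (degree e x <= D)%N.

End SimpleGraphs.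

Section Walks.
Context {R : realType} {d : measure_display} {Omega : measurableType d}.
Variables (V : countType) (P : probability Omega R).
Implicit Types (e : rel V) (X : nat -> Omega -> V).

Definition cond_prob (A B : set Omega) : R := fine (P (A `&` B)) / fine (P B).

Definition history X (h : nat -> V) (t : nat) : set Omega :=
  [set w | forall s, (s <= t)%N -> X s w = h s].

(* The state space V is countable and discrete, so that X t is a random
   variable as soon as the preimages of points are measurable.  The law of X 0
   is arbitrary. *)
Definition simple_random_walk e X : Prop :=
  (forall t x, measurable (X t @^-1` [set x])) /\
  (forall t (h : nat -> V) y, (0 < P (history X h t))%E ->
    cond_prob (X t.+1 @^-1` [set y]) (history X h t) =
      if e (h t) y then (degree e (h t))%:R^-1 else 0).

Definition walk_path X (w : Omega) : graph V :=
  Graph [set v | exists t, X t w = v]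
        (fun u v => exists t, (X t w = u /\ X t.+1 w = v) \/
                              (X t w = v /\ X t.+1 w = u)).

End Walks.

(* The walk started at any x has positive probability of never returning. *)
Definition transient (R : realType) (V : countType) (e : rel V) : Prop :=
  forall (x : V) (d : measure_display) (Omega : measurableType d)
    (P : probability Omega R) (X : nat -> Omega -> V),
    simple_random_walk P e X -> P (X 0%N @^-1` [set x]) = 1%E ->
    (P [set w | exists2 t, (0 < t)%N & X t w = x] < 1)%E.

(* Main.v *)
Require Import Defs.
From HB Require Import structures.
From mathcomp Require Import all_boot all_order all_algebra.
From mathcomp Require Import finmap.
From mathcomp Require Import all_classical all_reals all_analysis.
From mathcomp Require Import zify ring lra.
From Stdlib Require Import Relation_Operators.

Set Implicit Arguments.
Unset Strict Implicit.
Unset Printing Implicit Defensive.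

Import Order.TTheory GRing.Theory Num.Theory.
Import numFieldNormedType.Exports.

(* A vertex of level [n] is a binary word of length [width n].  The walk goes up by
   appending a letter, and also drops the first letter when [slide n].  In stage [k]
   the width stays [16 * 2 ^ k] for [2 ^ (16 * 2 ^ k - k)] levels, and then the words
   grow to the width of the next stage.  The conductance between the levels [n] and
   [n.+1] is [2 ^ (width n).+1], so that stage [k] contributes about [2 ^ - k] to the
   resistance to infinity, and the walk is transient.  Flipping the letters at a fixed
   position of all words is an automorphism, so hitting probabilities of single
   vertices are bounded through those of levels.

   Let [h := 2 ^ (2 ^ k)], and cut stage [k] into cells of [h ^ 9] levels.  A cell has no
   cutpoint unless (1) the walk does not return below it after having climbed [h] cells
   above it, (2) it returns only once, (3) some vertex lies on five crossings of the cell,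
   or (4) a crossing misses all the vertices that an earlier crossing has visited next to
   the cell.  In each case the probability that some cell of the stage is concerned is
   O(2 ^ - k), and Borel-Cantelli concludes.  Only (1) is not a union bound: the expected
   number of such cells is of order [h], but they come in clusters, since given one of
   them the expected number of the following ones is of order [h * 2 ^ k], by the
   divergence of the harmonic series.

   All these probabilities are bounded by explicit superharmonic functions of the
   position of the walk and of the state of a machine that reads its trajectory. *)

(** * The graph *)

(** Let [c] be [rate k] and [h] be [2 ^ c]. Words of stage [k] have [16 * c] letters, so a cell has
    resistance about [h ^ -7], and the stage has [h ^ 7 / 2 ^ k] cells and about [h ^ 32] vertices.
    Five crossings are required in (3) because 35 is the first multiple of 7 above 32. For (4), a
    word is renewed every [16 * c] levels and then equals a given vertex of its level with chance
    [h ^ -16]; a diffusive walk over [T] such steps makes about [T ^ 2] attempts, so [T] slightly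
    above [h ^ 8] is enough and a cell of [h ^ 9] levels has room for it. The obstacle is (1): a
    cell is crossed only once with probability about [2 ^ k / h ^ 7], so the expected number of such
    cells in a stage is of order 1. The gain is the logarithm of the stage length, of order [2 ^ k];
    hence stages whose lengths grow doubly exponentially while their resistances shrink only
    geometrically. Asking for a climb of [h] cells costs a factor [h] in (1), absorbed by the
    clusters, and wins a factor [h] in (2), where a union bound then suffices. *)

Definition rate (k : nat) : nat := 2 ^ k.
Definition stage_len (k : nat) : nat := 2 ^ (16 * rate k - k).
Fixpoint stage (k : nat) : nat :=
  if k is k'.+1 then stage k' + stage_len k' + 16 * rate k' else 16.

Definition slide (n : nat) : bool :=
  has (fun k => stage k <= n < stage k + stage_len k) (iota 0 n.+1).

Fixpoint width (n : nat) : nat :=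
  if n is n'.+1 then (if slide n' then width n' else (width n').+1) else 0.

Lemma leq_stage k : k + 16 <= stage k.
Proof.
elim: k => [|k IH] //=; have : 0 < rate k by rewrite /rate expn_gt0.
lia.
Qed.

Lemma stageS k : stage k + stage_len k <= stage k.+1.
Proof. by rewrite /= leq_addr. Qed.

Lemma leq_stage2 j k : j <= k -> stage j <= stage k.
Proof.
move=> /subnKC <-; elim: (k - j) => [|i IH]; first by rewrite addn0.
rewrite addnS; apply: (leq_trans IH); apply: leq_trans (stageS _); exact: leq_addr.
Qed.

(** [leq_stage] forces [k <= n] for any witness, so the bounded search in [slide] misses none. *)
Lemma slideP n :
  reflect (exists k, stage k <= n < stage k + stage_len k) (slide n).
Proof.
apply: (iffP hasP) => [[k _ H]|[k H]]; first by exists k.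
exists k => //; rewrite mem_iota /= add0n.
have := leq_stage k; lia.
Qed.

Lemma slide_gt15 n : slide n -> 16 <= n.
Proof. by move=> /slideP[k H]; have := leq_stage k; lia. Qed.

Lemma slideN k n : stage k + stage_len k <= n < stage k.+1 -> slide n = false.
Proof.
move=> /andP[H1 H2]; apply/negP => /slideP[j /andP[H3 H4]].
have [jk|kj|jk] := ltngtP j k.
- have := leq_trans (stageS j) (leq_stage2 jk); lia.
- have := leq_stage2 kj; lia.
- subst j; lia.
Qed.

Lemma slideN0 n : n < 16 -> slide n = false.
Proof. by move=> H; apply/negP => /slide_gt15; lia. Qed.

Lemma width_leq n : width n <= n.
Proof. by elim: n => //= n; case: ifP; lia. Qed.

Lemma leq_widthS n : width n <= width n.+1.
Proof. by rewrite /=; case: ifP; lia. Qed.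

Lemma leq_width m n : m <= n -> width m <= width n.
Proof.
move=> /subnKC <-; elim: (n - m) => [|i IH]; first by rewrite addn0.
by rewrite addnS; exact: leq_trans IH (leq_widthS _).
Qed.

Lemma width_small n : n <= 16 -> width n = n.
Proof.
elim: n => //= n IH H; rewrite slideN0; last lia.
by rewrite IH //; lia.
Qed.

Lemma slide_width n : slide n -> 0 < width n.
Proof.
move=> /slide_gt15 /leq_width; rewrite width_small //; lia.
Qed.

Lemma width_const k n : width (stage k) = 16 * rate k ->
  stage k <= n <= stage k + stage_len k -> width n = 16 * rate k.
Proof.
move=> H0 /andP[] /subnKC <-; elim: (n - stage k) => [|i IH]; first by rewrite addn0.
rewrite addnS => H /=; have -> : slide (stage k + i) by apply/slideP; exists k; lia.
by apply: IH; lia.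
Qed.

Lemma width_widen k i : width (stage k + stage_len k) = 16 * rate k ->
  i <= 16 * rate k -> width (stage k + stage_len k + i) = 16 * rate k + i.
Proof.
move=> H0; elim: i => [|i IH] H; first by rewrite !addn0.
rewrite addnS /= (@slideN k) /=; last lia.
by rewrite IH; lia.
Qed.

(** The widening part of stage [k] has [16 * rate k] levels and gains one letter at each, so the
    width doubles together with [rate]; the first 16 levels form a binary tree. *)
Lemma width_stage k : width (stage k) = 16 * rate k.
Proof.
elim: k => [|k IH]; first by rewrite width_small.
have H := @width_const k (stage k + stage_len k) IH.
rewrite [stage k.+1]/= width_widen ?H //; last lia.
by rewrite /rate expnS; lia.
Qed.

Lemma width_in_stage k n :
  stage k <= n <= stage k + stage_len k -> width n = 16 * rate k.
Proof. exact: width_const (width_stage k). Qed.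

(* The letter [i] of a word of level [n] sits at the absolute position
   [n - width n + i]: the words of two levels share the letters of their common
   positions, and flipping a position in all words is an automorphism. *)
Definition vertex : Type := {v : nat * seq bool | size v.2 == width v.1}.
HB.instance Definition _ := Countable.on vertex.

Definition level (v : vertex) : nat := (val v).1.
Definition word (v : vertex) : seq bool := (val v).2.

Lemma size_word v : size (word v) = width (level v).
Proof. by apply/eqP; exact: (valP v). Qed.

Lemma vertex_eq u v : level u = level v -> word u = word v -> u = v.
Proof.
by case: u v => [[m s] ?] [[n t] ?]; rewrite /level /word /= => ? ?; apply: val_inj; congr pair.
Qed.

Definition mkvertex n (s : seq bool) (h : size s == width n) : vertex :=
  @Sub _ (fun v : nat * seq bool => size v.2 == width v.1) _ (n, s) h.

Lemma size_up v b :
  size (rcons (drop (slide (level v)) (word v)) b) == width (level v).+1.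
Proof.
rewrite size_rcons size_drop size_word /=.
by case: ifP => [/slide_width|_]; lia.
Qed.

Definition up v b : vertex := mkvertex (size_up v b).

Definition trunc (s : seq bool) := take (size s).-1 s.

Lemma size_trunc s : size (trunc s) = (size s).-1.
Proof. by rewrite size_take; case: s => //= _ s; rewrite ltnS leqnn. Qed.

Lemma trunc_rcons s b : trunc (rcons s b) = s.
Proof. by rewrite /trunc size_rcons /= -cats1 take_size_cat. Qed.

Lemma rcons_trunc s : 0 < size s -> rcons (trunc s) (last false s) = s.
Proof. by case/lastP: s => // s b _; rewrite trunc_rcons last_rcons. Qed.

Lemma size_down v n b : level v = n.+1 ->
  size (if slide n then b :: trunc (word v) else trunc (word v)) == width n.
Proof.
move=> lv; case: ifP => sh; rewrite /= size_trunc size_word lv /= sh //.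
by have := slide_width sh; lia.
Qed.

Definition down_at v n (lv : level v = n.+1) b : vertex := mkvertex (size_down b lv).

(** The letter dropped by sliding is free on the way back, whence two lower neighbours; without
    sliding [down_at] ignores its letter, and one entry is listed. *)
Definition downs_at v n : level v = n -> seq vertex :=
  if n is n'.+1 then fun lv => if slide n' then [:: down_at lv false; down_at lv true]
                               else [:: down_at lv false]
  else fun=> [::].

Definition downs v : seq vertex := downs_at (erefl (level v)).

Definition ups v := [:: up v false; up v true].
(** Locked so that simplification leaves sums over [nbrs v] intact. *)
HB.lock Definition nbrs v := ups v ++ downs v.
Lemma nbrsE v : nbrs v = ups v ++ downs v. Proof. by rewrite nbrs.unlock. Qed.

Lemma level_up v b : level (up v b) = (level v).+1. Proof. by []. Qed.
Lemma word_up v b : word (up v b) = rcons (drop (slide (level v)) (word v)) b.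
Proof. by []. Qed.

Lemma downsE v n (lv : level v = n) : downs v = downs_at lv.
Proof. by case: n / lv. Qed.

Lemma downs0 v : level v = 0 -> downs v = [::].
Proof. by move=> lv; rewrite (downsE lv). Qed.

Lemma downsS v n (lv : level v = n.+1) :
  downs v = if slide n then [:: down_at lv false; down_at lv true] else [:: down_at lv false].
Proof. by rewrite (downsE lv). Qed.

Lemma level_down v n (lv : level v = n.+1) b : level (down_at lv b) = n.
Proof. by []. Qed.
Lemma word_down v n (lv : level v = n.+1) b :
  word (down_at lv b) = if slide n then b :: trunc (word v) else trunc (word v).
Proof. by []. Qed.

(** The letter appended on the way up is read off the end of [v], and the letter to restore on the
    way down off the head of [w]. *)
Lemma mem_downs v w : (w \in downs v) = (v \in ups w).
Proof.
case lv: (level v) => [|n].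
  rewrite downs0 // /ups !inE; symmetry; apply/negbTE/negP.
  by case/orP => /eqP H; move: lv; rewrite H level_up.
rewrite (downsS lv).
apply/idP/idP.
- move=> H.
  have [b {H}->] : exists b, w = down_at lv b.
    move: H; case: ifP => _; rewrite !inE; last by move/eqP ->; exists false.
    by case/orP => /eqP ->; [exists false|exists true].
  set d := down_at lv b.
  have -> : v = up d (last false (word v)).
    rewrite /d; apply: vertex_eq; first by rewrite level_up level_down.
    rewrite word_up word_down level_down.
    have E : 0 < size (word v).
      by rewrite size_word lv /=; case: ifP => [/slide_width|].
    rewrite -{1}(rcons_trunc E); congr rcons.
    by case: ifP => _ /=; rewrite ?drop0.
  by rewrite /ups !inE; case: (last _ _); rewrite eqxx ?orbT.
- move=> H.
  have [b E] : exists b, v = up w b.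
    by move: H; rewrite !inE; case/orP => /eqP ->; [exists false|exists true].
  have lw : level w = n by move: lv; rewrite E level_up => -[].
  have -> : w = down_at lv (head false (word w)).
    apply: vertex_eq; first by rewrite level_down.
    rewrite word_down E word_up lw trunc_rcons.
    case: ifP => sh; last by rewrite sh drop0.
    have := slide_width sh; rewrite -lw -size_word.
    by rewrite lw sh; case: (word w) => //= x s _; rewrite drop0.
  case: ifP => sh; rewrite !inE.
    by case: (head _ _); rewrite eqxx ?orbT.
  by apply/eqP; apply: vertex_eq; rewrite // !word_down sh.
Qed.

Lemma nbrs_sym v w : (w \in nbrs v) = (v \in nbrs w).
Proof. by rewrite !nbrsE !mem_cat !mem_downs orbC. Qed.

Lemma level_ups v w : w \in ups v -> level w = (level v).+1.
Proof. by rewrite !inE => /orP[]/eqP ->. Qed.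

Lemma level_downs v w : w \in downs v -> level v = (level w).+1.
Proof. by rewrite mem_downs => /level_ups. Qed.

Lemma level_nbrs v w : w \in nbrs v ->
  level w = (level v).+1 \/ level v = (level w).+1.
Proof. by rewrite nbrsE mem_cat => /orP[/level_ups|/level_downs]; [left|right]. Qed.

Lemma uniq_nbrs v : uniq (nbrs v).
Proof.
rewrite nbrsE cat_uniq; apply/and3P; split.
- rewrite /ups /= andbT inE; apply/eqP => /(congr1 (fun v => last false (word v))).
  by rewrite !word_up !last_rcons.
- apply/hasP => -[w /level_downs H1 /level_ups H2]; lia.
- case lv: (level v) => [|n]; first by rewrite downs0.
  rewrite (downsS lv); case: ifP => // sh; rewrite /= andbT inE; apply/eqP.
  by move=> /(congr1 (fun v => head false (word v))); rewrite !word_down sh.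
Qed.

Definition ndown (n : nat) : nat :=
  if n is n'.+1 then (slide n').+1 else 0.

Lemma size_downs v : size (downs v) = ndown (level v).
Proof.
case lv: (level v) => [|n]; first by rewrite downs0.
by rewrite (downsS lv) /=; case: ifP.
Qed.

Lemma size_nbrs v : size (nbrs v) = 2 + ndown (level v).
Proof. by rewrite nbrsE size_cat size_downs. Qed.

Lemma ndown_le2 n : ndown n <= 2.
Proof. by case: n => //= n; case: slide. Qed.

Lemma ndown_gt0 n : 0 < n -> 0 < ndown n.
Proof. by case: n. Qed.

Lemma sum_level (R : nmodType) (F : nat -> R) v :
  (\sum_(y <- nbrs v) F (level y) =
   F (level v).+1 *+ 2 + F (level v).-1 *+ ndown (level v))%R.
Proof.
rewrite nbrsE big_cat /=; congr (_ + _)%R; first by rewrite /ups !big_cons big_nil addr0 mulr2n.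
rewrite (eq_big_seq (fun=> F (level v).-1)); last by move=> w /level_downs ->.
by rewrite big_const_seq count_predT size_downs iter_addr_0.
Qed.

(** * Flip automorphisms *)

Definition window_start n := n - width n.

Lemma window_startS n : window_start n.+1 = window_start n + slide n.
Proof.
rewrite /window_start /=; have := width_leq n.
by case: ifP => sh; have := width_leq n.+1; rewrite /= sh; lia.
Qed.

Lemma size_flip (g : nat -> bool) v :
  size (mkseq (fun i => nth false (word v) i (+) g (window_start (level v) + i)) (size (word v)))
  == width (level v).
Proof. by rewrite size_mkseq size_word. Qed.

Definition flip g v : vertex := mkvertex (size_flip g v).

Lemma level_flip g v : level (flip g v) = level v. Proof. by []. Qed.
Lemma word_flip g v : word (flip g v) =
  mkseq (fun i => nth false (word v) i (+) g (window_start (level v) + i)) (size (word v)).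
Proof. by []. Qed.

Lemma flipK g : involutive (flip g).
Proof.
move=> v; apply: vertex_eq; rewrite ?level_flip // word_flip word_flip size_mkseq.
apply: (@eq_from_nth _ false); rewrite size_mkseq // => i Hi.
by rewrite !nth_mkseq // level_flip -addbA addbb addbF.
Qed.

(** A letter appended at level [n] gets the absolute position [n], and dropping the first letter
    advances [window_start] by one, so the surviving letters keep their positions. *)
Lemma flip_up g v b : flip g (up v b) = up (flip g v) (b (+) g (level v)).
Proof.
apply: vertex_eq; rewrite // word_flip !word_up level_up level_flip.
have lw := size_word v; have wl := width_leq (level v).
apply: (@eq_from_nth _ false); first by rewrite size_mkseq !size_rcons !size_drop size_mkseq.
move=> i; rewrite size_mkseq => Hi; rewrite nth_mkseq //.
have sh1 : slide (level v) <= size (word v).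
  by rewrite lw; case sh: (slide _) => //; exact: slide_width.
rewrite !nth_rcons !size_drop size_mkseq.
move: Hi; rewrite size_rcons size_drop ltnS leq_eqVlt => /orP[/eqP Hi|Hi].
  rewrite Hi ltnn eqxx; congr (_ (+) g _).
  by rewrite window_startS /window_start; lia.
rewrite Hi !nth_drop nth_mkseq; last lia.
by congr (_ (+) g _); rewrite window_startS; lia.
Qed.

Lemma flip_mem g v w : (flip g w \in nbrs (flip g v)) = (w \in nbrs v).
Proof.
suff H u x : x \in ups u -> flip g x \in ups (flip g u).
  have H' u x : x \in nbrs u -> flip g x \in nbrs (flip g u).
    rewrite !nbrsE !mem_cat => /orP[/H ->//|]; rewrite mem_downs => /H h.
    by rewrite mem_downs h orbT.
  by apply/idP/idP => [/H'|/H' //]; rewrite !flipK.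
move=> xu; have [b -> {x xu}] : exists b, x = up u b.
  by move: xu; rewrite !inE => /orP[]/eqP ->; [exists false|exists true].
by rewrite flip_up /ups !inE; case: (_ (+) _); rewrite eqxx ?orbT.
Qed.

Lemma sum_flip (R : nmodType) g (F : vertex -> R) v :
  (\sum_(y <- nbrs (flip g v)) F y = \sum_(y <- nbrs v) F (flip g y))%R.
Proof.
rewrite -(big_map (flip g) predT F); apply: perm_big; apply: uniq_perm.
- exact: uniq_nbrs.
- rewrite map_inj_uniq ?uniq_nbrs //; exact: can_inj (flipK g).
move=> w; rewrite -(flipK g w) flip_mem mem_map //; exact: can_inj (flipK g).
Qed.

Lemma flip_id (g : nat -> bool) v :
  (forall i, window_start (level v) <= i < level v -> g i = false) -> flip g v = v.
Proof.
move=> H; apply: vertex_eq; rewrite // word_flip.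
apply: (@eq_from_nth _ false); rewrite size_mkseq // => i Hi.
rewrite nth_mkseq // H ?addbF //.
move: Hi; rewrite size_word /window_start; have := width_leq (level v); lia.
Qed.

(** The disjunction says that the words of [v] and [s] occupy disjoint positions. [g] is the
    difference of [s] and [t], supported on the positions of [s]. *)
Lemma flip_transitive v s t : level s = level t ->
  (level v <= window_start (level s)) || (level s <= window_start (level v)) ->
  exists g, flip g v = v /\ flip g s = t.
Proof.
move=> lst disj; set a := window_start (level s).
exists (fun k => (a <= k < level s) && (nth false (word s) (k - a) (+) nth false (word t) (k - a))).
split.
  apply: flip_id => i Hi; apply/negbTE/negP => /andP[H _]; move: disj H Hi; rewrite /a; lia.
apply: vertex_eq; rewrite // word_flip.
have st : size (word s) = size (word t) by rewrite !size_word lst.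
apply: (@eq_from_nth _ false); rewrite size_mkseq // => i Hi.
rewrite nth_mkseq // -/a addKn.
have -> : (a <= a + i < level s).
  by move: Hi; rewrite size_word /a /window_start; have := width_leq (level s); lia.
by rewrite /= addbA addbb.
Qed.

Definition level_list n : seq vertex :=
  [seq mkvertex (valP t) | t : (width n).-tuple bool].

Lemma mem_level_list n v : (v \in level_list n) = (level v == n).
Proof.
apply/mapP/eqP => [[t _ ->] //|lv].
have sz : size (word v) == width n by rewrite size_word lv.
by exists (Tuple sz); rewrite ?mem_enum //; apply: vertex_eq.
Qed.

Lemma uniq_level_list n : uniq (level_list n).
Proof.
rewrite map_inj_uniq ?enum_uniq // => s t /(congr1 word) E; exact: val_inj.
Qed.

Lemma size_level_list n : size (level_list n) = 2 ^ width n.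
Proof. by rewrite size_map -cardE card_tuple card_bool. Qed.

Local Open Scope classical_set_scope.
Local Open Scope ring_scope.

(** * Supersolutions along the histories of a walk *)

Lemma measurable_preimage_countable d (T : measurableType d) (C : countType) (f : T -> C) :
  (forall c, measurable (f @^-1` [set c])) -> forall S, measurable (f @^-1` S).
Proof.
move=> mf S.
have -> : f @^-1` S = \bigcup_n [set w | S (f w) /\ choice.pickle (f w) = n].
  by apply/seteqP; split => w /= => [Sw|[n _ []//]]; exists (choice.pickle (f w)).
apply: bigcupT_measurable => n.
have [[c [Sc pc]]|nc] := pselect (exists c, S c /\ choice.pickle c = n).
  rewrite (_ : [set _ | _] = f @^-1` [set c]) //.
  apply/seteqP; split => w /=; last by move=> ->.
  by case=> _ H; apply: (pcan_inj choice.pickleK); rewrite H pc.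
rewrite (_ : [set _ | _] = set0) //.
by apply/seteqP; split => w //= H; apply: nc; exists (f w).
Qed.

(** * Real-valued probabilities *)

Section RealProbability.
Context {R : realType} {d : measure_display} {Omega : measurableType d}.
Variable P : probability Omega R.
Implicit Types A B : set Omega.

Definition prob A : R := fine (P A).

Lemma prE A : measurable A -> P A = (prob A)%:E.
Proof. by move=> mA; rewrite /prob fineK// fin_num_measure. Qed.

Lemma pr_ge0 A : 0 <= prob A.
Proof. exact/fine_ge0/measure_ge0. Qed.

Lemma pr_le1 A : measurable A -> prob A <= 1.
Proof. by move=> mA; rewrite -lee_fin -prE// probability_le1. Qed.

Lemma le_pr A B : measurable A -> measurable B -> A `<=` B -> prob A <= prob B.
Proof. by move=> mA mB AB; rewrite -lee_fin -!prE// le_measure ?inE. Qed.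

Lemma prU A B : measurable A -> measurable B -> prob (A `|` B) <= prob A + prob B.
Proof.
move=> mA mB; rewrite -lee_fin EFinD -!prE//; first exact: measureU2.
exact: measurableU.
Qed.

Lemma prU_disj A B : measurable A -> measurable B -> A `&` B = set0 ->
  prob (A `|` B) = prob A + prob B.
Proof.
move=> mA mB AB; rewrite /prob -fineD ?fin_num_measure//; congr fine.
exact: measureU.
Qed.

Lemma pr0 : prob set0 = 0. Proof. by rewrite /prob measure0. Qed.

Lemma pr_bigU I (r : seq I) (A : I -> set Omega) : (forall i, measurable (A i)) ->
  prob (\big[setU/set0]_(i <- r) A i) <= \sum_(i <- r) prob (A i).
Proof.
move=> mA; elim: r => [|i r IH]; first by rewrite !big_nil pr0.
rewrite !big_cons; apply: (le_trans (prU _ _)) => //; last by rewrite lerD2l.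
by apply: bigsetU_measurable => *.
Qed.

Lemma pr_bigU_disj (I : eqType) (r : seq I) (A : I -> set Omega) : uniq r ->
  (forall i, measurable (A i)) -> (forall i j, i != j -> A i `&` A j = set0) ->
  prob (\big[setU/set0]_(i <- r) A i) = \sum_(i <- r) prob (A i).
Proof.
move=> + mA dA; elim: r => [|i r IH] /=; first by rewrite !big_nil pr0.
move=> /andP[ir ur]; rewrite !big_cons prU_disj ?IH//.
  by apply: bigsetU_measurable => *.
rewrite big_distrr /= big_seq big1 // => j jr; apply: dA.
by apply: contraNneq ir => ->.
Qed.

Lemma pr_sup (A : nat -> set Omega) (c : R) : (forall n, measurable (A n)) ->
  {homo A : m n / (m <= n)%N >-> m `<=` n} ->
  (forall n, prob (A n) <= c) -> prob (\bigcup_n A n) <= c.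
Proof.
move=> mA homA Ac.
have mU : measurable (\bigcup_n A n) by exact: bigcupT_measurable.
rewrite -lee_fin -prE//.
have cvgA : P \o A @ \oo --> P (\bigcup_n A n).
  by apply: nondecreasing_cvg_mu => // m n mn; apply/subsetPset; exact: homA.
rewrite -(cvg_lim _ cvgA)//; apply: lime_le; first by apply/cvg_ex; eexists; exact: cvgA.
by apply: nearW => n /=; rewrite prE// lee_fin.
Qed.

Lemma prob0_negligible A : measurable A -> prob A = 0 -> P.-negligible A.
Proof. by move=> mA A0; exists A; split => //; rewrite (prE mA) A0. Qed.

End RealProbability.

Section Degree.
Variables (V : countType) (e : rel V) (nb : V -> seq V).
Hypothesis nbE : forall v w, e v w = (w \in nb v).

Lemma neighborsE v : neighbors e v = [set` [fset w in nb v]%fset].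
Proof. by apply/seteqP; split => z; rewrite /neighbors /= nbE inE. Qed.

Lemma degreeE (nb_uniq : forall v, uniq (nb v)) v : degree e v = size (nb v).
Proof. by rewrite /degree neighborsE set_fsetK card_fseq undup_id. Qed.

End Degree.

(** * Cylinder events of the walk *)

Section Histories.
Context {R : realType} {d : measure_display} {Omega : measurableType d}.
Variables (P : probability Omega R) (V : countType) (e : rel V) (nb : V -> seq V).
Variable X : nat -> Omega -> V.
Hypothesis nbE : forall v w, e v w = (w \in nb v).
Hypothesis nb_uniq : forall v, uniq (nb v).
Hypothesis nb_gt0 : forall v, (0 < size (nb v))%N.
Hypothesis srw : simple_random_walk P e X.

Local Notation pr := (prob P).

(* Trajectories are recorded backwards, the current position being the head. *)
Fixpoint hist (t : nat) (w : Omega) : seq V :=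
  if t is t'.+1 then X t w :: hist t' w else [:: X 0%N w].

Lemma size_hist t w : size (hist t w) = t.+1.
Proof. by elim: t => //= t ->. Qed.

Lemma nth_rev_hist x0 t w s : (s <= t)%N -> nth x0 (rev (hist t w)) s = X s w.
Proof.
elim: t => [|t IH]; first by case: s.
rewrite leq_eqVlt => /orP[/eqP ->|]; rewrite /= rev_cons nth_rcons size_rev size_hist.
  by rewrite ltnn eqxx.
by move=> H; rewrite H; apply: IH.
Qed.

Definition cyl (h : seq V) : set Omega := [set w | hist (size h).-1 w = h].

Lemma cyl_history v h : cyl (v :: h) = history X (nth v (rev (v :: h))) (size h).
Proof.
apply/seteqP; split => w; rewrite /cyl /history /=.
  by move=> E s sh; rewrite -E nth_rev_hist.
move=> H; apply: (can_inj revK); apply: (@eq_from_nth _ v).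
  by rewrite !size_rev size_hist.
by move=> i; rewrite size_rev size_hist ltnS => Hi; rewrite nth_rev_hist// H.
Qed.

Lemma measurable_cyl h : measurable (cyl h).
Proof.
case: h => [|v h].
  rewrite (_ : cyl _ = set0) //; apply/seteqP; split => w //=.
elim: h v => [|v' h IH] v.
  rewrite (_ : cyl _ = X 0%N @^-1` [set v]); first exact: srw.1.
  by apply/seteqP; rewrite /cyl /=; split => [w []|w /= ->].
rewrite (_ : cyl _ = cyl (v' :: h) `&` X (size h).+1 @^-1` [set v]).
  apply: measurableI; first exact: IH.
  exact: srw.1.
by apply/seteqP; rewrite /cyl /=; split => w /= [-> ->].
Qed.

Lemma measurable_hist t (S : set (seq V)) : measurable [set w | S (hist t w)].
Proof.
apply: (@measurable_preimage_countable _ _ _ (hist t)) => h.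
have [st|st] := eqVneq (size h) t.+1.
  rewrite (_ : _ @^-1` _ = cyl h); first exact: measurable_cyl.
  by apply/seteqP; split => w; rewrite /cyl /= st.
rewrite (_ : _ @^-1` _ = set0) //.
by apply/seteqP; split => w //= E; move: st; rewrite -E size_hist eqxx.
Qed.

Lemma cylS y v h : cyl (y :: v :: h) = X (size h).+1 @^-1` [set y] `&` cyl (v :: h).
Proof. by apply/seteqP; rewrite /cyl /=; split => w /= [-> ->]. Qed.

Lemma pr_cylS y v h : y \in nb v ->
  pr (cyl (y :: v :: h)) = pr (cyl (v :: h)) / (size (nb v))%:R.
Proof.
move=> yv; have [p0|p0] := eqVneq (pr (cyl (v :: h))) 0.
  rewrite p0 mul0r; apply/eqP; rewrite eq_le pr_ge0 andbT -p0.
  by apply: le_pr; [exact: measurable_cyl|exact: measurable_cyl|rewrite cylS => w []].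
have hpos : (0 < P (history X (nth v (rev (v :: h))) (size h)))%E.
  rewrite -cyl_history prE; last exact: measurable_cyl.
  by rewrite lte_fin lt_neqAle eq_sym p0 pr_ge0.
have := srw.2 (size h) _ y hpos.
have -> : nth v (rev (v :: h)) (size h) = v.
  by rewrite rev_cons nth_rcons size_rev ltnn eqxx.
rewrite nbE yv /cond_prob -cyl_history -cylS -/(pr _) -/(pr _).
rewrite (degreeE nbE nb_uniq).
by move=> <-; rewrite mulrC divfK.
Qed.

Let measurable_leaves t v : measurable [set w | X t w \notin nb v].
Proof.
by apply: (@measurable_preimage_countable _ _ _ (X t) _ (fun x => x \notin nb v)) => c; exact: srw.1.
Qed.

(** The successors in [nb v] have equal shares that already add up to the mass of the cylinder, so
    nothing remains for the exit. *)
Lemma pr_cyl_exit v h :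
  pr (cyl (v :: h) `&` [set w | X (size h).+1 w \notin nb v]) = 0.
Proof.
have mE : measurable [set w | X (size h).+1 w \notin nb v] := measurable_leaves _ _.
set E := [set w | _] in mE *.
have mI : measurable (cyl (v :: h) `&` E) by apply: measurableI => //; exact: measurable_cyl.
have mU : measurable (\big[setU/set0]_(y <- nb v) cyl (y :: v :: h)).
  by apply: bigsetU_measurable => *; exact: measurable_cyl.
have H : cyl (v :: h) = (\big[setU/set0]_(y <- nb v) cyl (y :: v :: h)) `|` (cyl (v :: h) `&` E).
  apply/seteqP; split => w.
    move=> cw; have [yn|yn] := boolP (X (size h).+1 w \in nb v); [left|by right].
    rewrite -bigcup_seq; exists (X (size h).+1 w); first by rewrite /= yn.
    by rewrite cylS.
  case=> [|[]//]; rewrite -bigcup_seq => -[y _]; rewrite cylS => -[]//.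
have D : (\big[setU/set0]_(y <- nb v) cyl (y :: v :: h)) `&` (cyl (v :: h) `&` E) = set0.
  apply/seteqP; split => w //= -[]; rewrite -bigcup_seq => -[y /= yv].
  by rewrite cylS /E /= => -[-> _] [_]; rewrite yv.
have := congr1 (prob P) H; rewrite prU_disj// pr_bigU_disj//.
- rewrite (eq_big_seq (fun=> pr (cyl (v :: h)) / (size (nb v))%:R)); last first.
    by move=> y yv; rewrite (pr_cylS _ yv).
  rewrite big_const_seq count_predT iter_addr_0  -[X in _ = X + _]mulr_natr divfK.
    by move=> /eqP; rewrite -subr_eq0 opprD addrA subrr sub0r oppr_eq0 => /eqP.
  by rewrite pnatr_eq0 -lt0n nb_gt0.
- by move=> y; exact: measurable_cyl.
move=> y z yz; rewrite !cylS; apply/seteqP; split => w //= -[[-> _] [E1 _]].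
by rewrite E1 eqxx in yz.
Qed.

Section Supersolution.
Variables (T : set (seq V)) (Inv : set (seq V)) (phi : seq V -> R).
Hypothesis Inv_step : forall v h y, Inv (v :: h) -> ~ T (v :: h) -> y \in nb v ->
  Inv (y :: v :: h).
Hypothesis phi_ge0 : forall h, Inv h -> 0 <= phi h.
Hypothesis phi_T : forall h, Inv h -> T h -> 1 <= phi h.
Hypothesis phi_step : forall v h, Inv (v :: h) -> ~ T (v :: h) ->
  \sum_(y <- nb v) phi (y :: v :: h) <= (size (nb v))%:R * phi (v :: h).

Let hit n (h : seq V) : set Omega :=
  cyl h `&` [set w | exists2 s, ((size h).-1 <= s <= (size h).-1 + n)%N & T (hist s w)].

Let measurable_hit n h : measurable (hit n h).
Proof.
apply: measurableI; first exact: measurable_cyl.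
rewrite (_ : [set _ | _] = \bigcup_s ([set w | ((size h).-1 <= s <= (size h).-1 + n)%N /\ T (hist s w)])).
  apply: bigcupT_measurable => s.
  exact: (measurable_hist s (fun g => ((size h).-1 <= s <= (size h).-1 + n)%N /\ T g)).
by apply/seteqP; split => w /= => [[s ? ?]|[s _ [? ?]]]; exists s.
Qed.

(** Optional stopping for a nonnegative supermartingale, by induction on the number of steps left:
    [phi_step] averages over the successors, and exits from [nb] are null. *)
Lemma pr_hit_le n h : Inv h -> pr (hit n h) <= pr (cyl h) * phi h.
Proof.
elim: n h => [|n IH] h Ih.
  have [Th|nTh] := pselect (T h).
    apply: le_trans (ler_peMr (pr_ge0 _ _) (phi_T Ih Th)).
    by apply: le_pr => //; [exact: measurable_cyl|move=> w []].
  rewrite (_ : hit 0 h = set0).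
    by rewrite pr0 mulr_ge0 ?pr_ge0// phi_ge0.
  apply/seteqP; split => w // -[ch [s]]; rewrite addn0 => /andP[h1 h2] Ts.
  have : s = (size h).-1 by lia.
  by move=> sE; move: Ts; rewrite sE ch.
have [Th|nTh] := pselect (T h).
  apply: le_trans (ler_peMr (pr_ge0 _ _) (phi_T Ih Th)).
  by apply: le_pr => //; [exact: measurable_cyl|move=> w []].
case: h Ih nTh => [|v h] Ih nTh.
  rewrite (_ : hit _ _ = set0); first by rewrite pr0 mulr_ge0 ?pr_ge0// phi_ge0.
  by apply/seteqP; split => w // -[].
have mbig : measurable (\big[setU/set0]_(y <- nb v) hit n (y :: v :: h)).
  by apply: bigsetU_measurable => *.
have mE : measurable (cyl (v :: h) `&` [set w | X (size h).+1 w \notin nb v]).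
  apply: measurableI; first exact: measurable_cyl.
  exact: measurable_leaves.
have sub : hit n.+1 (v :: h) `<=` (\big[setU/set0]_(y <- nb v) hit n (y :: v :: h))
    `|` (cyl (v :: h) `&` [set w | X (size h).+1 w \notin nb v]).
  move=> w [cw [s /= /andP[s1 s2] Ts]].
  have [yn|yn] := boolP (X (size h).+1 w \in nb v); [left|by right].
  rewrite -bigcup_seq; exists (X (size h).+1 w); first by rewrite /= yn.
  split; first by rewrite cylS.
  exists s => //=; have : s <> size h by move=> E; apply: nTh; rewrite -cw /= -E.
  lia.
apply: le_trans (le_pr P _ _ sub) _ => //; first exact: measurableU.
apply: le_trans (prU P _ _) _ => //; rewrite pr_cyl_exit addr0.
apply: le_trans (pr_bigU P _ _) _ => //.
apply: (@le_trans _ _ (\sum_(y <- nb v) pr (cyl (v :: h)) / (size (nb v))%:R * phi (y :: v :: h))).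
  rewrite big_seq [leRHS]big_seq; apply: ler_sum => y yv.
  by rewrite -(pr_cylS _ yv); apply: IH; exact: Inv_step.
rewrite -mulr_sumr -mulrA ler_wpM2l ?pr_ge0//.
rewrite mulrC ler_pdivrMr ?ltr0n// mulrC.
exact: phi_step.
Qed.

Lemma pr_supersolution x0 : Inv [:: x0] ->
  pr [set w | X 0%N w = x0 /\ exists t, T (hist t w)] <= phi [:: x0].
Proof.
move=> I0.
rewrite (_ : [set _ | _] = \bigcup_n hit n [:: x0]).
  apply: pr_sup => //.
    move=> m n mn w [cw [s /andP[s1 s2] Ts]]; split => //; exists s => //; lia.
  move=> n; apply: le_trans (pr_hit_le _ I0) _.
  rewrite ler_piMl ?phi_ge0//; apply: pr_le1; exact: measurable_cyl.
apply/seteqP; split => w /=.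
  move=> [X0 [t Tt]]; exists t => //; split; first by rewrite /cyl /= X0.
  by exists t => //=; lia.
move=> [n _ [+ [s _ Ts]]]; rewrite /cyl /= => -[X0]; split => //; by exists s.
Qed.

End Supersolution.

Lemma measurable_exists_hist (T : set (seq V)) : measurable [set w | exists t, T (hist t w)].
Proof.
rewrite (_ : [set _ | _] = \bigcup_t [set w | T (hist t w)]).
  by apply: bigcupT_measurable => t; exact: measurable_hist.
by apply/seteqP; split => w /= => [[t ?]|[t _ ?]]; exists t.
Qed.

(** Countable union of the null exits over all finite histories, enumerated by [pickle]. *)
Lemma negligible_not_walk : P.-negligible [set w | exists t, X t.+1 w \notin nb (X t w)].
Proof.
have mE v h : measurable (cyl (v :: h) `&` [set w | X (size h).+1 w \notin nb v]).
  apply: measurableI; first exact: measurable_cyl.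
  exact: measurable_leaves.
pose F n := if choice.unpickle n is Some (v :: h) then
  cyl (v :: h) `&` [set w | X (size h).+1 w \notin nb v] else set0.
have -> : [set w | exists t, X t.+1 w \notin nb (X t w)] = \bigcup_n F n.
  apply/seteqP; split => w /=.
    move=> [t nt]; have [h hE] : exists h, hist t w = X t w :: h.
      by case: t {nt} => [|t]; [exists [::]|exists (hist t w)].
    have sh : size h = t by have := size_hist t w; rewrite hE => -[].
    exists (choice.pickle (X t w :: h)) => //; rewrite /F choice.pickleK; split; last by rewrite /= sh.
    by rewrite /cyl /= sh.
  move=> [n _]; rewrite /F; case: (choice.unpickle n) => // -[//|v h] [].
  rewrite /cyl /=; case: h => [|v' h] /=.
    by case=> <- ?; exists 0%N.
  by case=> <- _ ?; exists (size h).+1.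
apply: negligible_bigcup => n; rewrite /F; case: (choice.unpickle n) => [[|v h]|].
- exact: negligible_set0.
- exact: (prob0_negligible (mE _ _) (pr_cyl_exit _ _)).
- exact: negligible_set0.
Qed.

End Histories.

(** * Resistances and machines *)

Definition edge : rel vertex := fun v w => w \in nbrs v.

Lemma size_nbrs_gt0 v : (0 < size (nbrs v))%N.
Proof. by rewrite size_nbrs. Qed.

Section Resistance.
Variable R : realType.

(* Twice the resistance between the levels [n] and [n.+1]. *)
Definition res (n : nat) : R := 2^-1 ^+ width n.
Definition rho (m n : nat) : R := \sum_(m <= k < n) res k.

Lemma res_gt0 n : 0 < res n. Proof. by rewrite exprn_gt0// invr_gt0. Qed.
Lemma res_ge0 n : 0 <= res n. Proof. exact/ltW/res_gt0. Qed.
Hint Resolve res_gt0 res_ge0 : core.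

Lemma rho_ge0 m n : 0 <= rho m n. Proof. exact: sumr_ge0. Qed.

Lemma rhonn m : rho m m = 0. Proof. by rewrite /rho big_geq. Qed.

Lemma rho_cat m n p : (m <= n <= p)%N -> rho m p = rho m n + rho n p.
Proof. by move=> /andP[mn np]; rewrite /rho (big_cat_nat mn). Qed.

Lemma rhoSr m n : (m <= n)%N -> rho m n.+1 = rho m n + res n.
Proof. by move=> mn; rewrite /rho big_nat_recr. Qed.

Lemma rhoSl m n : (m < n)%N -> rho m n = res m + rho m.+1 n.
Proof. by move=> mn; rewrite /rho big_ltn. Qed.

Lemma rho_gt0 m n : (m < n)%N -> 0 < rho m n.
Proof. by move=> mn; rewrite rhoSl// ltr_wpDr// rho_ge0. Qed.

Lemma le_rho m m' n n' : (m' <= m)%N -> (n <= n')%N -> rho m n <= rho m' n'.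
Proof.
move=> mm nn; have [nm|mn] := leqP n m; first by rewrite /rho big_geq// sumr_ge0.
rewrite (@rho_cat m' m n') ?(@rho_cat m n n') ?nn ?mm ?andbT; try lia.
have := rho_ge0 m' m; have := rho_ge0 n n'; lra.
Qed.

(** The edges between two consecutive levels are counted from both sides. This makes [rho] the
    harmonic coordinate of the level of the walk. *)
Lemma res_ndown n : (0 < n)%N -> (ndown n)%:R * res n.-1 = 2 * res n.
Proof.
case: n => // n _; rewrite /res /=; case sh: (slide n) => //=.
by rewrite mul1r exprS mulrA divff ?mul1r// pnatr_eq0.
Qed.

(** Kirchhoff's law: [c0] and [c1] compare the fluxes of [F] through the edges above and below [v],
    and [res_ndown] brings both to the scale [res (level v)]. At level 0 the lower flux is absent,
    hence the sign condition. *)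
Lemma sum_level_le (F : nat -> R) v (c0 c1 : R) : (level v = 0%N -> 0 <= c1) ->
  c0 * res (level v) <= F (level v) - F (level v).+1 ->
  ((0 < level v)%N -> F (level v).-1 - F (level v) <= c1 * res (level v).-1) ->
  \sum_(y <- nbrs v) F (level y) <=
  (size (nbrs v))%:R * F (level v) - 2 * (c0 - c1) * res (level v).
Proof.
move=> c10 H0 H1; rewrite sum_level size_nbrs natrD; move: c10 H0 H1; set n := level v.
have [-> /(_ erefl) c10|n0 _] := posnP n => H0 H1.
  have := res_gt0 0; have : 0 <= c1 * res 0 by rewrite mulr_ge0.
  move: H0; rewrite /= mulr0n addr0 addr0 mulr2n; set a := F 0%N; set b := F 1%N; set s := res 0; nra.
have := res_ndown n0; have := H1 isT; move: H0.
set a := F n; set b := F n.+1; set e := F n.-1; set D := ndown n => H0 {}H1 H2.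
have : D%:R * (e - a) <= D%:R * (c1 * res n.-1) by rewrite ler_wpM2l// ler0n.
rewrite mulrCA H2 -[e *+ D]mulr_natr mulr2n; nra.
Qed.

Lemma sum_level_le0 (F : nat -> R) v (c : R) : 0 <= c ->
  c * res (level v) <= F (level v) - F (level v).+1 ->
  ((0 < level v)%N -> F (level v).-1 - F (level v) <= c * res (level v).-1) ->
  \sum_(y <- nbrs v) F (level y) <= (size (nbrs v))%:R * F (level v).
Proof.
move=> c0 H0 H1; have := sum_level_le (fun=> c0) H0 H1; rewrite subrr mulr0 mul0r subr0//.
Qed.

Lemma sum_nbrs_le (F G : vertex -> R) v : (forall y, y \in nbrs v -> F y <= G y) ->
  \sum_(y <- nbrs v) F y <= \sum_(y <- nbrs v) G y.
Proof. by move=> H; rewrite big_seq [leRHS]big_seq; apply: ler_sum. Qed.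

Lemma sum_nbrs_const (c : R) v : \sum_(y <- nbrs v) c = (size (nbrs v))%:R * c.
Proof. by rewrite big_const_seq count_predT iter_addr_0 mulr_natl. Qed.

End Resistance.
#[global] Hint Extern 0 (is_true (@Order.le _ _ _ (res _ _))) => exact: res_ge0 : core.
#[global] Hint Extern 0 (is_true (@Order.lt _ _ _ (res _ _))) => exact: res_gt0 : core.

(** * Machines that read a trajectory, and phases *)

Section Machines.
Context {R : realType} {d : measure_display} {Omega : measurableType d}.
Variables (P : probability Omega R) (X : nat -> Omega -> vertex).
Hypothesis srw : simple_random_walk P edge X.

Fixpoint state (Q : Type) (step : Q -> vertex -> Q) q0 (x : nat -> vertex) (t : nat) : Q :=
  if t is t'.+1 then step (state step q0 x t') (x t) else step q0 (x 0%N).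

Lemma state_hist (Q : Type) (step : Q -> vertex -> Q) q0 t w :
  foldr (fun y q => step q y) q0 (hist X t w) = state step q0 (X^~ w) t.
Proof. by elim: t => //= t ->. Qed.

Lemma head_hist x0 t w : head x0 (hist X t w) = X t w.
Proof. by case: t. Qed.

Section Machine.
Variables (Q : Type) (step : Q -> vertex -> Q) (q0 : Q) (bad Inv : Q -> vertex -> Prop).
Variables (phi : Q -> vertex -> R) (x0 : vertex).
Hypothesis Inv0 : Inv (step q0 x0) x0.
Hypothesis InvS : forall q v y, Inv q v -> ~ bad q v -> y \in nbrs v -> Inv (step q y) y.
Hypothesis phi_ge0 : forall q v, Inv q v -> 0 <= phi q v.
Hypothesis phi_bad : forall q v, Inv q v -> bad q v -> 1 <= phi q v.
Hypothesis phi_step : forall q v, Inv q v -> ~ bad q v ->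
  \sum_(y <- nbrs v) phi (step q y) y <= (size (nbrs v))%:R * phi q v.

Lemma machine_bound :
  measurable [set w | X 0%N w = x0 /\ exists t, bad (state step q0 (X^~ w) t) (X t w)] /\
  prob P [set w | X 0%N w = x0 /\ exists t, bad (state step q0 (X^~ w) t) (X t w)]
  <= phi (step q0 x0) x0.
Proof.
pose run := foldr (fun y q => step q y) q0.
pose T (h : seq vertex) := bad (run h) (head x0 h).
have E : [set w | X 0%N w = x0 /\ exists t, bad (state step q0 (X^~ w) t) (X t w)] =
    [set w | X 0%N w = x0 /\ exists t, T (hist X t w)].
  by apply/seteqP; split => w /= [-> [t H]]; split => //; exists t; move: H;
     rewrite /T /run state_hist head_hist.
rewrite E; split.
  apply: (@measurableI _ _ [set w | X 0%N w = x0]); first exact: srw.1.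
  exact: (measurable_exists_hist srw).
apply: (pr_supersolution (nb := nbrs) _ uniq_nbrs size_nbrs_gt0 srw
  (Inv := fun h => Inv (run h) (head x0 h)) (phi := fun h => phi (run h) (head x0 h))) => //.
- by move=> v h y; exact: InvS.
- by move=> h; exact: phi_ge0.
- by move=> h; exact: phi_bad.
by move=> v h; exact: phi_step.
Qed.

End Machine.

Section Phases.
Variables (S F : nat -> vertex -> bool) (phi : nat -> vertex -> R) (n : nat) (x0 : vertex).

(* The walk must enter [S 0], then [S 1], and so on up to [S n.-1], without
   entering [F j] while it waits for [S j]. *)
Definition phases (x : nat -> vertex) : Prop :=
  exists t : nat -> nat, t 0%N = 0%N /\
    forall j, (j < n)%N -> [/\ (t j < t j.+1)%N, S j (x (t j.+1)) &
      forall s, (t j < s < t j.+1)%N -> ~~ S j (x s) /\ ~~ F j (x s)].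

Definition phase_step (q : option nat) (y : vertex) : option nat :=
  if q is Some j then
    if S j y then Some j.+1 else if F j y then None else Some j
  else None.

(** When phase [j] begins, the walk sits in the previous target, whatever [S j] and [F j] say there:
    [phases] tests only strictly later positions. *)
Definition phase_dom j v := (~~ S j v && ~~ F j v) || ((0 < j)%N && S j.-1 v).

Lemma phases_state x : ~~ S 0%N (x 0%N) -> ~~ F 0%N (x 0%N) -> phases x ->
  exists t, state phase_step (Some 0%N) x t = Some n.
Proof.
move=> S0 F0 [t [t0 H]]; exists (t n).
suff K j : (j <= n)%N -> state phase_step (Some 0%N) x (t j) = Some j by exact: K.
elim: j => [|j IH] jn; first by rewrite t0 /= (negbTE S0) (negbTE F0).
have [tt Sj Hj] := H j jn.
have W s : (t j <= s < t j.+1)%N -> state phase_step (Some 0%N) x s = Some j.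
  move=> /andP[/subnKC <-]; elim: (s - t j)%N => [|i IHi] Hi.
    by rewrite addn0 IH// ltnW.
  rewrite addnS /= IHi; last lia.
  have [|/negbTE s1 /negbTE s2] := Hj (t j + i).+1; first lia.
  by rewrite /= s1 s2.
have E : t j.+1 = (t j.+1).-1.+1 by lia.
rewrite E /= W; last lia.
by rewrite /= -E Sj.
Qed.

Hypothesis S0 : ~~ S 0%N x0.
Hypothesis F0 : ~~ F 0%N x0.
Hypothesis phi_ge0 : forall j v, (j <= n)%N -> 0 <= phi j v.
Hypothesis phi_end : forall v, 1 <= phi n v.
Hypothesis phi_step : forall j v, (j < n)%N -> phase_dom j v ->
  \sum_(y <- nbrs v) (if S j y then phi j.+1 y else if F j y then 0 else phi j y)
  <= (size (nbrs v))%:R * phi j v.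

Lemma phases_bound : exists2 E, measurable E /\ prob P E <= phi 0%N x0 &
  [set w | X 0%N w = x0 /\ phases (X^~ w)] `<=` E.
Proof.
pose Inv (q : option nat) v := if q is Some j then (j <= n)%N /\ ((j < n)%N -> phase_dom j v) else True.
pose ph (q : option nat) v := if q is Some j then phi j v else 0.
have [|||||mE prE] := @machine_bound _ phase_step (Some 0%N) (fun q _ => q = Some n) Inv ph x0.
- by rewrite /= (negbTE S0) (negbTE F0) /=; split => // _; rewrite /phase_dom S0 F0.
- move=> [j|] v y //= [jn dj] nj yv.
  have {}jn : (j < n)%N by rewrite ltn_neqAle jn andbT; apply/eqP => E; apply: nj; rewrite E.
  case: ifP => Sy /=; first by split => // _; rewrite /phase_dom Sy orbT.
  by case: ifP => Fy //=; split; [exact: ltnW|rewrite /phase_dom Sy Fy].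
- by move=> [j|] v //= [jn _]; exact: phi_ge0.
- by move=> [j|] v //= _ [->].
- move=> [j|] v /=; last by move=> _ _; rewrite mulr0 sumr_le0.
  move=> [jn dj] nj.
  have {}jn : (j < n)%N by rewrite ltn_neqAle jn andbT; apply/eqP => E; apply: nj; rewrite E.
  apply: le_trans (phi_step jn (dj jn)).
  by apply: ler_sum => y _; case: ifP => // Sy; case: ifP.
eexists; first by split; [exact: mE|move: prE; rewrite /= (negbTE S0) (negbTE F0)].
move=> w /= [X0 H]; split => //.
by apply: phases_state H; rewrite X0.
Qed.

End Phases.

End Machines.

(** * Hitting a vertex before given levels *)

Section Dirichlet.
Variable R : realType.
Implicit Types (D : pred vertex) (g : vertex -> R) (B : pred nat).

Local Notation deg v := ((size (nbrs v))%:R : R).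

Lemma deg_gt0 v : 0 < deg v. Proof. by rewrite ltr0n size_nbrs_gt0. Qed.

(** Expected payoff of the walk stopped on [D], within [N] steps; an unfinished walk pays 0, so the
    value increases with [N] when [g] is nonnegative. *)
Fixpoint dirichlet D g N v : R :=
  if D v then g v
  else if N is N'.+1 then (\sum_(y <- nbrs v) dirichlet D g N' y) / deg v else 0.

Lemma dirichletD D g N v : D v -> dirichlet D g N v = g v.
Proof. by case: N => /= [|N] ->. Qed.

Lemma dirichletS D g N v : ~~ D v ->
  dirichlet D g N.+1 v = (\sum_(y <- nbrs v) dirichlet D g N y) / deg v.
Proof. by move=> /negbTE /= ->. Qed.

Lemma dirichlet_le D g (f : vertex -> R) : (forall v, 0 <= f v) ->
  (forall v, D v -> g v <= f v) ->
  (forall v, ~~ D v -> \sum_(y <- nbrs v) f y <= deg v * f v) ->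
  forall N v, dirichlet D g N v <= f v.
Proof.
move=> f0 gf sf; elim=> [|N IH] v; first by case Dv: (D v) => /=; rewrite Dv ?gf.
have [Dv|Dv] := boolP (D v); first by rewrite dirichletD ?gf.
rewrite dirichletS// ler_pdivrMr ?deg_gt0// mulrC.
by apply: le_trans (sf _ Dv); apply: sum_nbrs_le.
Qed.

Section Bounded.
Variables (D : pred vertex) (g : vertex -> R).
Hypothesis g01 : forall v, 0 <= g v <= 1.

Lemma dirichlet_ge0 N v : 0 <= dirichlet D g N v.
Proof.
elim: N v => [|N IH] v /=; case: ifP => // _; try by case/andP: (g01 v).
by rewrite divr_ge0// sumr_ge0.
Qed.

Lemma dirichlet_le1 N v : dirichlet D g N v <= 1.
Proof.
apply: (@dirichlet_le _ _ (fun=> 1)) => // [w _|w _]; first by case/andP: (g01 w).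
by rewrite sum_nbrs_const.
Qed.

Lemma dirichlet_nondecreasing v : nondecreasing_seq (dirichlet D g ^~ v).
Proof.
apply/nondecreasing_seqP => N; elim: N v => [|N IH] v.
  have [Dv|Dv] := boolP (D v); first by rewrite !dirichletD.
  by rewrite [leLHS]/= (negbTE Dv) dirichlet_ge0.
have [Dv|Dv] := boolP (D v); first by rewrite !dirichletD.
rewrite !dirichletS// ler_pM2r ?invr_gt0 ?deg_gt0//.
by apply: sum_nbrs_le.
Qed.

Definition dirlim v : R := limn (dirichlet D g ^~ v).

Lemma dirichlet_cvg v : dirichlet D g ^~ v @ \oo --> dirlim v.
Proof.
apply: nondecreasing_is_cvgn; first exact: dirichlet_nondecreasing.
by exists 1 => _ [N _ <-]; exact: dirichlet_le1.
Qed.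

Lemma dirlim_le v c : (forall N, dirichlet D g N v <= c) -> dirlim v <= c.
Proof.
move=> H; apply: limr_le; first by apply/cvg_ex; exists (dirlim v); exact: dirichlet_cvg.
exact: nearW.
Qed.

Lemma dirlim_ge v N : dirichlet D g N v <= dirlim v.
Proof.
apply: nondecreasing_cvgn_le; first exact: dirichlet_nondecreasing.
by apply/cvg_ex; exists (dirlim v); exact: dirichlet_cvg.
Qed.

Lemma dirlim_ge0 v : 0 <= dirlim v.
Proof. exact: le_trans (dirichlet_ge0 0 v) (dirlim_ge v 0). Qed.

Lemma dirlimD v : D v -> dirlim v = g v.
Proof.
move=> Dv; apply/eqP; rewrite eq_le -{2}(dirichletD g 0 Dv) dirlim_ge andbT.
by apply: dirlim_le => N; rewrite dirichletD.
Qed.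

Lemma dirlim_superharmonic v : ~~ D v ->
  \sum_(y <- nbrs v) dirlim y <= deg v * dirlim v.
Proof.
move=> Dv.
have cv : (\sum_(y <- nbrs v) dirichlet D g N y) @[N --> \oo] --> \sum_(y <- nbrs v) dirlim y.
  elim: (nbrs v) => [|y s IH].
    under eq_fun do rewrite big_nil.
    by rewrite big_nil; exact: cvg_cst.
  under eq_fun do rewrite big_cons.
  by rewrite big_cons; apply: cvgD => //; exact: dirichlet_cvg.
rewrite -(cvg_lim _ cv)//; apply: limr_le; first by apply/cvg_ex; eexists; exact: cv.
apply: nearW => N; rewrite mulrC -ler_pdivrMr ?deg_gt0// -dirichletS//.
exact: dirlim_ge.
Qed.

End Bounded.

Definition hit_pred B (s : vertex) : pred vertex := fun v => (v == s) || B (level v).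
Definition indic (s v : vertex) : R := (v == s)%:R.

Lemma indic01 s v : 0 <= indic s v <= 1.
Proof. by rewrite /indic; case: eqP => _; rewrite ?lexx ?ler01. Qed.

Lemma dirichlet_flip h B s N v :
  dirichlet (hit_pred B (flip h s)) (indic (flip h s)) N (flip h v) =
  dirichlet (hit_pred B s) (indic s) N v.
Proof.
have fE w : (flip h w == flip h s) = (w == s) by rewrite (can_eq (flipK h)).
have DE w : hit_pred B (flip h s) (flip h w) = hit_pred B s w by rewrite /hit_pred fE.
elim: N v => [|N IH] v; first by rewrite /= DE /indic fE.
have [Dv|Dv] := boolP (hit_pred B s v); first by rewrite !dirichletD ?DE// /indic fE.
rewrite !dirichletS ?DE// sum_flip !size_nbrs level_flip; congr (_ / _).
by apply: eq_bigr => y _; rewrite IH.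
Qed.

(* The probability of hitting [s] before the levels in [B]. *)
Definition hitting B s v : R := dirlim (hit_pred B s) (indic s) v.

(** * From levels to single vertices *)

Section HittingBound.
Variables (B : pred nat) (n : nat) (G : nat -> R).
Hypothesis G0 : forall m, 0 <= G m.
Hypothesis Gn : forall v, level v = n ->
  if B n then 1 <= G n
  else \sum_(y <- nbrs v) G (level y) + deg v <= deg v * G n.
Hypothesis GB : forall v, level v != n -> ~~ B (level v) ->
  \sum_(y <- nbrs v) G (level y) <= deg v * G (level v).

(** The expected number of vertices of level [n] that are hit is at most the expected number of
    visits to that level, for which [G] is a supersolution. At level [n] the term [s = v] is the
    present visit, and the other terms continue with the walk. *)
Lemma sum_dirichlet_le N v :
  \sum_(s <- level_list n) dirichlet (hit_pred B s) (indic s) N v <= G (level v).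
Proof.
have S1 w : level w = n -> \sum_(s <- level_list n) indic s w = 1.
  move=> lw; rewrite (bigD1_seq w) ?uniq_level_list ?mem_level_list ?lw//=.
  rewrite /indic eqxx big1 ?addr0// => s /negbTE; rewrite eq_sym => -> //.
elim: N v => [|N IH] v.
  have [lv|lv] := eqVneq (level v) n.
    apply: (@le_trans _ _ (\sum_(s <- level_list n) indic s v)).
      apply: ler_sum => s _ /=; rewrite /hit_pred /indic; case: ifP => //.
    rewrite S1// lv; have := Gn lv; case: ifP => // _.
    have := deg_gt0 v; have : 0 <= \sum_(y <- nbrs v) G (level y) by apply: sumr_ge0.
    by move: (deg v) (G n) (\sum_(_ <- _) _) => D g S h1 h2 h3; nra.
  rewrite big_seq big1// => s; rewrite mem_level_list => /eqP ls.
  rewrite /= /hit_pred /indic; have /negbTE -> // : v != s.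
    by apply: contraNneq lv => ->; rewrite ls.
  by case: ifP.
have [Bv|Bv] := boolP (B (level v)).
  rewrite (eq_bigr (fun s => indic s v)); last by move=> s _; rewrite dirichletD// /hit_pred Bv orbT.
  have [lv|lv] := eqVneq (level v) n.
    by rewrite S1// lv; have := Gn lv; rewrite -lv Bv.
  rewrite big_seq big1// => s; rewrite mem_level_list => /eqP ls.
  by rewrite /indic; have /negbTE -> // : v != s; apply: contraNneq lv => ->; rewrite ls.
have A s : s != v -> dirichlet (hit_pred B s) (indic s) N.+1 v =
    (\sum_(y <- nbrs v) dirichlet (hit_pred B s) (indic s) N y) / deg v.
  by move=> sv; rewrite dirichletS// /hit_pred (negbTE Bv) orbF eq_sym.
have Q : \sum_(s <- level_list n) (\sum_(y <- nbrs v) dirichlet (hit_pred B s) (indic s) N y) / deg v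
    <= (\sum_(y <- nbrs v) G (level y)) / deg v.
  rewrite -mulr_suml ler_pM2r ?invr_gt0 ?deg_gt0// exchange_big.
  exact: sum_nbrs_le.
have [lv|lv] := eqVneq (level v) n.
  have vn : v \in level_list n by rewrite mem_level_list lv.
  have E1 : dirichlet (hit_pred B v) (indic v) N.+1 v = 1.
    by rewrite dirichletD /hit_pred /indic ?eqxx.
  rewrite (bigD1_seq v) ?uniq_level_list//= -/(dirichlet _ _ N.+1 v) E1.
  apply: (@le_trans _ _ (1 + (\sum_(y <- nbrs v) G (level y)) / deg v)).
    rewrite lerD2l; apply: le_trans Q; rewrite [leRHS](bigD1_seq v) ?uniq_level_list//=.
    rewrite (eq_bigr _ A) ler_wpDl// divr_ge0// sumr_ge0// => y _.
    exact/dirichlet_ge0/indic01.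
  have := Gn lv; rewrite -lv (negbTE Bv) lv => H2.
  by rewrite -(ler_pM2l (deg_gt0 v)) mulrDr mulr1 mulrCA divff ?gt_eqF ?deg_gt0// mulr1 addrC.
rewrite big_seq (eq_bigr (fun s => (\sum_(y <- nbrs v) dirichlet (hit_pred B s) (indic s) N y) / deg v)).
  rewrite -big_seq; apply: le_trans Q _; rewrite ler_pdivrMr ?deg_gt0// mulrC; exact: GB.
move=> s; rewrite mem_level_list => /eqP ls; apply: A.
by apply: contraNneq lv => <-; rewrite ls.
Qed.

(** By [flip_transitive] all [2 ^ width n] vertices of the level have the same chance of being hit
    from [v], so each has the share [res n] of the sum. *)
Lemma hitting_le s v : level s = n ->
  (level v <= window_start n)%N || (n <= window_start (level v))%N ->
  hitting B s v <= res R n * G (level v).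
Proof.
move=> ls far; apply: dirlim_le => [|N]; first exact: indic01.
have E t : t \in level_list n -> dirichlet (hit_pred B t) (indic t) N v =
    dirichlet (hit_pred B s) (indic s) N v.
  rewrite mem_level_list => /eqP lt.
  have [||h [hv hs]] := @flip_transitive v s t; rewrite ?ls ?lt//.
  by rewrite -{1}hv -{1 2}hs dirichlet_flip.
have := sum_dirichlet_le N v; rewrite (eq_big_seq _ E) big_const_seq count_predT.
rewrite iter_addr_0 size_level_list -mulr_natl natrX -ler_pdivlMl ?exprn_gt0//.
by rewrite -exprVn.
Qed.

End HittingBound.

Lemma hitting_ge0 B s v : 0 <= hitting B s v.
Proof. exact/dirlim_ge0/indic01. Qed.

Lemma hittingE B s v : (v == s) || B (level v) -> hitting B s v = (v == s)%:R.
Proof. by move=> H; rewrite /hitting dirlimD//; exact: indic01. Qed.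

Lemma hitting_superharmonic B s v : v != s -> ~~ B (level v) ->
  \sum_(y <- nbrs v) hitting B s y <= deg v * hitting B s v.
Proof.
move=> vs Bv; apply: dirlim_superharmonic; first exact: indic01.
by rewrite /hit_pred negb_or vs.
Qed.

End Dirichlet.

(** * Green functions *)

Section HittingLevels.
Variable R : realType.
Local Notation rho := (rho R).
Local Notation res := (res R).

Lemma deg_le4 v : (size (nbrs v))%:R <= 4 :> R.
Proof. by rewrite size_nbrs ler_nat; have := ndown_le2 (level v); lia. Qed.

Lemma rho_geq m n : (n <= m)%N -> rho m n = 0.
Proof. by move=> nm; rewrite /rho big_geq. Qed.

(* Up to the factor [size (nbrs v) <= 4], the expected number of visits to level [n]
   before level [hi], for a walk started at level [m]. *)
Definition green n hi m : R := 2 / res n * rho (maxn m n) hi.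

Lemma green_ge0 n hi m : 0 <= green n hi m.
Proof. by rewrite mulr_ge0 ?rho_ge0// divr_ge0. Qed.

Lemma greenE n hi m : (n <= m)%N -> green n hi m = 2 / res n * rho m hi.
Proof. by move=> nm; rewrite /green (maxn_idPl nm). Qed.

Lemma green_below n hi m : (m <= n)%N -> green n hi m = 2 / res n * rho n hi.
Proof. by move=> nm; rewrite /green (maxn_idPr nm). Qed.

(** The factor 2 in [green] serves here: the sum falls short of the harmonic value by 4, which is at
    least the degree. *)
Lemma green_at n hi w : (n < hi)%N -> level w = n ->
  \sum_(y <- nbrs w) green n hi (level y) + (size (nbrs w))%:R <=
  (size (nbrs w))%:R * green n hi n.
Proof.
move=> sh lw; pose c := 2 / res n.
have crn : c * res n = 2 by rewrite /c divfK// gt_eqF.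
have := @sum_level_le R (green n hi) w c 0 (fun=> lexx _).
rewrite lw subr0 (@greenE _ _ n)// (@greenE _ _ n.+1)// -[2 * c * _]mulrA crn -/c => H.
apply: (@le_trans _ _ ((size (nbrs w))%:R * (c * rho n hi) - 2 * 2 + (size (nbrs w))%:R)).
  rewrite lerD2r; apply: H.
    by rewrite (rhoSl R sh) mulrDr addrK crn.
  by move=> n0; rewrite green_below ?leq_pred// subrr mul0r.
by have := deg_le4 w; lra.
Qed.

Lemma green_step n hi w : level w != n -> level w != hi ->
  \sum_(y <- nbrs w) green n hi (level y) <= (size (nbrs w))%:R * green n hi (level w).
Proof.
move=> wn wh; pose c := 2 / res n; have c0 : 0 <= c by rewrite /c divr_ge0.
pose c' := if (n < level w < hi)%N then c else 0.
apply: (@sum_level_le0 R (green n hi) w c'); first by rewrite /c'; case: ifP.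
  rewrite /c'; case: ifP => [/andP[nw whi]|H].
    by rewrite !greenE ?(rhoSl R whi) ?mulrDr ?addrK ?(ltnW nw)// ltnW// ltnW.
  rewrite mul0r; have [wn'|nw] := leqP (level w) n.
    by rewrite !green_below ?subrr//; lia.
  by rewrite !greenE ?rho_geq ?subrr//; lia.
move=> w0; rewrite /c'; case: ifP => [/andP[nw whi]|H].
  have E : (level w).-1.+1 = level w by lia.
  rewrite !greenE; try lia; rewrite (@rhoSl R (level w).-1); last lia.
  by rewrite E mulrDr addrK.
rewrite mul0r; have [wn'|nw] := leqP (level w) n.
  by rewrite !green_below ?subrr//; lia.
by rewrite !greenE ?rho_geq ?subrr//; lia.
Qed.

Lemma hitting_up_le s v hi : (level s < hi)%N -> (level v <= window_start (level s))%N ->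
  hitting R (pred1 hi) s v <= 2 * rho (level s) hi.
Proof.
set n := level s => sh vs.
have := @hitting_le R (pred1 hi) n (green n hi) _ _ _ s v erefl _.
rewrite (@green_below _ _ (level v)); last by apply: leq_trans vs _; rewrite /window_start leq_subr.
have -> : res n * (2 / res n * rho n hi) = 2 * rho n hi.
  by rewrite mulrA [2 / _]mulrC mulrA divff ?mul1r// gt_eqF.
apply.
- exact: green_ge0.
- by move=> w lw /=; rewrite ltn_eqF//; exact: green_at.
- by move=> w wn /= wh; exact: green_step.
- by rewrite vs.
Qed.

(** The potential mirrors [green]: it is killed at [lo] and constant above the level of [s]. *)
Lemma hitting_down_le s v lo : (lo < level s)%N -> (level s <= window_start (level v))%N ->
  hitting R (pred1 lo) s v <= 2 * rho lo (level s).
Proof.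
set n := level s => sh vs.
pose c := 2 / res n; pose G m := c * rho lo (minn m n).
have c0 : 0 <= c by rewrite /c divr_ge0.
have crn : c * res n = 2 by rewrite /c divfK// gt_eqF.
have GE m : (m <= n)%N -> G m = c * rho lo m by move=> nm; rewrite /G (minn_idPl nm).
have Gn m : (n <= m)%N -> G m = c * rho lo n by move=> nm; rewrite /G (minn_idPr nm).
have := @hitting_le R (pred1 lo) n G _ _ _ s v erefl _.
rewrite (Gn (level v)); last by apply: leq_trans vs _; rewrite /window_start leq_subr.
rewrite (mulrA (res n)) [res n * c]mulrC crn; apply.
- by move=> m; rewrite mulr_ge0// rho_ge0.
- move=> w lw /=; rewrite gtn_eqF//.
  have := @sum_level_le R G w 0 (- c).
  rewrite lw (GE n)// opprK add0r -[2 * c * _]mulrA crn => H.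
  apply: (@le_trans _ _ ((size (nbrs w))%:R * (c * rho lo n) - 2 * 2 + (size (nbrs w))%:R)).
    rewrite lerD2r; apply: H; first by lia.
      by rewrite Gn// mul0r subrr.
    move=> n0; have E : n.-1.+1 = n by lia.
    rewrite GE ?leq_pred// -{2}E rhoSr; last lia.
    by rewrite mulrDr opprD addrA subrr add0r mulNr.
  by have := deg_le4 w; lra.
- move=> w wn /= wl.
  have H m : (m < lo)%N -> G m = 0.
    by move=> ml; rewrite GE ?rho_geq ?mulr0//; lia.
  have [wlo|low] := ltnP (level w) lo.
    have Hs := H _ wlo; rewrite Hs mulr0 big_seq sumr_le0// => y /level_nbrs ly.
    rewrite GE ?rho_geq ?mulr0//; lia.
  have {}low : (lo < level w)%N by rewrite ltn_neqAle eq_sym wl.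
  pose c' := if (level w < n)%N then - c else 0.
  have := @sum_level_le R G w c' c'; rewrite subrr mulr0 mul0r subr0; apply.
  + by lia.
  + rewrite /c'; case: ifP => nw.
      by rewrite !GE ?(ltnW nw)// rhoSr ?(ltnW low)// mulrDr opprD addrA subrr add0r mulNr.
    by rewrite !Gn ?subrr ?mul0r//; lia.
  + move=> w0; rewrite /c'; have E : (level w).-1.+1 = level w by lia.
    case: ifP => nw.
      rewrite !GE; try lia; rewrite -{2}E rhoSr; last lia.
      by rewrite mulrDr opprD addrA subrr add0r mulNr.
    by rewrite !Gn ?subrr ?mul0r//; lia.
- by rewrite vs orbT.
Qed.

(** * Uniformity of the exit position *)

Section Exit.
Variables (m a : nat).
Hypothesis constw : forall k, (m - a <= k <= m + a)%N -> width k = a.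

Let am : (a <= m)%N. Proof. by rewrite -(@constw m) ?width_leq//; lia. Qed.

Let rhoE i j : (m - a <= i <= j)%N -> (j <= m + a)%N -> rho i j = (j - i)%:R * 2^-1 ^+ a.
Proof.
move=> /andP[h1 h2] h3; rewrite /rho (eq_big_nat _ _ (F2 := fun=> 2^-1 ^+ a)).
  by rewrite big_const_nat iter_addr_0 mulr_natl.
by move=> k Hk; rewrite /res constw//; lia.
Qed.

Hypothesis a_gt0 : (0 < a)%N.

Let half i j : (i + (m - a) = j)%N -> (i = a)%N -> 
  rho (m - a) j / rho (m - a) (m + a) = 2^-1.
Proof.
move=> <- ->; rewrite !rhoE; try lia.
have -> : (a + (m - a) - (m - a) = a)%N by lia.
have -> : (m + a - (m - a) = a + a)%N by lia.
have H : (a%:R : R) != 0 by rewrite pnatr_eq0; lia.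
have -> : (a + a)%:R * 2^-1 ^+ a = 2 * (a%:R * 2^-1 ^+ a) :> R by rewrite natrD; ring.
by rewrite invfM mulrCA divff ?mulr1// mulf_neq0.
Qed.

(** At distance [a] no letter of [v] survives, so the exit is spread evenly over its level, and each
    of the two levels is reached first with probability one half. The potentials [G] are the affine
    exit probabilities. *)
Lemma hitting_exit_le s v : level v = m -> (level s == m - a)%N || (level s == m + a)%N ->
  hitting R (pred2 (m - a)%N (m + a)%N) s v <= 2^-1 ^+ a / 2.
Proof.
move=> lv ls.
have r0 : 0 < rho (m - a) (m + a) by apply: rho_gt0; lia.
have rs : res (level s) = 2^-1 ^+ a by rewrite /res constw//; case/orP: ls => /eqP ->; lia.
have half1 : rho (m - a) m / rho (m - a) (m + a) = 2^-1 by apply: (half (i := a)); lia.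
have half2 : rho m (m + a) / rho (m - a) (m + a) = 2^-1.
  have := @rho_cat R (m - a) m (m + a); rewrite (_ : (_ <= _ <= _)%N); last lia.
  move=> /(_ isT) E; apply: (addrI (rho (m - a) m / rho (m - a) (m + a))).
  by rewrite -mulrDl -E divff ?gt_eqF// half1; field.
have wm : window_start m = (m - a)%N by rewrite /window_start constw//; lia.
case/orP: ls => /eqP ls.
- pose G k := rho k (m + a) / rho (m - a) (m + a).
  have := @hitting_le R (pred2 (m - a)%N (m + a)%N) (level s) G _ _ _ s v erefl _.
  rewrite rs lv /G half2; apply.
  + by move=> k; rewrite divr_ge0 ?rho_ge0 ?ltW.
  + by move=> w lw; rewrite /= ls eqxx /= divff// gt_eqF.
  + move=> w wn /=; rewrite negb_or => /andP[w1 w2].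
    have Z k : (m + a <= k)%N -> G k = 0 by move=> H; rewrite /G (rho_geq H) mul0r.
    pose c := if (level w < m + a)%N then (rho (m - a) (m + a))^-1 else 0.
    apply: (@sum_level_le0 R G w c).
    * by rewrite /c; case: ifP => // _; rewrite invr_ge0 ltW.
    * rewrite /c; case: ifP => H.
        by rewrite /G (rhoSl R H) -mulrBl addrK mulrC.
      by rewrite mul0r !Z ?subrr//; lia.
    * move=> w0; have E : (level w).-1.+1 = level w by lia.
      rewrite /c; case: ifP => H.
        by rewrite /G (@rhoSl R (level w).-1) ?E -?mulrBl ?addrK 1?mulrC//; lia.
      by rewrite mul0r !Z ?subrr//; lia.
  + by rewrite wm -ls leqnn orbT.
- pose G k := rho (m - a) k / rho (m - a) (m + a).
  have := @hitting_le R (pred2 (m - a)%N (m + a)%N) (level s) G _ _ _ s v erefl _.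
  rewrite rs lv /G half1; apply.
  + by move=> k; rewrite divr_ge0 ?rho_ge0 ?ltW.
  + by move=> w lw; rewrite /= ls eqxx orbT divff// gt_eqF.
  + move=> w wn /=; rewrite negb_or => /andP[w1 w2].
    have [wl|wl] := ltnP (level w) (m - a).
      rewrite /G [X in _ * (X / _)]rho_geq ?(ltnW wl)// mul0r mulr0 big_seq sumr_le0// => y /level_nbrs ly.
      by rewrite rho_geq ?mul0r//; lia.
    have {}wl : (m - a < level w)%N by rewrite ltn_neqAle eq_sym w1.
    have GS k : (m - a <= k)%N -> G k - G k.+1 = - (rho (m - a) (m + a))^-1 * res k.
      by move=> mk; rewrite /G rhoSr// -mulrBl opprD addrA subrr add0r mulNr mulrC mulNr.
    have := @sum_level_le R G w (- (rho (m - a) (m + a))^-1) (- (rho (m - a) (m + a))^-1).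
    rewrite subrr mulr0 mul0r subr0; apply; first by lia.
      by rewrite GS// ltnW.
    by move=> w0; have E : (level w).-1.+1 = level w by [lia]; rewrite -{2}E GS//; lia.
  + have -> : window_start (level s) = m by rewrite ls /window_start constw; lia.
    by rewrite leqnn.
Qed.

End Exit.

End HittingLevels.

(** * Crossings, returns and escapes *)

Definition at_level (s : seq nat) (j : nat) (v : vertex) : bool := level v == nth 0%N s j.
Definition at_level_opt (f : seq (option nat)) (j : nat) (v : vertex) : bool :=
  nth None f j == Some (level v).

Section PhaseBounds.
Context {R : realType} {d : measure_display} {Omega : measurableType d}.
Variables (P : probability Omega R) (X : nat -> Omega -> vertex).
Hypothesis srw : simple_random_walk P edge X.
Variable x0 : vertex.
Local Notation rho := (rho R).
Local Notation res := (res R).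
Local Notation deg v := ((size (nbrs v))%:R : R).

(** A bound on the outer measure, so that events about cutpoints require no measurability proof. *)
Definition prob_le (A : set Omega) (c : R) : Prop :=
  exists2 E, measurable E /\ prob P E <= c & A `<=` E.

(** Gambler's ruin in the coordinate [rho]. Below [p] the potential is 0, since [rho p] is then an
    empty sum. *)
Lemma escape_step p t v : (p < t)%N -> level v != p ->
  \sum_(y <- nbrs v) (if level y == t then 1 else if level y == p then 0
                      else rho p (level y) / rho p t) <= deg v * (rho p (level v) / rho p t).
Proof.
move=> pt vp; pose z m := rho p m / rho p t.
have p0 := rho_gt0 R pt.
have zt : z t = 1 by rewrite /z divff// gt_eqF.
have zp m : (m <= p)%N -> z m = 0 by move=> mp; rewrite /z rho_geq// mul0r.
rewrite (eq_bigr (fun y => z (level y))); last first.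
  by move=> y _; case: eqP => [->|_]; rewrite ?zt//; case: eqP => [->|_]//; rewrite zp.
rewrite -/(z (level v)); have [vp'|pv] := ltnP (level v) p.
  by rewrite zp ?(ltnW vp')// mulr0 big_seq sumr_le0// => y /level_nbrs ly; rewrite zp//; lia.
have {}pv : (p < level v)%N by rewrite ltn_neqAle eq_sym vp.
have zS m : (p <= m)%N -> z m - z m.+1 = - (rho p t)^-1 * res m.
  by move=> pm; rewrite /z rhoSr//; field; rewrite gt_eqF.
have := @sum_level_le R z v (- (rho p t)^-1) (- (rho p t)^-1).
rewrite subrr mulr0 mul0r subr0; apply; first by lia.
  by rewrite zS// ltnW.
by move=> v0; have E : (level v).-1.+1 = level v by [lia]; rewrite -{2}E zS//; lia.
Qed.

Lemma cut_bound p q K : (level x0 < q)%N -> (p < q)%N -> (q < K)%N ->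
  prob_le [set w | X 0%N w = x0 /\
      phases (at_level [:: q; K]) (at_level_opt [:: None; Some p]) 2 (X^~ w)]
    (rho p q / rho p K).
Proof.
move=> xq pq qK; have pK := ltn_trans pq qK.
pose phi j v := nth 1 [:: rho p q / rho p K; rho p (level v) / rho p K] j.
apply: (phases_bound srw (phi := phi)).
- by rewrite /at_level /= neq_ltn xq.
- by [].
- by move=> [|[|[|]]] v //= _; rewrite /phi /= divr_ge0 ?rho_ge0.
- by move=> v; rewrite /phi.
- move=> [|[|]] //= v _.
    move=> _; rewrite /phi /= (eq_bigr (fun=> rho p q / rho p K)) ?sum_nbrs_const//.
    by move=> y _; rewrite /at_level /=; case: eqP => [->|].
  move=> D; rewrite /phi /= /at_level /= /at_level_opt /=.
  apply: le_trans (escape_step pK _); last first.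
    move: D; rewrite /phase_dom /at_level /at_level_opt /= => /orP[/andP[_]|/eqP ->].
      by apply: contraNneq => ->.
    by rewrite gtn_eqF.
  apply: ler_sum => y _; case: eqP => // _.
  by case: eqP => [[->]|H]; [rewrite eqxx|case: eqP => // E; rewrite E in H].
Qed.

(* From [hi] the walk climbs to [q], comes back to [lo], climbs to [hi], and then
   escapes to [K] without a further visit to [lo]. *)
Lemma single_return_bound lo hi q K :
  (level x0 < lo)%N -> (lo < hi)%N -> (hi < q)%N -> (q < K)%N ->
  prob_le [set w | X 0%N w = x0 /\
      phases (at_level [:: hi; q; lo; hi; K])
        (at_level_opt [:: None; Some lo; None; None; Some lo]) 5 (X^~ w)]
    (rho lo hi / rho lo q * (rho lo hi / rho lo K)).
Proof.
move=> xlo lohi hiq qK.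
have loq := ltn_trans lohi hiq; have loK := ltn_trans loq qK.
have dv a b : 0 <= rho lo a / rho lo b by rewrite divr_ge0 ?rho_ge0.
pose z := rho lo hi / rho lo K; have z0 : 0 <= z by exact: dv.
pose phi j v := nth 1 [:: rho lo hi / rho lo q * z; rho lo (level v) / rho lo q * z; z; z;
  rho lo (level v) / rho lo K] j.
apply: (phases_bound srw (phi := phi)).
- by rewrite /at_level /= neq_ltn (ltn_trans xlo lohi).
- by [].
- by move=> [|[|[|[|[|[|]]]]]] v //= _; rewrite /phi /=; do ?[exact: dv|exact: mulr_ge0 (dv _ _) z0].
- by move=> v; rewrite /phi.
have K1 v t : (lo < t)%N -> level v != lo -> \sum_(y <- nbrs v)
     (if at_level [:: t] 0 y then 1 else if at_level_opt [:: Some lo] 0 y then 0 else rho lo (level y) / rho lo t)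
     <= deg v * (rho lo (level v) / rho lo t).
  move=> lot vl; apply: le_trans (escape_step lot vl); apply: ler_sum => y _.
  rewrite /at_level /at_level_opt /=; case: eqP => // _.
  by case: eqP => [[->]|H]; [rewrite eqxx|case: eqP => // E; rewrite E in H].
have D1 v j : (j == 1%N) || (j == 4%N) ->
  phase_dom (at_level [:: hi; q; lo; hi; K]) (at_level_opt [:: None; Some lo; None; None; Some lo]) j v ->
  level v != lo.
  by case/orP => /eqP ->; rewrite /phase_dom /at_level /at_level_opt /= => /orP[/andP[_]|/eqP ->];
    rewrite ?(gtn_eqF lohi)//; apply: contraNneq => ->.
move=> [|[|[|[|[|]]]]] // v _ D; rewrite /phi /=.
- rewrite -sum_nbrs_const; apply: ler_sum => y _; rewrite /at_level /at_level_opt /=.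
  by case: eqP => [->|].
- rewrite mulrA; apply: le_trans (ler_wpM2r z0 (K1 v q loq (D1 _ _ _ D))) => //.
  rewrite mulr_suml; apply: ler_sum => y _; rewrite /at_level /at_level_opt /=.
  by case: ifP; rewrite ?mul1r//; case: ifP; rewrite ?mul0r.
- by rewrite -sum_nbrs_const; apply: ler_sum => y _ /=; case: ifP.
- rewrite -sum_nbrs_const; apply: ler_sum => y _; rewrite /at_level /at_level_opt /=.
  by case: eqP => [->|].
exact: K1 (D1 _ _ _ D).
Qed.

(** [B - rho 0] decreases with the level, so it is superharmonic even at level 0, where all edges go
    up. With [B] the total resistance the bound vanishes as [K] grows. *)
Lemma return_bound (B : R) m K : (forall n, rho 0 n <= B) -> (level x0 < K)%N ->
  rho 0 m < B ->
  prob_le [set w | X 0%N w = x0 /\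
      phases (at_level [:: K; m]) (at_level_opt [:: None; None]) 2 (X^~ w)]
    ((B - rho 0 K) / (B - rho 0 m)).
Proof.
move=> rB xK mB; have d0 : 0 < B - rho 0 m by rewrite subr_gt0.
pose f n := (B - rho 0 n) / (B - rho 0 m).
have f0 n : 0 <= f n by rewrite divr_ge0 ?subr_ge0 ?(ltW mB)//.
pose phi j v := nth 1 [:: f K; f (level v)] j.
apply: (phases_bound srw (phi := phi)).
- by rewrite /at_level /= neq_ltn xK.
- by [].
- by move=> [|[|[|]]] v //= _; rewrite /phi /=.
- by move=> v; rewrite /phi.
- move=> [|[|]] // v _ D; rewrite /phi /=.
    rewrite -sum_nbrs_const; apply: ler_sum => y _; rewrite /at_level /at_level_opt /=.
    by case: eqP => [->|].
  have fS n : f n - f n.+1 = (B - rho 0 m)^-1 * res n.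
    by rewrite /f rhoSr//; field; rewrite gt_eqF.
  apply: le_trans (@sum_level_le0 R f v (B - rho 0 m)^-1 _ _ _).
  + apply: ler_sum => y _; rewrite /at_level /at_level_opt /=.
    by case: eqP => [->|]//; rewrite /f divff// gt_eqF.
  + by rewrite invr_ge0 ltW.
  + by rewrite fS.
  + by move=> v0; have E : (level v).-1.+1 = level v by [lia]; rewrite -{2}E fS.
Qed.

Section Crossings.
Variables (s : vertex) (lo hi : nat).

Definition cross_target (j : nat) (v : vertex) : bool :=
  match (j %% 4)%N with
  | 0 => level v == lo
  | 2 => level v == hi
  | _ => v == s
  end.

Definition cross_avoid (j : nat) (v : vertex) : bool :=
  match (j %% 4)%N with
  | 1 => level v == hi
  | 3 => level v == lo
  | _ => false
  end.

(* [s] is visited during each of the first five crossings between [lo] and [hi]. *)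
Lemma crossings_bound : (level x0 < lo)%N -> (lo < level s < hi)%N ->
  (lo <= window_start (level s))%N -> (level s <= window_start hi)%N ->
  prob_le [set w | X 0%N w = x0 /\ phases cross_target cross_avoid 10 (X^~ w)]
    ((2 * rho (level s) hi) ^+ 3 * (2 * rho lo (level s)) ^+ 2).
Proof.
move=> xlo /andP[los shi] lofar hifar.
set u := 2 * rho (level s) hi; set e := 2 * rho lo (level s).
have u0 : 0 <= u by rewrite mulr_ge0// rho_ge0.
have e0 : 0 <= e by rewrite mulr_ge0// rho_ge0.
(* [K j] is the product of the factors still to come at phase [j], apart from the visit in progress
   during odd phases, which [H j] carries. Upward visits cost [u], downward ones [e]. *)
pose K := nth 1 [:: u ^+ 3 * e ^+ 2; u ^+ 2 * e ^+ 2; u ^+ 2 * e ^+ 2; u ^+ 2 * e; u ^+ 2 * e;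
  u * e; u * e; u; u; 1; 1].
have K0 j : 0 <= K j.
  by rewrite /K; move: j => [|[|[|[|[|[|[|[|[|[|[|j]]]]]]]]]]] /=; rewrite ?nth_nil;
    do ?[exact: ler01|exact: u0|exact: e0|apply: mulr_ge0|apply: exprn_ge0].
pose H j v := match (j %% 4)%N with
  | 1 => hitting R (pred1 hi) s v | 3 => hitting R (pred1 lo) s v | _ => 1 end.
have H0 j v : 0 <= H j v.
  by rewrite /H; case: (j %% 4)%N => [|[|[|[|]]]]// *; exact: hitting_ge0.
pose phi j v := K j * H j v.
have -> : u ^+ 3 * e ^+ 2 = phi 0%N x0 by rewrite /phi /K /H /= mulr1.
apply: (phases_bound srw (phi := phi)).
- by rewrite /cross_target /= neq_ltn xlo.
- by [].
- by move=> j v _; rewrite mulr_ge0.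
- by move=> v; rewrite /phi /K /H /= mulr1.
have even_step j v c : (forall y, cross_target j y -> phi j.+1 y <= c) ->
   (forall y, cross_avoid j y = false) -> (forall y, phi j y = c) ->
   \sum_(y <- nbrs v) (if cross_target j y then phi j.+1 y else if cross_avoid j y then 0 else phi j y)
   <= deg v * phi j v.
  move=> h1 h2 h3; rewrite h3 -sum_nbrs_const; apply: ler_sum => y _.
  by case: ifP => [/h1//|_]; rewrite h2 h3.
have odd_step j v b : (forall y, cross_target j y = (y == s)) ->
   (forall y, cross_avoid j y = (level y == b)) -> K j.+1 = K j ->
   (forall y, H j y = hitting R (pred1 b) s y) -> (forall y, H j.+1 y = 1) ->
   v != s -> level v != b ->
   \sum_(y <- nbrs v) (if cross_target j y then phi j.+1 y else if cross_avoid j y then 0 else phi j y)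
   <= deg v * phi j v.
  move=> h1 h2 h3 h4 h5 vs vb; rewrite /phi h4 mulrCA.
  apply: le_trans (ler_wpM2l (K0 j) (@hitting_superharmonic R (pred1 b) s v vs vb)).
  rewrite mulr_sumr; apply: ler_sum => y _; rewrite h1 h2 h3 h4 h5.
  case: eqP => [->|_]; first by rewrite hittingE eqxx.
  by case: ifP => // _; rewrite mulr_ge0// hitting_ge0.
have hu y : level y = lo -> hitting R (pred1 hi) s y <= u.
  by move=> ly; apply: hitting_up_le; rewrite ?ly.
have hd y : level y = hi -> hitting R (pred1 lo) s y <= e.
  by move=> ly; apply: hitting_down_le; rewrite ?ly.
have dom1 j v b b' : (b < level s)%N && (level s < b')%N || (b' < level s)%N && (level s < b)%N ->
   (forall y, cross_target j.+1 y = (y == s)) ->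
   (forall y, cross_avoid j.+1 y = (level y == b)) ->
   (forall y, cross_target j y = (level y == b')) ->
   phase_dom cross_target cross_avoid j.+1 v -> v != s /\ level v != b.
  move=> bb h1 h2 h3; rewrite /phase_dom h1 h2 /= h3 => /orP[/andP[-> ->]//|/eqP lv].
  split; first by apply/eqP => E; rewrite E in lv; move: bb; lia.
  by rewrite lv; apply/eqP; move: bb; lia.
have step4 j v : (j < 10)%N -> (j %% 4 = 0)%N -> K j.+1 * u <= K j ->
   \sum_(y <- nbrs v) (if cross_target j y then phi j.+1 y else if cross_avoid j y then 0 else phi j y)
   <= deg v * phi j v.
  move=> j10 j4 Kj.
  have j4' : (j.+1 %% 4 = 1)%N by lia.
  apply: (@even_step _ _ (K j)); rewrite /cross_target /cross_avoid /phi /H ?j4 ?j4'//.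
    by move=> y /eqP ly; apply: le_trans Kj; rewrite ler_wpM2l// hu.
  by move=> y; rewrite mulr1.
have step2 j v : (j < 10)%N -> (j %% 4 = 2)%N -> K j.+1 * e <= K j ->
   \sum_(y <- nbrs v) (if cross_target j y then phi j.+1 y else if cross_avoid j y then 0 else phi j y)
   <= deg v * phi j v.
  move=> j10 j4 Kj.
  have j4' : (j.+1 %% 4 = 3)%N by lia.
  apply: (@even_step _ _ (K j)); rewrite /cross_target /cross_avoid /phi /H ?j4 ?j4'//.
    by move=> y /eqP ly; apply: le_trans Kj; rewrite ler_wpM2l// hd.
  by move=> y; rewrite mulr1.
have step1 j v : (j.+1 %% 4 = 1)%N -> K j.+2 = K j.+1 ->
   phase_dom cross_target cross_avoid j.+1 v ->
   \sum_(y <- nbrs v) (if cross_target j.+1 y then phi j.+2 y else if cross_avoid j.+1 y then 0 else phi j.+1 y)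
   <= deg v * phi j.+1 v.
  move=> j4 Kj D.
  have j4' : (j.+2 %% 4 = 2)%N by lia.
  have j4'' : (j %% 4 = 0)%N by lia.
  have [||||vs vb] := @dom1 j v hi lo _ _ _ _ D; rewrite ?shi ?los ?orbT//; try by move=> y; rewrite /cross_target /cross_avoid ?j4 ?j4''.
  by apply: (@odd_step _ _ hi) => // y; rewrite /cross_target /cross_avoid /H ?j4 ?j4'.
have step3 j v : (j.+1 %% 4 = 3)%N -> K j.+2 = K j.+1 ->
   phase_dom cross_target cross_avoid j.+1 v ->
   \sum_(y <- nbrs v) (if cross_target j.+1 y then phi j.+2 y else if cross_avoid j.+1 y then 0 else phi j.+1 y)
   <= deg v * phi j.+1 v.
  move=> j4 Kj D.
  have j4' : (j.+2 %% 4 = 0)%N by lia.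
  have j4'' : (j %% 4 = 2)%N by lia.
  have [||||vs vb] := @dom1 j v lo hi _ _ _ _ D; rewrite ?shi ?los ?orbT//; try by move=> y; rewrite /cross_target /cross_avoid ?j4 ?j4''.
  by apply: (@odd_step _ _ lo) => // y; rewrite /cross_target /cross_avoid /H ?j4 ?j4'.
move=> [|[|[|[|[|[|[|[|[|[|]]]]]]]]]] // v _ D.
- by apply: step4 => //; rewrite /K /= (_ : _ * u = u ^+ 3 * e ^+ 2)//; ring.
- exact: step1.
- by apply: step2 => //; rewrite /K /= (_ : _ * e = u ^+ 2 * e ^+ 2)//; ring.
- exact: step3.
- by apply: step4 => //; rewrite /K /= (_ : _ * u = u ^+ 2 * e)//; ring.
- exact: step1.
- by apply: step2 => //; rewrite /K /= (_ : _ * e = u * e)//; ring.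
- exact: step3.
- by apply: step4 => //; rewrite /K /= mul1r.
- exact: step1.
Qed.

End Crossings.

End PhaseBounds.

(** * Escapes come in clusters *)

Definition is_walk (x : nat -> vertex) : Prop := forall t, x t.+1 \in nbrs (x t).

Lemma walk_level x t : is_walk x ->
  level (x t.+1) = (level (x t)).+1 \/ level (x t) = (level (x t.+1)).+1.
Proof. by move=> wx; exact/level_nbrs. Qed.

Lemma walk_stays_above x p s t : is_walk x -> (p < level (x s))%N -> (s <= t)%N ->
  (forall i, (s < i <= t)%N -> level (x i) != p) -> (p < level (x t))%N.
Proof.
move=> wx ps /subnKC <-; elim: (t - s)%N => [|i IH] H; first by rewrite addn0.
have {}IH : (p < level (x (s + i)))%N by apply: IH => j Hj; apply: H; lia.
have := H (s + i).+1; have := walk_level (s + i) wx; rewrite addnS; lia.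
Qed.

Lemma walk_stays_below x p s t : is_walk x -> (level (x s) < p)%N -> (s <= t)%N ->
  (forall i, (s < i <= t)%N -> level (x i) != p) -> (level (x t) < p)%N.
Proof.
move=> wx ps /subnKC <-; elim: (t - s)%N => [|i IH] H; first by rewrite addn0.
have {}IH : (level (x (s + i)) < p)%N by apply: IH => j Hj; apply: H; lia.
have := H (s + i).+1; have := walk_level (s + i) wx; rewrite addnS; lia.
Qed.

Definition escapes p q K : (nat -> vertex) -> Prop :=
  phases (at_level [:: q; K]) (at_level_opt [:: None; Some p]) 2.

Section SomeCut.
Context {R : realType} {d : measure_display} {Omega : measurableType d}.
Variables (P : probability Omega R) (X : nat -> Omega -> vertex).
Hypothesis srw : simple_random_walk P edge X.
Variable x0 : vertex.
Local Notation rho := (rho R).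
Local Notation res := (res R).
Local Notation deg v := ((size (nbrs v))%:R : R).

Variables (p q : nat -> nat) (M J N K : nat) (sg : R).
Hypothesis MJN : (M + J <= N)%N.
Hypothesis q_lt : forall j, (j < N)%N -> (q j < q j.+1)%N.
Hypothesis p_le : forall i j, (0 < i <= j)%N -> (j <= M)%N -> (p i <= p j)%N.
Hypothesis pq : forall j, (0 < j <= M)%N -> (p j < q j)%N.
Hypothesis qK : (q N < K)%N.
Hypothesis x0q : (level x0 < q 1)%N.
Hypothesis sg0 : 0 <= sg.
Hypothesis sgP : forall b, (0 < b <= M)%N ->
  rho (p b) (q b) / rho (p b) K <=
  sg * (1 + \sum_(b.+1 <= j < (b + J).+1) rho (p b) (q b) / rho (p b) (q j)).

Lemma q_mono i j : (i <= j <= N)%N -> (q i <= q j)%N.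
Proof.
move=> /andP[/subnKC <-]; elim: (j - i)%N => [|k IH]; first by rewrite addn0.
by rewrite addnS => H; apply: leq_trans (IH _) (ltnW (q_lt _)); lia.
Qed.

Let step (st : option nat * nat) (y : vertex) : option nat * nat :=
  let new := (st.2 < N)%N && (level y == q st.2.+1) in
  (if st.1 is Some b then (if level y == p b then None else Some b)
   else if new && (st.2.+1 <= M)%N then Some st.2.+1 else None,
   if new then st.2.+1 else st.2).

(** A charging argument: each new level [q j] releases [sg] from a budget [sg * N]. While [b] is
    followed, [rho (p b) (level v)] times the sum is the expected number of the next levels reached
    before [p b]. Only the part of the escape probability that these future payments do not cover is
    stored. *)
Let coef b m : R := (rho (p b) K)^-1 - sg * \sum_(m.+1 <= j < (b + J).+1) (rho (p b) (q j))^-1.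

(* [st.1] is the lowest level [p b] that the walk has not visited again since it
   first hit [q b], and [st.2] the number of levels [q j] hit so far. *)
Let phi (st : option nat * nat) (v : vertex) : R :=
  (if st.1 is Some b then rho (p b) (level v) * coef b st.2 else 0) + sg * (N - st.2)%:R.

Let Inv (st : option nat * nat) (v : vertex) : Prop :=
  [/\ (st.2 <= N)%N, (st.2 < N)%N -> (level v < q st.2.+1)%N &
   forall b, st.1 = Some b -> [/\ (0 < b <= M)%N, (b <= st.2)%N, (p b < level v)%N & (level v <= K)%N]].

Let bad (st : option nat * nat) (v : vertex) : Prop := st.1 /\ level v = K.

Let InvS st v y : Inv st v -> ~ bad st v -> y \in nbrs v -> Inv (step st y) y.
Proof.
case: st => [b m] [/= mN mq Hb] nb /level_nbrs ly.
have new : (m < N)%N && (level y == q m.+1) \/ ((m < N)%N -> (level y < q m.+1)%N).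
  by case: (ltnP m N) => H; [have := mq H; case: eqP => ?; [left|right]; lia|right].
have lst : (m.+1 < N)%N -> (level y == q m.+1) -> (level y < q m.+2)%N.
  by move=> H /eqP ->; exact: q_lt.
have qm : (m < N)%N -> (q m.+1 <= K)%N.
  by move=> H; apply: leq_trans (ltnW qK); apply: q_mono; rewrite H leqnn.
split => /=.
- by case: ifP => //; case/andP.
- case: ifP => [/andP[H1 H2] H|H]; first exact: lst.
  by case: new; rewrite ?H.
move=> b'; case: b Hb nb => [b|] Hb nb.
  case: eqP => // yp [<-]; have [H1 H2 H3 H4] := Hb b erefl.
  have H5 : level v <> K by move=> E; apply: nb.
  split => //; [by case: ifP; lia|lia|lia].
case: ifP => // /andP[/andP[H1 /eqP H2] H3] [<-].
rewrite H1 H2 eqxx /=; split => //; first by rewrite pq.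
exact: qm.
Qed.

(** A level [q j] not yet hit lies above the walk, so each anticipated payment is at most [sg];
    since [M + J <= N], the remaining budget covers them all. *)
Let phi_ge0 st v : Inv st v -> 0 <= phi st v.
Proof.
case: st => [[b|] m] [/= mN mq Hb]; rewrite /phi /=; last by rewrite add0r mulr_ge0.
have [H1 H2 H3 H4] := Hb b erefl.
rewrite /coef mulrBr mulrCA -addrA addr_ge0//.
  by rewrite divr_ge0// rho_ge0.
rewrite addrC subr_ge0 ler_wpM2l// mulr_sumr.
apply: (@le_trans _ _ (\sum_(m.+1 <= j < (b + J).+1) 1)).
  rewrite big_nat [leRHS]big_nat; apply: ler_sum => j /andP[j1 j2].
  have mN' : (m < N)%N by lia.
  have lj : (level v < q j)%N by apply: leq_trans (mq mN') (q_mono _); lia.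
  by rewrite ler_pdivrMr ?mul1r ?le_rho// ?(ltnW lj)// rho_gt0// (ltn_trans H3).
rewrite big_const_nat iter_addr_0 ler_nat; lia.
Qed.

Let phi_bad st v : Inv st v -> bad st v -> 1 <= phi st v.
Proof.
case: st => [[b|] m] [/= mN mq Hb] [//= _ lK]; rewrite /phi /=.
have [H1 H2 H3 H4] := Hb b erefl.
have -> : m = N.
  apply/eqP; rewrite eqn_leq mN leqNgt; apply/negP => H; have := mq H.
  by rewrite lK; have : (q m.+1 <= q N)%N by [apply: q_mono; rewrite H leqnn]; lia.
rewrite subnn mulr0 addr0 /coef big_geq ?mulr0 ?subr0; last lia.
by rewrite lK divff// gt_eqF// rho_gt0// -lK.
Qed.

Let phi_step st v : Inv st v -> ~ bad st v ->
  \sum_(y <- nbrs v) phi (step st y) y <= deg v * phi st v.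
Proof.
case: st => [[b|] m] [/= mN mq Hb] nb.
  have [H1 H2 H3 H4] := Hb b erefl.
  pose L n := rho (p b) n * coef b m + sg * (N - m)%:R.
  have LS n : (p b <= n)%N -> L n - L n.+1 = - coef b m * res n.
    by move=> pn; rewrite /L rhoSr//; ring.
  apply: (@le_trans _ _ (\sum_(y <- nbrs v) L (level y))); last first.
    have := @sum_level_le R L v (- coef b m) (- coef b m).
    rewrite subrr mulr0 mul0r subr0; apply; first by lia.
      by rewrite LS// ltnW.
    by move=> v0; have E : (level v).-1.+1 = level v by [lia]; rewrite -{2}E LS//; lia.
  apply: sum_nbrs_le => y /level_nbrs ly.
  rewrite /phi /L /=; have [yp|yp] := eqVneq (level y) (p b).
    rewrite yp rhonn mul0r !add0r; case: ifP => // /andP[H5 _].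
    by rewrite ler_wpM2l// ler_nat; lia.
  case: ifP => // /andP[H5 /eqP yq]; rewrite yq.
  have E : (N - m)%:R = (N - m.+1)%:R + 1 :> R by rewrite -[X in _ + X]/(1%:R) -natrD; congr _%:R; lia.
  (* The jump of [coef] at a new level, times [rho (p b) (q m.+1)], is exactly the [sg] released by
     the budget. *)
  have [bJ|bJ] := ltnP m (b + J).
    have r0 : rho (p b) (q m.+1) != 0 by rewrite gt_eqF// rho_gt0//; have := mq H5; lia.
    rewrite /coef [\sum_(m.+1 <= j < _) _]big_ltn; last by lia.
    rewrite E; set S := \sum_(_ <= _ < _) _; set a := rho _ _ in r0 *.
    rewrite le_eqVlt; apply/orP; left; apply/eqP; field.
    by rewrite r0 gt_eqF// rho_gt0//; lia.
  have C i : (m <= i)%N -> coef b i = (rho (p b) K)^-1.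
    by move=> mi; rewrite /coef big_geq ?mulr0 ?subr0//; lia.
  by rewrite !C// E lerD2l ler_wpM2l// lerDl ler01.
rewrite -sum_nbrs_const; apply: sum_nbrs_le => y /level_nbrs ly.
rewrite /phi /= [X in _ <= X]add0r.
have [/andP[H5 /eqP yq]|/negbTE nw] := boolP ((m < N)%N && (level y == q m.+1)); last by rewrite /= add0r.
rewrite yq /=.
have E : (N - m)%:R = (N - m.+1)%:R + 1 :> R by rewrite -[X in _ + X]/(1%:R) -natrD; congr _%:R; lia.
case: ifP => [H6|_]; last by rewrite add0r ler_wpM2l// ler_nat; lia.
have := @sgP m.+1 H6; rewrite E /coef mulrBr mulrCA mulr_sumr.
by rewrite [_ * (1 + _)]mulrDr; lra.
Qed.

(** Following one index at a time detects every escape: the index [c <= b] followed when [q b] is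
    first hit has [p c <= p b], and the walk then stays above [p b] until [K]. *)
Lemma some_escape_bound :
  prob_le P [set w | X 0%N w = x0 /\ (is_walk (X^~ w) /\
      exists2 b, (0 < b <= M)%N & escapes (p b) (q b) K (X^~ w))]
    (sg * N%:R).
Proof.
have I0 : Inv (step (None, 0%N) x0) x0.
  rewrite /step /= (ltn_eqF x0q) andbF; split => //.
have [mE prE] := @machine_bound _ _ _ P X srw _ step (None, 0%N) bad Inv phi x0 I0 InvS phi_ge0 phi_bad phi_step.
eexists; first split; first exact: mE.
  by move: prE; rewrite {2}/step /= (ltn_eqF x0q) andbF /phi /= add0r subn0.
move=> w /= [X0 [wx [b bM [t [t0 H]]]]]; split => //.
set x := X^~ w in wx H *.
have [t01 /eqP /= lt1 H1] := H 0%N isT; have [t12 /eqP /= lt2 H2] := H 1%N isT.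
rewrite /at_level /at_level_opt /= in H1 H2; rewrite t0 in H1 t01.
exists (t 2%N); split => //; clear H.
set S := state step (None, 0%N) x.
have A i : [/\ ((S i).2 <= N)%N, ((S i).2 < N)%N -> (level (x i) < q (S i).2.+1)%N,
   forall c, (S i).1 = Some c -> (0 < c <= (S i).2)%N &
   (0 < (S i).2)%N -> exists2 k, (k <= i)%N & level (x k) = q (S i).2].
  elim: i => [|i IH].
    have x00 : x 0%N = x0 by [].
    by rewrite /S /= x00 (ltn_eqF x0q) andbF; split.
  have -> : S i.+1 = step (S i) (x i.+1) by [].
  case: (S i) IH => [c m] /= [A1 A2 A3 A4]; have ly := walk_level i wx.
  have [/andP[h1 /eqP h2]|h] := boolP ((m < N)%N && (level (x i.+1) == q m.+1)).
    split => //=.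
    - by move=> h3; rewrite h2 q_lt.
    - move=> c'; case: c A3 => [c|] A3; last by case: ifP => // _ [<-]; lia.
      by case: eqP => // _ [<-]; have := A3 c erefl; lia.
    - by exists i.+1.
  split => //=.
  - move=> h1; rewrite h1 /= in h; have := A2 h1; lia.
  - move=> c'; case: c A3 => [c|] A3 //.
    by case: eqP => // _ [<-]; exact: A3.
  - by move=> m0; have [k ki lk] := A4 m0; exists k => //; lia.
have [c [c0 cb Sc]] : exists c, [/\ (0 < c)%N, (c <= b)%N & (S (t 1%N)).1 = Some c].
  have E : t 1%N = (t 1%N).-1.+1 by lia.
  have -> : S (t 1%N) = step (S (t 1%N).-1) (x (t 1%N)) by rewrite {1 3}E.
  have [A1 A2 A3 A4] := A (t 1%N).-1.
  case: (S _) A1 A2 A3 A4 => [c m] /= A1 A2 A3 A4.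
  have ly := walk_level (t 1%N).-1 wx; rewrite -E lt1 in ly.
  have below k : (k <= (t 1%N).-1)%N -> (level (x k) < q b)%N.
    move=> kt; apply: (@walk_stays_below x (q b) 0 k) => //.
      by rewrite [x 0%N]X0; apply: leq_trans x0q (q_mono _); lia.
    by move=> i /andP[i1 i2]; have [|//] := H1 i; lia.
  have mb : (m < b)%N.
    rewrite ltnNge; apply/negP => bm; have [|k k1 k2] := A4; first by lia.
    have := below k k1; rewrite k2 ltnNge => /negP; apply; apply: q_mono; lia.
  have mN : (m < N)%N by lia.
  have bm : b = m.+1.
    apply/eqP; rewrite eqn_leq mb andbT leqNgt; apply/negP => h.
    have h1 : (q m.+1 < q b)%N.
      by apply: leq_trans (q_lt _) (q_mono _); lia.
    have := A2 mN; lia.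
  rewrite mN lt1 -bm eqxx /=.
  case: c A3 => [c|] A3; last by rewrite (andP bM).2; exists b; split => //; lia.
  have := A3 c erefl => cm; exists c; split; [lia|lia|].
  rewrite gtn_eqF//; apply: leq_ltn_trans (pq bM); apply: p_le; lia.
have above i : (t 1%N <= i <= t 2%N)%N -> (p b < level (x i))%N.
  move=> /andP[i1 i2]; apply: (@walk_stays_above x (p b) (t 1%N) i) => //.
    by rewrite lt1 pq.
  move=> k /andP[k1 k2]; have [->|kt] := eqVneq k (t 2%N).
    rewrite lt2 gtn_eqF//; apply: leq_ltn_trans (ltnW (pq bM)) _.
    by apply: leq_ltn_trans qK; apply: q_mono; lia.
  have [|_] := H2 k; first lia.
  by apply: contraNneq => ->.
have pc : (p c <= p b)%N by apply: p_le; lia.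
have stays i : (t 1%N <= i <= t 2%N)%N -> (S i).1 = Some c.
  move=> /andP[/subnKC <-]; elim: (i - t 1%N)%N => [|k IH]; first by rewrite addn0.
  rewrite addnS => hk; have {}IH := IH (ltnW hk).
  have -> : S (t 1%N + k).+1 = step (S (t 1%N + k)) (x (t 1%N + k).+1) by [].
  rewrite /step /= IH; have := above (t 1%N + k).+1; case: eqP => // ->; lia.
by rewrite stays//; lia.
Qed.

End SomeCut.

(** * Later crossings meet earlier ones *)

Section Growth.
Variable R : realType.

(** A discrete hyperbolic cosine. For [i <= T], [growth r i / growth r T] is the chance that a
    simple walk on the integers from [i], reflected at 0 and killed with chance [r] at every step
    from elsewhere, reaches [T]. *)
Fixpoint growth2 (r : R) (i : nat) : R * R :=
  if i is i'.+1 then let: (x, y) := growth2 r i' in (y, 2 * y / (1 - r) - x) else (1, 1).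
Definition growth r i : R := (growth2 r i).1.

Lemma growth0 r : growth r 0 = 1. Proof. by []. Qed.
Lemma growth1 r : growth r 1 = 1. Proof. by []. Qed.
Lemma growthS r i : growth r i.+2 = 2 * growth r i.+1 / (1 - r) - growth r i.
Proof.
by rewrite /growth /=; case E : (growth2 r i) => [x y] /=.
Qed.

Section Bounds.
Variable r : R.
Hypothesis r01 : 0 < r < 1.

(** Convexity comes from [1 / (1 - r) >= 1 + r] and requires a nonnegative value; the second case
    disappears once positivity is known. *)
Lemma growth_convex i : 2 * growth r i.+1 + 2 * r * growth r i.+1 <=
  growth r i.+2 + growth r i \/ growth r i.+1 < 0.
Proof.
have [g0|] := leP 0 (growth r i.+1); [left|by right].
rewrite growthS subrK; case/andP: r01 => r0 r1.
rewrite ler_pdivlMr ?subr_gt0//; nra.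
Qed.

Lemma growth_mono i : 1 <= growth r i <= growth r i.+1.
Proof.
case/andP: r01 => r0 r1; elim: i => [|i /andP[g1 g2]]; first by rewrite growth0 growth1 lexx.
have := growth_convex i; rewrite (le_trans g1 g2) /=; case; nra.
Qed.

Lemma growth_ge1 i : 1 <= growth r i. Proof. by case/andP: (growth_mono i). Qed.

Lemma le_growth i j : (i <= j)%N -> growth r i <= growth r j.
Proof.
move=> /subnKC <-; elim: (j - i)%N => [|k IH]; first by rewrite addn0.
by rewrite addnS; apply: le_trans IH _; case/andP: (growth_mono (i + k)).
Qed.

Lemma growth_diff i k : 2 * r * k%:R * growth r i <= growth r (i + k).+1 - growth r (i + k).
Proof.
case/andP: r01 => r0 r1; elim: k => [|k IH].
  by rewrite mulr0 mul0r addn0 subr_ge0; case/andP: (growth_mono i).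
have g1 := growth_ge1 i; have gi := @le_growth i (i + k).+1 (leqW (leq_addr _ _)).
have := growth_convex (i + k); case; last by lra.
rewrite !addnS -natr1; nra.
Qed.

(** After [k] steps the slope is at least [2 * r * k] times the initial value, and [k] more steps at
    that slope suffice. Doubling thus takes a number of steps of order the inverse square root of
    [r], which is the diffusive gain. *)
Lemma growth_double i k : 1 <= r * (k * k)%:R -> 2 * growth r i <= growth r (i + 2 * k).
Proof.
case/andP: r01 => r0 r1 rk.
suff : forall j, growth r (i + k) + 2 * r * k%:R * growth r i * j%:R <= growth r (i + k + j).
  move=> /(_ k); have -> : (i + 2 * k = i + k + k)%N by lia.
  have g1 := growth_ge1 i; have gi := @le_growth i (i + k) (leq_addr _ _).
  rewrite natrM in rk; move: (k%:R) rk => x rk; nra.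
elim=> [|j IH]; first by rewrite mulr0 addr0 addn0.
have H := growth_diff i (k + j); rewrite addnA natrD in H.
have g1 := growth_ge1 i; rewrite addnS -natr1.
have : 0 <= r * j%:R * growth r i by rewrite !mulr_ge0 ?ler0n// ?ltW//; lra.
move: IH H; set A := growth r (i + k); set B := growth r _; set D := growth r _.+1.
set g := growth r i; nra.
Qed.

Lemma growth_exp m k : 1 <= r * (k * k)%:R -> 2 ^+ m <= growth r (2 * k * m).
Proof.
move=> rk; elim: m => [|m IH]; first by rewrite muln0 growth0.
have -> : (2 * k * m.+1 = 2 * k * m + 2 * k)%N by lia.
apply: le_trans (growth_double _ rk); rewrite exprS ler_wpM2l//.
Qed.

End Bounds.
End Growth.

Definition precedes (up : bool) (m n : nat) : bool := if up then (m < n)%N else (n < m)%N.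

Lemma precedes_next b l l' n : l' = l.+1 \/ l = l'.+1 -> l' <> n -> precedes b l n -> precedes b l' n.
Proof. rewrite /precedes; case: b; lia. Qed.

Lemma precedes_prev b l l' n : l' = l.+1 \/ l = l'.+1 -> l' <> n -> precedes b n l -> precedes b n l'.
Proof. rewrite /precedes; case: b; lia. Qed.

Section Intersection.
Context {R : realType} {d : measure_display} {Omega : measurableType d}.
Variables (P : probability Omega R) (X : nat -> Omega -> vertex).
Hypothesis srw : simple_random_walk P edge X.
Variable x0 : vertex.
Local Notation rho := (rho R).
Local Notation res := (res R).
Local Notation deg v := ((size (nbrs v))%:R : R).

(* The levels [z 0], ..., [z T] are equally spaced, [width] apart, in a zone of
   constant width, and are enumerated upwards or downwards from the side of [nst]
   to the side of [c0]. *)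
Variables (nst c0 K T a : nat) (z : nat -> nat) (dir : bool).
Hypothesis T_gt1 : (1 < T)%N.
Hypothesis a_gt0 : (0 < a)%N.
Hypothesis zE : forall i, (i <= T)%N -> z i = (if dir then z 0 + i * a else z 0 - i * a)%N.
Hypothesis zT : dir || (T * a <= z 0)%N.
Hypothesis z_width : forall k, (if dir then z 0 <= k <= z T else z T <= k <= z 0)%N -> width k = a.
Hypothesis nst_z : (if dir then nst < z 0 else z 0 < nst)%N.
Hypothesis z_c0 : (if dir then z T <= c0 else c0 <= z T)%N.
Hypothesis nstK : (nst < K)%N.
Hypothesis c0K : (c0 < K)%N.
Hypothesis x0c0 : (level x0 < c0)%N.

(** [Starting] waits for [z 1], [Trying A i] remembers the last grid level met, and [Spoiled] waits
    for the next visit to [nst] after a meeting with [A]. Meetings are tested on grid levels only,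
    which is enough to bound [misses] from above. *)
Inductive status :=
  | Waiting | Collecting of seq vertex | Starting of seq vertex
  | Trying of seq vertex & nat | Spoiled of seq vertex | Stopped | Missed.

Definition covers (A : seq vertex) : bool :=
  all (fun i => has (fun v => level v == z i) A) (iota 0 T.+1).

Let step (st : status) (y : vertex) : status :=
  match st with
  | Waiting => if level y == c0 then Collecting [:: y] else Waiting
  | Collecting A => if level y == nst then (if covers A then Starting A else Stopped)
                    else Collecting (y :: A)
  | Starting A =>
      if level y == K then Stopped
      else if level y == z 1 then (if y \in A then Spoiled A else Trying A 1)
      else Starting A
  | Trying A i =>
      if level y == K then Stopped
      else if level y == nst then Starting A
      else if level y == z i.+1 then
        (if y \in A then Spoiled A else if i.+1 == T then Missed else Trying A i.+1)
      else if level y == z i.-1 then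
        (if y \in A then Spoiled A else if i.-1 == 0%N then Starting A else Trying A i.-1)
      else Trying A i
  | Spoiled A =>
      if level y == K then Stopped else if level y == nst then Starting A else Spoiled A
  | st => st
  end.

Let r : R := 2^-1 ^+ a.
Let w i : R := growth r i / growth r T.
Let u := w 1.
Let G := green R nst K.

Let r01 : 0 < r < 1.
Proof.
rewrite exprn_gt0 ?invr_gt0//= exprn_ilt1 ?invr_ge0//; first lia.
by rewrite invf_lt1// ltr1n.
Qed.

Let w_gt0 i : 0 < w i.
Proof.
by rewrite divr_gt0//; apply: lt_le_trans (growth_ge1 r01 _); exact: ltr01.
Qed.
Let wT : w T = 1.
Proof. by rewrite /w divff// gt_eqF//; apply: lt_le_trans (growth_ge1 r01 _); exact: ltr01. Qed.
Let w0 : w 0 = u. Proof. by rewrite /u /w growth0 growth1. Qed.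
Let u0 : 0 <= u. Proof. exact/ltW/w_gt0. Qed.

Let exits i : pred nat := pred2 (minn (z i.-1) (z i.+1)) (maxn (z i.-1) (z i.+1)).

(* The value of the game for a walk between [z i.-1] and [z i.+1], paying [w] on the
   vertices of these levels outside of [A]. *)
Let pay (A : seq vertex) i v : R :=
  w i.+1 * \sum_(s <- level_list (z i.+1) | s \notin A) hitting R (exits i) s v +
  w i.-1 * \sum_(s <- level_list (z i.-1) | s \notin A) hitting R (exits i) s v.

(** [u] is the value of one attempt: [G] counts the visits to [nst], the indicator stands for the
    attempt in progress, and [pay] replaces the indicator once the walk is on the grid. *)
Let phi (st : status) (v : vertex) : R :=
  match st with
  | Waiting | Collecting _ => u * G nst
  | Starting _ => u * (G (level v) + (level v != nst)%:R)
  | Trying A i => u * G (level v) + pay A i v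
  | Spoiled A => u * G (level v)
  | Stopped => 0
  | Missed => 1
  end.

Let bad (st : status) (v : vertex) := st = Missed.

Let Inv (st : status) (v : vertex) : Prop :=
  match st with
  | Starting A => covers A /\ level v != K
  | Spoiled A => [/\ covers A, level v != nst & level v != K]
  | Trying A i => [/\ covers A, (0 < i < T)%N, ~~ exits i (level v) & level v != K]
  | _ => True
  end.

Let exitsE i n : exits i n = (n == z i.-1) || (n == z i.+1).
Proof. by rewrite /exits /=; case: leqP => // _; rewrite orbC. Qed.

Let z_lt i : (i < T)%N -> (if dir then z i.+1 = z i + a else (z i.+1 + a = z i))%N.
Proof.
move=> iT; have := zE (ltnW iT); have := zE iT; move: zT; case: dir => /= h; first lia.
by have : (i.+1 * a <= T * a)%N; [rewrite leq_mul2r; lia|lia].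
Qed.

Let z_precedes i : (i < T)%N -> precedes dir (z i) (z i.+1).
Proof. by move=> /z_lt; have := a_gt0; clear; rewrite /precedes; case: dir; lia. Qed.

Let z_neq i : (i < T)%N -> z i.+1 != z i.
Proof. by move=> /z_lt; have := a_gt0; clear; case: dir; lia. Qed.

Let z_neq2 i : (0 < i < T)%N -> z i.+1 != z i.-1.
Proof.
move=> /andP[i0 iT]; have zz := z_lt iT; have := @z_lt i.-1; rewrite prednK// => H.
by have := H (ltnW iT); have := a_gt0; move: zz; clear; case: dir; lia.
Qed.

Let G_ge0 m : 0 <= G m. Proof. exact: green_ge0. Qed.

Let pay_ge0 A i v : 0 <= pay A i v.
Proof.
by rewrite addr_ge0// mulr_ge0 ?(ltW (w_gt0 _))// sumr_ge0// => s _; exact: hitting_ge0.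
Qed.

Let sum_exit (A : seq vertex) i n v : exits i (level v) ->
  \sum_(s <- level_list n | s \notin A) hitting R (exits i) s v =
  ((level v == n) && (v \notin A))%:R.
Proof.
move=> ev; have [lv|lv] := eqVneq (level v) n; last first.
  rewrite big_seq_cond big1// => s /andP[]; rewrite mem_level_list => /eqP ls _.
  by rewrite hittingE ?ev ?orbT//; case: eqP => // E; move: lv; rewrite E ls eqxx.
have vl : v \in level_list n by rewrite mem_level_list lv.
have [vA|vA] := boolP (v \in A) => /=.
  rewrite big1// => s sA; rewrite hittingE ?ev ?orbT//.
  by case: eqP => // E; rewrite -E vA in sA.
rewrite big_mkcond (bigD1_seq v) ?uniq_level_list//= vA hittingE ?eqxx//.
rewrite big1 ?addr0// => s sv; case: ifP => // _.
by rewrite hittingE ?ev ?orbT// eq_sym (negbTE sv).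
Qed.

Let pay_exit (A : seq vertex) i v : (0 < i < T)%N -> v \notin A ->
  (level v == z i.+1 -> pay A i v = w i.+1) /\ (level v == z i.-1 -> pay A i v = w i.-1).
Proof.
move=> iT vA; have := z_neq2 iT => zz.
split=> lv; rewrite /pay !sum_exit ?exitsE ?lv ?orbT// vA (eqP lv).
  by rewrite (negbTE zz) mulr1 mulr0 addr0.
by rewrite eq_sym (negbTE zz) mulr1 mulr0 add0r.
Qed.

Let pay_step A i v : ~~ exits i (level v) -> \sum_(y <- nbrs v) pay A i y <= deg v * pay A i v.
Proof.
move=> nv; rewrite big_split /= mulrDr -!mulr_sumr !(mulrCA (deg v)).
have H j n : j = i.-1 \/ j = i.+1 -> n = z j -> 
    \sum_(y <- nbrs v) \sum_(s <- level_list n | s \notin A) hitting R (exits i) s y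
    <= deg v * \sum_(s <- level_list n | s \notin A) hitting R (exits i) s v.
  move=> ji nz; rewrite exchange_big mulr_sumr /= big_seq_cond [leRHS]big_seq_cond.
  apply: ler_sum => s /andP[+ _]; rewrite mem_level_list => /eqP ls.
  apply: hitting_superharmonic => //; apply: contraNneq nv => ->.
  by rewrite exitsE ls nz; case: ji => ->; rewrite eqxx ?orbT.
apply: lerD; (apply: ler_wpM2l; first exact/ltW/w_gt0).
  by apply: (H i.+1) => //; right.
by apply: (H i.-1) => //; left.
Qed.

(** [A] contains at least one of the [2 ^ a] vertices of each adjacent grid level, and such a level
    is entered evenly with total mass one half. So it is entered outside [A] with probability at
    most [(1 - r) / 2], which gives the recurrence of [growth]. *)
Let pay_center A i v : covers A -> (0 < i < T)%N -> level v = z i -> pay A i v <= w i.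
Proof.
move=> cA iT lv; have [i0 iT'] := andP iT.
have [m E] : exists m, i = m.+1 by exists i.-1; rewrite prednK.
have zmul j : (j <= T)%N -> (j * a <= T * a)%N by move=> jT; rewrite leq_mul2r jT orbT.
have zw k : (z i - a <= k <= z i + a)%N -> width k = a.
  move=> hk; apply: z_width; move: hk.
  rewrite (zE (ltnW iT')) (zE (leqnn T)); have := zmul _ iT'.
  have : (a <= i * a)%N by rewrite leq_pmull.
  by move: zT; clear; case: dir => /=; lia.
have zm := zw (z i); have am : (a <= z i)%N by rewrite -{1}zm ?width_leq//; clear; lia.
have zp1 : (if dir then z i.+1 = z i + a else z i.+1 = z i - a)%N.
  by have := z_lt iT'; clear; case: dir; lia.
have zm1 : (if dir then z i.-1 = z i - a else z i.-1 = z i + a)%N.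
  have := @z_lt i.-1; rewrite prednK// => H; have := H (ltnW iT'); clear; case: dir; lia.
have ex : exits i = pred2 (z i - a)%N (z i + a)%N.
  by rewrite /exits; move: zp1 zm1; clear; case: dir => -> ->; congr pred2; lia.
have bound j : j = i.-1 \/ j = i.+1 ->
    \sum_(s <- level_list (z j) | s \notin A) hitting R (exits i) s v <= (1 - r) / 2.
  move=> ji; have jT : (j <= T)%N by move: ji i0 iT'; clear; lia.
  have wj : width (z j) = a by apply: zw; move: ji zp1 zm1 am; clear; case=> ->; case: dir; lia.
  have hs : (0 < count (fun s => s \in A) (level_list (z j)))%N.
    rewrite -has_count; move/allP: cA => /(_ j); rewrite mem_iota ltnS jT => /(_ isT).
    by move=> /hasP[s sA ls]; apply/hasP; exists s; rewrite ?mem_level_list.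
  have cnt : ((count (fun s => s \notin A) (level_list (z j)))%:R : R) <= 2 ^+ a - 1.
    rewrite lerBrDr -natrX natr1 ler_nat -wj -size_level_list.
    by rewrite -(count_predC (fun s => s \in A)) addnC -addn1 leq_add2l.
  apply: (@le_trans _ _ (\sum_(s <- level_list (z j) | s \notin A) r / 2)).
    rewrite big_seq_cond [leRHS]big_seq_cond; apply: ler_sum => s /andP[+ _].
    rewrite mem_level_list => ls; rewrite ex; apply: hitting_exit_le => //.
    by move: ji ls zp1 zm1; clear; case=> ->; case: dir; lia.
  rewrite big_const_seq iter_addr_0 -[_ *+ _]mulr_natl.
  case/andP: r01 => r0 r1; have r2 : 2 ^+ a * r = 1.
    by rewrite /r exprVn divff// expf_neq0.
  move: cnt r2; set C := _%:R; set D := 2 ^+ a; nra.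
have wr : w i.+1 + w i.-1 = 2 * w i / (1 - r).
  by rewrite /w E /= -mulrDl growthS subrK; rewrite -!mulrA; congr (_ * _); rewrite mulrCA mulrC -mulrA.
rewrite /pay; apply: (@le_trans _ _ ((w i.+1 + w i.-1) * ((1 - r) / 2))).
  rewrite mulrDl; apply: lerD; (apply: ler_wpM2l; first exact/ltW/w_gt0).
    by apply: bound; right.
  by apply: bound; left.
case/andP: r01 => r0 r1.
have E2 (b c : R) : c != 0 -> 2 * b / c * (c / 2) = b by move=> c0'; field.
by rewrite wr E2// subr_eq0 gt_eqF.
Qed.

Let InvS st v y : Inv st v -> ~ bad st v -> y \in nbrs v -> Inv (step st y) y.
Proof.
move=> I nb /level_nbrs ly; case: st I nb => [|A|A|A i|A||] //=.
- by case: ifP.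
- move=> _ _; case: ifP => // /eqP ln; case: ifP => //= cA; by rewrite ln ltn_eqF.
- case=> cA vK _; case: eqP => // yK; case: eqP => [lz|lz]; last by split => //; apply/eqP.
  have lz' : level y != nst by rewrite lz; have := z_lt (ltnW T_gt1); have := nst_z; clear; case: dir; lia.
  case: ifP => yA //=; first by split => //; apply/eqP.
  split => //; [ |exact/eqP].
  rewrite exitsE lz negb_or eq_sym; apply/andP; split.
    by rewrite eq_sym; apply: z_neq; exact: ltnW.
  by rewrite eq_sym; apply: z_neq.
- case=> cA iT ev vK _; have [i0 iT'] := andP iT.
  case: eqP => // yK; case: eqP => [ln|yn]; first by split => //; rewrite ln ltn_eqF.
  case: eqP => [lz|lz1].
    case: ifP => yA; first by split => //; apply/eqP.
    case: eqP => // iT1; have iT2 : (i.+1 < T)%N by move: iT1 iT'; clear; lia.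
    split => //; last exact/eqP.
    by rewrite exitsE lz negb_or /= z_neq// eq_sym z_neq.
  case: eqP => [lz|lz2].
    case: ifP => yA; first by split => //; apply/eqP.
    case: eqP => // iT1; first by split => //; apply/eqP.
    have E : i.-1.-1.+1 = i.-1 by move: iT1; clear; lia.
    have iT2 : (0 < i.-1 < T)%N by move: iT1 iT'; clear; lia.
    have /andP[_ iT3] := iT2; split => //; last exact/eqP.
    rewrite exitsE lz negb_or prednK// [_ == z i]eq_sym.
    have /negbTE -> : z i != z i.-1 by rewrite -{1}(prednK i0); apply: z_neq.
    by rewrite andbT -{1}E; apply: z_neq; exact: leq_ltn_trans (leq_pred _) iT3.
  by split => //; [rewrite exitsE; apply/norP; split; apply/eqP|apply/eqP].
case=> cA vn vK _; case: eqP => // yK; case: eqP => [ln|yn].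
  by split => //; rewrite ln ltn_eqF.
by split => //; apply/eqP.
Qed.

Let phi_ge0 st v : Inv st v -> 0 <= phi st v.
Proof.
have uG m : 0 <= u * G m by rewrite mulr_ge0.
case: st => [|A|A|A i|A||] /= _ //; do ?[exact: uG|exact: addr_ge0 (uG _) (pay_ge0 _ _ _)].
exact: mulr_ge0 u0 (addr_ge0 (G_ge0 _) (ler0n _ _)).
Qed.

Let phi_step st v : Inv st v -> ~ bad st v ->
  \sum_(y <- nbrs v) phi (step st y) y <= deg v * phi st v.
Proof.
have uG m : u * G m >= 0 by rewrite mulr_ge0.
have start_le A y : phi (Starting A) y <= u * (G (level y) + 1).
  by rewrite ler_wpM2l// lerD2l; case: (_ != _).
have sup v' : level v' != nst -> level v' != K ->
  \sum_(y <- nbrs v') u * G (level y) <= deg v' * (u * G (level v')).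
  by move=> h1 h2; rewrite -mulr_sumr mulrCA ler_wpM2l//; apply: green_step.
have sup' v' : level v' != K ->
  \sum_(y <- nbrs v') u * G (level y) <= deg v' * (u * G (level v')).
  have [lw h|] := eqVneq (level v') nst; last exact: sup.
  rewrite -mulr_sumr mulrCA ler_wpM2l// lw.
  by apply: le_trans (green_at R nstK lw); rewrite lerDl.
case: st => [|A|A|A i|A||] I nb.
- rewrite /= -sum_nbrs_const; apply: sum_nbrs_le => y _.
  by case: ifP => // _.
- rewrite [X in _ <= _ * X]/= -sum_nbrs_const; apply: sum_nbrs_le => y _ /=.
  case: ifP => // /eqP ly; case: ifP => // _; rewrite /= ?ly ?eqxx ?addr0//.
- case: I => cA vK; rewrite [step _]/=.
  have pt y : phi (step (Starting A) y) y <= u * (G (level y) + 1).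
    rewrite /=; case: ifP => [_ /=|_]; first by rewrite mulr_ge0// addr_ge0.
    case: ifP => [lz|_]; last exact: start_le.
    case: ifP => yA /=; first by rewrite ler_wpM2l// lerDl.
    rewrite mulrDr mulr1 lerD2l; apply: pay_center => //; exact/eqP.
  apply: le_trans (sum_nbrs_le (fun y _ => pt y)) _.
  rewrite /= -mulr_sumr big_split /= sum_nbrs_const mulr1 mulrCA ler_wpM2l//.
  have [lv|lv] := eqVneq (level v) nst.
    by rewrite /= lv addr0; exact: green_at.
  by rewrite mulrDr mulr1 lerD2r; apply: green_step.
- case: I => cA iT ev vK.
  have pt y : phi (step (Trying A i) y) y <= u * G (level y) + pay A i y.
    rewrite /=; case: ifP => [_ /=|_]; first by rewrite addr_ge0.
    case: ifP => [/eqP ly /=|_]; first by rewrite ly eqxx addr0 lerDl.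
    case: ifP => [lz|_].
      case: ifP => yA /=; first by rewrite lerDl.
      have [-> // _] := pay_exit iT (negbT yA).
      case: eqP => [-> |iT1] /=; first by rewrite wT lerDr.
      rewrite lerD2l; apply: pay_center; [by []| |exact/eqP].
      by move: iT iT1; clear; lia.
    case: ifP => [lz|_] //=.
    case: ifP => yA /=; first by rewrite lerDl.
    have [_ -> //] := pay_exit iT (negbT yA).
    case: eqP => [->|iT1] /=.
      by rewrite w0; apply: le_trans (start_le A y) _; rewrite mulrDr mulr1.
    rewrite lerD2l; apply: pay_center; [by []| |exact/eqP].
    by move: iT iT1; clear; lia.
  apply: le_trans (sum_nbrs_le (fun y _ => pt y)) _.
  rewrite /= big_split /= mulrDr; apply: lerD; [exact: sup'|exact: pay_step].
- case: I => cA vn vK.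
  apply: le_trans (sup _ vn vK); apply: sum_nbrs_le => y _ /=.
  case: ifP => [_ //=|_]; case: ifP => [/eqP ly|_] //=.
  by rewrite ly eqxx addr0.
- by rewrite /= mulr0 big1.
by case: nb.
Qed.

(* A walk that has visited every level of the zone between its first visit to [c0]
   and the next visit to [nst], and that later crosses from [nst] to [c0] without
   meeting any of the vertices visited in that period. *)
Definition misses (x : nat -> vertex) : Prop :=
  exists t1 t2 s t3,
    [/\ [/\ level (x t1) = c0, (forall i, (i < t1)%N -> level (x i) != c0), (t1 < t2)%N,
        level (x t2) = nst & forall i, (t1 <= i < t2)%N -> level (x i) != nst],
        [/\ (t2 <= s < t3)%N, level (x s) = nst, level (x t3) = c0 &
        forall i, (s < i <= t3)%N -> level (x i) != nst],
        (forall i, (i <= t3)%N -> level (x i) != K) &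
        forall i j, (s < i <= t3)%N -> (t1 <= j < t2)%N -> x i != x j].

(** A bound on the expected number of visits to [nst], times the value [1 / growth r T] of one
    attempt. *)
Lemma misses_bound :
  prob_le P [set w | X 0%N w = x0 /\ (is_walk (X^~ w) /\ misses (X^~ w))]
    (2 / res nst * rho nst K / growth r T).
Proof.
have I0 : Inv (step Waiting x0) x0 by rewrite /step (ltn_eqF x0c0).
have phi_bad st v : Inv st v -> bad st v -> 1 <= phi st v by move=> _ ->.
have [mE prE] := @machine_bound _ _ _ P X srw _ step Waiting bad Inv phi x0 I0 InvS phi_ge0 phi_bad phi_step.
eexists; first split; first exact: mE.
  move: prE; rewrite {2}/step (ltn_eqF x0c0) /= => prE.
  apply: le_trans prE _; rewrite /G greenE// /u /w growth1 mulrC mul1r //.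
move=> om /= [X0 [wx [t1 [t2 [s [t3 [[l1 f1 t12 l2 f2] [st l3 l4 f3] nK dis]]]]]]]; split => //.
set x := X^~ om in wx l1 f1 l2 f2 l3 l4 f3 nK dis *.
exists t3; set S := state step Waiting x.
have lvS i := walk_level i wx.
have Sr i : S i.+1 = step (S i) (x i.+1) by [].
have before i : (i < t1)%N -> S i = Waiting.
  elim: i => [|i IH] it; first by rewrite /S /= (negbTE (f1 0%N it)).
  by rewrite Sr IH ?(ltnW it)//= (negbTE (f1 _ it)).
have St1 : S t1 = Collecting [:: x t1].
  case: t1 l1 before {f1 t12 f2 dis} => [|t] lt before; first by rewrite /S /= lt eqxx.
  by rewrite Sr before//= lt eqxx.
have coll i : (t1 <= i < t2)%N -> exists2 A, S i = Collecting A &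
    forall v, v \in A <-> exists2 j, (t1 <= j <= i)%N & x j = v.
  move=> /andP[/subnKC <-]; elim: (i - t1)%N => [|k IH] kt.
    exists [:: x t1]; rewrite addn0//= => v; rewrite inE; split.
      by move/eqP ->; exists t1 => //; clear; lia.
    by move=> [j jt <-]; apply/eqP; congr x; move: jt; clear; lia.
  have [A SA HA] := IH ltac:(clear -kt; lia).
  exists (x (t1 + k).+1 :: A).
    by rewrite addnS Sr SA /= (negbTE (f2 _ _))//; clear -kt; lia.
  move=> v; rewrite inE addnS; split.
    case/orP => [/eqP ->|/HA [j jt <-]]; first by exists (t1 + k).+1 => //; clear; lia.
    by exists j => //; clear -jt; lia.
  move=> [j jt <-]; have [->|jk] := eqVneq j (t1 + k).+1; first by rewrite eqxx.
  by apply/orP; right; apply/HA; exists j => //; clear -jt jk; lia.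
have [A SA HA] := coll t2.-1 ltac:(clear -t12; lia).
have zmul j : (j <= T)%N -> (j * a <= T * a)%N by move=> jT; rewrite leq_mul2r jT orbT.
have z_c0' j : (j <= T)%N -> (if dir then z j <= c0 else c0 <= z j)%N.
  move=> jT; have := zmul _ jT; have := z_c0; rewrite (zE jT) (zE (leqnn T)); move: zT; clear; case: dir => /=; lia.
have z_nst j : (j <= T)%N -> (if dir then nst < z j else z j < nst)%N.
  by move=> jT; have := nst_z; rewrite (zE jT); clear; case: dir => /=; lia.
(* On its way from [c0] to [nst] the walk visits every grid level. *)
have cA : covers A.
  apply/allP => j; rewrite mem_iota ltnS => /andP[_ jT].
  have [i it li] : exists2 i, (t1 <= i <= t2)%N & level (x i) = z j.
    apply: contrapT => H; have := z_c0' j jT; have := z_nst j jT.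
    have ne i : (t1 <= i <= t2)%N -> level (x i) != z j.
      by move=> it; apply/eqP => E; apply: H; exists i.
    have ne1 := ne t1 ltac:(clear -t12; lia); rewrite l1 in ne1.
    case: dir => h1 h2.
      have := @walk_stays_above x (z j) t1 t2 wx; rewrite l1 l2 => /(_ _ (ltnW t12)) Q.
      suff : (z j < nst)%N by clear -h1; lia.
      by apply: Q => [|i it]; [clear -h2 ne1; lia|apply: ne; clear -it; lia].
    have := @walk_stays_below x (z j) t1 t2 wx; rewrite l1 l2 => /(_ _ (ltnW t12)) Q.
    suff : (nst < z j)%N by clear -h1; lia.
    by apply: Q => [|i it]; [clear -h2 ne1; lia|apply: ne; clear -it; lia].
  apply/hasP; exists (x i); last by rewrite li.
  apply/HA; exists i => //; have : i <> t2.
    by move=> E; move: li; rewrite E l2; have := z_nst j jT; clear; case: dir; lia.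
  by clear -it; lia.
have St2 : S t2 = Starting A.
  have E : t2 = t2.-1.+1 by clear -t12; lia.
  by rewrite E Sr SA -E /= l2 eqxx cA.
have ok i : (t2 <= i <= s)%N ->
    S i = Starting A \/ (exists j, S i = Trying A j) \/ S i = Spoiled A \/ S i = Missed.
  move=> /andP[/subnKC <-]; elim: (i - t2)%N => [|k IH] ks; first by rewrite addn0; left.
  rewrite addnS Sr; have /andP[_ st3] := st; have nKk := nK (t2 + k).+1 ltac:(clear -ks st3; lia).
  case: (IH ltac:(clear -ks; lia)) => [->|[[j ->]|[->|->]]] /=; rewrite ?(negbTE nKk).
  - by case: ifP => _; [case: ifP => _; eauto|eauto].
  - by do 6?case: ifP => _; eauto.
  - by case: ifP => _; eauto.
  - by eauto.
have Ss : S s = Starting A \/ S s = Missed.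
  have [ts|ts] := eqVneq t2 s; first by left; rewrite -ts.
  have /andP[t2s st3] := st; have E : s = s.-1.+1 by clear -ts t2s; lia.
  have nKs := nK s (ltnW st3).
  have n1 : (level (x s) == z 1) = false.
    by apply/eqP => E'; have := z_nst 1%N (ltnW T_gt1); rewrite -E' l3; clear; case: dir; lia.
  rewrite E Sr -E; case: (ok s.-1 ltac:(clear -ts t2s; lia)) => [->|[[j ->]|[->|->]]] /=;
    rewrite ?(negbTE nKs) ?n1 ?l3 ?eqxx; auto.
(* Between [s] and [t3] neither [nst], nor [K], nor [A] interrupts the attempt, and the states other
   than [Missed] keep the walk short of [c0]. *)
have main i : (s <= i <= t3)%N -> S i = Missed \/
    (S i = Starting A /\ precedes dir (level (x i)) (z 1)) \/
    (exists j, [/\ S i = Trying A j, (0 < j < T)%N, precedes dir (z j.-1) (level (x i)) &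
      precedes dir (level (x i)) (z j.+1)]).
  move=> /andP[/subnKC <-]; elim: (i - s)%N => [|k IH] ks.
    rewrite addn0; case: Ss => ->; [right; left; split => //|by left].
    by rewrite l3; exact: z_nst 1%N (ltnW T_gt1).
  have ss : (s < (s + k).+1 <= t3)%N by clear -ks; lia.
  rewrite addnS Sr; set y := x (s + k).+1.
  have nKk : level y != K by apply: nK; case/andP: ss.
  have yA : (y \in A) = false.
    apply/negbTE/negP => /HA [j jt E]; have jt' : (t1 <= j < t2)%N by clear -jt t12; lia.
    by have := dis (s + k).+1 j ss jt'; move/eqP; apply; exact: esym E.
  have yn : level y != nst by apply: f3.
  have ly := lvS (s + k)%N; rewrite -/y in ly.
  case: (IH ltac:(clear -ks; lia)) => [->|[[-> lS]|[j [-> jT lp ln]]]] /=; first by left.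
    rewrite (negbTE nKk) yA; case: eqP => lz.
      right; right; exists 1%N; rewrite lz; split => //.
        exact: (z_precedes (ltnW T_gt1)).
      exact: z_precedes.
    by right; left; split => //; exact: (precedes_next ly lz lS).
  have [j0 jT'] := andP jT.
  rewrite (negbTE nKk) (negbTE yn) yA; case: eqP => lz.
    case: eqP => jT1; first by left.
    have jT2 : (j.+1 < T)%N by clear -jT1 jT'; lia.
    right; right; exists j.+1; rewrite lz; split => //.
      exact: (z_precedes jT').
    exact: z_precedes.
  case: eqP => lz'.
    case: eqP => j1.
      right; left; split => //; rewrite lz' j1; exact: z_precedes (ltnW T_gt1).
    have [j' E] : exists j', j = j'.+2 by exists j.-2; clear -j0 j1; lia.
    rewrite E /= in lz' jT' j1 *; right; right; exists j'.+1; rewrite lz'; split => //.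
    - exact: ltnW.
    - exact: z_precedes (ltnW (ltnW jT')).
    exact: z_precedes (ltnW jT').
  right; right; exists j; split => //; last exact: (precedes_next ly lz ln).
  exact: (precedes_prev ly lz' lp).
have [s3 t3E] : (s <= t3)%N /\ (t3 <= t3)%N by case/andP: st => _ /ltnW.
have [//|[[_ l]|[j [_ jT _ l]]]] := main t3 ltac:(by rewrite s3).
  by have := z_c0' 1%N (ltnW T_gt1); move: l; rewrite l4; clear; rewrite /precedes; case: dir; lia.
have /andP[_ jT'] := jT.
by have := z_c0' j.+1 jT'; move: l; rewrite l4; clear; rewrite /precedes; case: dir; lia.
Qed.

End Intersection.

Local Close Scope ring_scope.

(** * A deterministic criterion *)

Lemma first_after (A : pred nat) t0 t : t0 < t -> A t ->
  exists2 s, t0 < s <= t & A s /\ forall i, t0 < i < s -> ~~ A i.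
Proof.
move=> t0t At; have ex : exists s, (t0 < s) && A s by exists t; rewrite t0t.
case: (ex_minnP ex) => s /andP[ts As] mins; exists s; last first.
  split=> // i /andP[ti is_]; apply/negP => Ai; have := mins i; rewrite ti Ai => /(_ isT); lia.
by rewrite ts; apply: mins; rewrite t0t.
Qed.

Lemma last_before (A : pred nat) t0 t : t0 < t -> A t0 ->
  exists2 r, t0 <= r < t & A r /\ forall i, r < i < t -> ~~ A i.
Proof.
move=> t0t At; have ex : exists s, (t0 <= s < t) && A s by exists t0; rewrite leqnn t0t.
have ub i : (t0 <= i < t) && A i -> i <= t by move=> /andP[/andP[_ /ltnW]].
case: (ex_maxnP ex ub) => r /andP[tr Ar] maxr; exists r => //; split=> // i /andP[ri it].
by apply/negP => Ai; have := maxr i; rewrite Ai andbT => H; have := H ltac:(lia); lia.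
Qed.

Section LevelPaths.
Variable x : nat -> vertex.
Hypothesis wx : is_walk x.

Lemma visits_up m s t : s <= t -> level (x s) < m <= level (x t) ->
  exists2 i, s < i <= t & level (x i) = m.
Proof.
move=> st H; apply: contrapT => no.
suff : level (x t) < m by lia.
apply: (@walk_stays_below x m s t wx) => //; first lia.
by move=> i it; apply/eqP => E; apply: no; exists i.
Qed.

Lemma visits_down m s t : s <= t -> level (x t) <= m < level (x s) ->
  exists2 i, s < i <= t & level (x i) = m.
Proof.
move=> st H; apply: contrapT => no.
suff : m < level (x t) by lia.
apply: (@walk_stays_above x m s t wx) => //; first lia.
by move=> i it; apply/eqP => E; apply: no; exists i.
Qed.

Lemma above_back m i t : i <= t -> m < level (x t) ->
  (forall k, i <= k < t -> level (x k) != m) -> m < level (x i).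
Proof.
move=> it mt no; rewrite ltnNge; apply/negP => im.
have [E|E] := eqVneq (level (x i)) m.
  have [ti|ti] := eqVneq i t; first by rewrite ti in E; lia.
  by have := no i ltac:(lia); rewrite E eqxx.
have [k kt lk] := @visits_up m i t it ltac:(lia).
have : k != t by apply/eqP => kE; rewrite kE in lk; lia.
by move=> kt'; have := no k ltac:(lia); rewrite lk eqxx.
Qed.

Lemma below_back m i t : i <= t -> level (x t) < m ->
  (forall k, i <= k < t -> level (x k) != m) -> level (x i) < m.
Proof.
move=> it mt no; rewrite ltnNge; apply/negP => im.
have [E|E] := eqVneq (level (x i)) m.
  have [ti|ti] := eqVneq i t; first by rewrite ti in E; lia.
  by have := no i ltac:(lia); rewrite E eqxx.
have [k kt lk] := @visits_down m i t it ltac:(lia).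
have : k != t by apply/eqP => kE; rewrite kE in lk; lia.
by move=> kt'; have := no k ltac:(lia); rewrite lk eqxx.
Qed.

End LevelPaths.

Section NotCutpoint.
Context {d : measure_display} {Omega : measurableType d}.
Variables (X : nat -> Omega -> vertex) (w : Omega).
Let x := X^~ w.
Hypothesis wx : is_walk x.
Variables (s : vertex) (lo n1 n2 hi p q K m : nat).
Hypothesis x0lo : level (x 0) < lo.
Hypothesis lo_n1 : lo < n1.
Hypothesis n1_s : n1 <= level s.
Hypothesis s_n2 : level s < n2.
Hypothesis n2_hi : n2 < hi.
Hypothesis p_lo : p <= lo.
Hypothesis hi_q : hi < q.
Hypothesis qK : q < K.
Hypothesis s_m : level s <= m.
Hypothesis mK : m < K.
Hypothesis unbounded : forall k, exists t, k <= level (x t).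
Hypothesis no_return : ~ phases (at_level [:: K; m]) (at_level_opt [:: None; None]) 2 x.
Hypothesis no_escape : ~ escapes p q K x.
Hypothesis no_single_return : ~ phases (at_level [:: hi; q; lo; hi; K])
        (at_level_opt [:: None; Some lo; None; None; Some lo]) 5 x.
Hypothesis not_all_crossings : ~ phases (cross_target s lo hi) (cross_avoid lo hi) 10 x.
Hypothesis meets_below : ~ misses n1 lo K x.
Hypothesis meets_above : ~ misses n2 hi K x.

Let H := remove_vertex (walk_path X w) s.
Let conn := clos_refl_trans vertex (adj H).

Let conn_refl v : conn v v. Proof. exact: rt_refl. Qed.
Let conn_trans u v v' : conn u v -> conn v v' -> conn u v'. Proof. exact: rt_trans. Qed.
Let conn_sym u v : conn u v -> conn v u.
Proof.
elim=> [a b [[t tab] ? ?]|a|a b c _ h1 _ h2]; [|exact: rt_refl|exact: rt_trans h2 h1].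
by apply: rt_step; split => //; exists t; case: tab; [right|left].
Qed.

Let conn_segment i j : i <= j -> (forall k, i <= k <= j -> x k <> s) -> conn (x i) (x j).
Proof.
move=> /subnKC <-; elim: (j - i) => [|k IH] ns; first by rewrite addn0; exact: conn_refl.
rewrite addnS; apply: conn_trans (IH _) _; first by move=> l l1; apply: ns; lia.
apply: rt_step; split; [|by apply: ns; lia|by apply: ns; lia].
by exists (i + k); left; split; rewrite // addnS.
Qed.

Let neq_s k : level (x k) <> level s -> x k <> s.
Proof. by move=> E kE; apply: E; rewrite kE. Qed.

Let at_lev i n := level (x i) == n.

(* Removing [s] leaves two connected hubs: what the walk visits before [n1], and what it
   visits between [hi] and its next visit to [n2].  The ends at [lo] of the later crossings
   are joined to the first hub, the ends at [hi] and the final escape to the second one,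
   and some crossing avoids [s]. *)
Lemma not_cutpoint : ~ cutpoint (walk_path X w) (X 0 w) s.
Proof.
move=> [_ fin].
have [tK [tK0 lK fK]] : exists tK, [/\ 0 < tK, level (x tK) = K & forall i, i < tK -> level (x i) < K].
  have [t Kt] := unbounded K.
  have [i it li] := @visits_up x wx K 0 t ltac:(lia) ltac:(lia).
  have [j jt [/eqP lj fj]] := @first_after (fun i => level (x i) == K) 0 i ltac:(lia) ltac:(by apply/eqP).
  exists j; split => //; first lia.
  move=> k kj; apply: (@walk_stays_below x K 0 k wx); [lia|lia|].
  by move=> l lk; apply: fj; lia.
have first n : level (x 0) < n <= K -> exists2 t, 0 < t <= tK &
    level (x t) = n /\ forall i, 0 < i < t -> level (x i) != n.
  move=> Hn; have [i it li] := @visits_up x wx n 0 tK ltac:(lia) ltac:(lia).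
  have [j jt [/eqP lj fj]] := @first_after (at_lev^~ n) 0 i ltac:(lia) ltac:(by apply/eqP).
  by exists j => //; lia.
have [ta ta_tK [lta fta]] := first lo ltac:(lia).
have [h1 h1_tK [lh1 fh1]] := first hi ltac:(lia).
have [tq tq_tK [ltq ftq]] := first q ltac:(lia).
have fst_lt m1 t1 m2 t2 : 0 < t2 -> level (x 0) < m1 < m2 -> level (x t2) = m2 ->
    (forall i, 0 < i < t1 -> level (x i) != m1) -> t1 < t2.
  move=> t20 h lt2 ft1; have [i it li] := @visits_up x wx m1 0 t2 ltac:(lia) ltac:(lia).
  rewrite ltnNge; apply/negP => t21; have [E|E] := eqVneq i t2.
    by rewrite -E li in lt2; lia.
  by have := ft1 i ltac:(lia); rewrite li eqxx.
have ta_h1 : ta < h1 by apply: (fst_lt lo _ hi) => //; lia.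
have h1_tq : h1 < tq by apply: (fst_lt hi _ q) => //; lia.
have tq_lt : tq < tK by apply: (fst_lt q _ K) => //; lia.
(* Since [p] is not escaped, the walk comes down from [q] to [p], hence through [lo], before
   [tK]. *)
have [r rt lr] : exists2 r, tq < r < tK & level (x r) = lo.
  have [i it li] : exists2 i, tq < i < tK & level (x i) = p.
    apply: contrapT => no; apply: no_escape.
    exists (fun j => nth 0 [:: 0; tq; tK] j); split => // -[|[|]]//= _.
      split => //=; [lia|by rewrite /at_level /= ltq|move=> i it].
      by rewrite /at_level /at_level_opt /=; split => //; apply: ftq; lia.
    split => //; first by rewrite /at_level /= lK.
    move=> i it; rewrite /at_level /at_level_opt /=; split.
      by rewrite neq_ltn fK//; lia.
    by apply/eqP => -[E]; apply: no; exists i.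
  have [k kt lk] := @visits_down x wx lo tq i ltac:(lia) ltac:(lia).
  by exists k => //; lia.
have next t n b : t < b -> level (x b) = n -> exists2 t', t < t' <= b &
    level (x t') = n /\ forall i, t < i < t' -> level (x i) != n.
  move=> tb lb; have [j jt [/eqP lj fj]] := @first_after (at_lev^~ n) t b tb ltac:(by apply/eqP).
  by exists j.
have next_hi t : t < tK -> level (x t) < hi -> exists2 t', t < t' < tK &
    level (x t') = hi /\ forall i, t < i < t' -> level (x i) != hi.
  move=> ttK lt_; have [i it li] := @visits_up x wx hi t tK ltac:(lia) ltac:(lia).
  have [t' tt' [lt' ft']] := next t hi i ltac:(lia) li; exists t' => //.
  have : t' != tK by apply/eqP => E; rewrite E lK in lt'; lia.
  by lia.
have [l1 l1r [ll1 fl1]] := next h1 lo r ltac:(lia) lr.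
have [h2 h2t [lh2 fh2]] := next_hi l1 ltac:(lia) ltac:(lia).
(* A second return to [lo]. If the first one follows [tq], its being the only one would be a single
   return; if it precedes [tq], the walk has met [hi] again before [tq], and the return [r] is
   another one. *)
have [r2 r2t lr2] : exists2 r2, h2 < r2 < tK & level (x r2) = lo.
  have [ql|lq] := ltnP tq l1.
    apply: contrapT => no; apply: no_single_return.
    exists (fun j => nth 0 [:: 0; h1; tq; l1; h2; tK] j); split => // -[|[|[|[|[|]]]]] //= _;
      rewrite /at_level /at_level_opt /=.
    - split; [lia|by rewrite lh1|move=> i it; split => //]; exact: fh1.
    - split; [lia|by rewrite ltq|move=> i it; split; first by apply: ftq; lia].
      by have := fl1 i ltac:(lia); apply: contraNN => /eqP[->].
    - by split; [lia|rewrite ll1|move=> i it; split => //; apply: fl1; lia].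
    - by split; [lia|rewrite lh2|move=> i it; split => //; apply: fh2; lia].
    - split; [lia|by rewrite lK|move=> i it; split; first by rewrite neq_ltn fK//; lia].
      by apply/eqP => -[E]; apply: no; exists i.
  exists r => //; have [i it li] := @visits_up x wx hi l1 tq ltac:(lia) ltac:(lia).
  have : h2 <= i by rewrite leqNgt; apply/negP => ih; have := fh2 i ltac:(lia); rewrite li eqxx.
  lia.
have [l2 l2r [ll2 fl2]] := next h2 lo r2 ltac:(lia) lr2.
have [h3 h3t [lh3 fh3]] := next_hi l2 ltac:(lia) ltac:(lia).
have [tn tn_tK [ltn_ ftn]] := first n1 ltac:(lia).
have ta_tn : ta < tn by apply: (fst_lt lo _ n1) => //; lia.
have tn_h1 : tn < h1 by apply: (fst_lt n1 _ hi) => //; lia.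
have low_hub i : i < tn -> conn (x 0) (x i).
  move=> itn; apply: conn_segment => // k ki; apply: neq_s.
  have : level (x k) < n1.
    apply: (@walk_stays_below x n1 0 k wx) => //; first lia.
    by move=> l lk; apply: ftn; lia.
  lia.
have [tm tmt [ltm ftm]] : exists2 tm, h1 < tm < l1 & level (x tm) = n2 /\
    forall i, h1 < i < tm -> level (x i) != n2.
  have [i it li] := @visits_down x wx n2 h1 l1 ltac:(lia) ltac:(lia).
  have [t' tt' [lt' ft']] := next h1 n2 i ltac:(lia) li; exists t' => //.
  have : t' != l1 by apply/eqP => E; rewrite E ll1 in lt'; lia.
  lia.
have hub_above k : h1 <= k < tm -> n2 < level (x k).
  move=> kt; apply: (@walk_stays_above x n2 h1 k wx); [lia|lia|].
  by move=> l lk; apply: ftm; lia.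
have high_hub j : h1 <= j < tm -> conn (x h1) (x j).
  move=> jt; apply: conn_segment; first lia.
  by move=> k ki; apply: neq_s; have := hub_above k ltac:(lia); lia.
have noK i t : i <= t -> t < tK -> level (x i) != K.
  by move=> it ttK; rewrite neq_ltn fK//; lia.
(* The end of the crossing, after its last visit to [n1], avoids [s] and meets a vertex of the first
   hub by [meets_below]. *)
have low_end l h : tn < h < l -> l < tK -> level (x h) = hi -> level (x l) = lo -> conn (x 0) (x l).
  move=> hl ltK lh ll; have [i it li] := @visits_down x wx n1 h l ltac:(lia) ltac:(lia).
  have il : i < l.
    by rewrite ltn_neqAle (andP it).2 andbT; apply/eqP => E; rewrite E ll in li; lia.
  have [r' rt' [/eqP lr' fr']] := @last_before (at_lev^~ n1) i l il ltac:(by apply/eqP).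
  have fr'' k : r' < k <= l -> level (x k) != n1.
    move=> kt; have [->|kl] := eqVneq k l; first by rewrite ll; lia.
    by apply: fr'; lia.
  have [i' [j [it' jt' E]]] : exists i' j, [/\ r' < i' <= l, ta <= j < tn & x i' = x j].
    apply: contrapT => no; apply: meets_below; exists ta, tn, r', l; split.
    - split => //; first by move=> i0 h0; case: i0 h0 => [|i0] h0; [lia|apply: fta; lia].
      by move=> i0 h0; apply: ftn; lia.
    - by split => //; lia.
    - by move=> i0 h0; apply: noK h0 ltK.
    - by move=> i0 j h0 h0'; apply/eqP => E; apply: no; exists i0, j.
  apply: conn_trans (low_hub j ltac:(lia)) _; rewrite -E.
  apply: conn_segment; first lia.
  move=> k ki; apply: neq_s; have : level (x k) < n1; last lia.
  by apply: (@below_back x wx n1 k l); [lia|lia|move=> l' h0; apply: fr''; lia].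
have high_end h r' : tm <= r' < h -> h < tK -> level (x r') = n2 -> level (x h) = hi ->
    (forall k, r' < k <= h -> level (x k) != n2) -> conn (x h1) (x h).
  move=> rh htK lr' lh fr'.
  have [i' [j [it' jt' E]]] : exists i' j, [/\ r' < i' <= h, h1 <= j < tm & x i' = x j].
    apply: contrapT => no; apply: meets_above; exists h1, tm, r', h; split.
    - split => //; [|lia|]; first by move=> i0 h0; case: i0 h0 => [|i0] h0; [lia|apply: fh1; lia].
      by move=> i0 h0; have := hub_above i0 h0; lia.
    - by split => //; lia.
    - by move=> i0 h0; apply: noK h0 htK.
    - by move=> i0 j h0 h0'; apply/eqP => E; apply: no; exists i0, j.
  apply: conn_trans (high_hub j jt') _; rewrite -E.
  apply: conn_segment; first lia.
  move=> k ki; apply: neq_s; have : n2 < level (x k); last lia.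
  by apply: (@above_back x wx n2 k h); [lia|lia|move=> l' h0; apply: fr'; lia].
have high_end' l h : tm < l < h -> h < tK -> level (x l) = lo -> level (x h) = hi -> conn (x h1) (x h).
  move=> lh_ htK ll lh; have [i it li] := @visits_up x wx n2 l h ltac:(lia) ltac:(lia).
  have ih : i < h.
    by rewrite ltn_neqAle (andP it).2 andbT; apply/eqP => E; rewrite E lh in li; lia.
  have [r' rt' [/eqP lr' fr']] := @last_before (at_lev^~ n2) i h ih ltac:(by apply/eqP).
  apply: (high_end h r') => //; first lia.
  move=> k kt; have [->|kl] := eqVneq k h; first by rewrite lh; lia.
  by apply: fr'; lia.
(* After its last visit to [n2] before [tK] the walk passes [hi] and stays above [n2] until [tK]. *)
have final : conn (x h1) (x tK).
  have [r' rt' [/eqP lr' fr']] := @last_before (at_lev^~ n2) tm tK ltac:(lia) ltac:(by apply/eqP).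
  have [h' ht' [lh' fh']] := next_hi r' ltac:(lia) ltac:(lia).
  apply: (conn_trans (v := x h')).
    by apply: (high_end h' r') => //; [lia|lia|move=> k kt; apply: fr'; lia].
  apply: conn_segment; first lia.
  move=> k ki; apply: neq_s; have : n2 < level (x k); last lia.
  apply: (@above_back x wx n2 k tK); [lia|lia|move=> l' h0; apply: fr'; lia].
have cross : conn (x 0) (x tK).
  have lo_s i : level (x i) = lo -> x i <> s by move=> E; apply: neq_s; lia.
  have hi_s i : level (x i) = hi -> x i <> s by move=> E; apply: neq_s; lia.
  have seg i j : i < j -> x i <> s -> x j <> s -> (forall k, i < k < j -> x k <> s) -> conn (x i) (x j).
    move=> ij xi xj xk; apply: conn_segment; first exact: ltnW.
    move=> k kij; have [->//|ki] := eqVneq k i; have [->//|kj] := eqVneq k j.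
    by apply: xk; lia.
  have c_h2 : conn (x h1) (x h2) by apply: (high_end' l1); lia.
  have c_h3 : conn (x h1) (x h3) by apply: (high_end' l2); lia.
  have c_l1 : conn (x 0) (x l1) by apply: (low_end l1 h1); lia.
  have c_l2 : conn (x 0) (x l2) by apply: (low_end l2 h2); lia.
  have c_ta : conn (x 0) (x ta) by exact: low_hub.
  have dec i j : i < j -> x i <> s -> x j <> s ->
      conn (x i) (x j) \/ exists2 k, i < k < j & x k = s /\ forall l, i < l < k -> x l <> s.
    move=> ij xi xj.
    have [[k kij ks]|no] := pselect (exists2 k, i < k < j & x k = s).
      right; have [k' kk' [/eqP k1 k2]] := @first_after (fun k => x k == s) i k ltac:(lia) ltac:(by apply/eqP).
      exists k'; first lia; split => // l li; have := k2 l li; by move/eqP.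
    by left; apply: seg => // k kij ks; apply: no; exists k.
  (* The ends of each crossing are joined to opposite hubs, so one crossing that avoids [s] is
     enough. If all five meet [s], their first visits to [s] contradict [not_all_crossings]. *)
  case: (dec ta h1 ta_h1 (lo_s _ lta) (hi_s _ lh1)) => [c|[k1 k1t [xk1 fk1]]].
    exact: conn_trans c_ta (conn_trans c final).
  case: (dec h1 l1 ltac:(lia) (hi_s _ lh1) (lo_s _ ll1)) => [c|[k2 k2t [xk2 fk2]]].
    exact: conn_trans c_l1 (conn_trans (conn_sym c) final).
  case: (dec l1 h2 ltac:(lia) (lo_s _ ll1) (hi_s _ lh2)) => [c|[k3 k3t [xk3 fk3]]].
    exact: conn_trans c_l1 (conn_trans c (conn_trans (conn_sym c_h2) final)).
  case: (dec h2 l2 ltac:(lia) (hi_s _ lh2) (lo_s _ ll2)) => [c|[k4 k4t [xk4 fk4]]].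
    exact: conn_trans c_l2 (conn_trans (conn_sym c) (conn_trans (conn_sym c_h2) final)).
  case: (dec l2 h3 ltac:(lia) (lo_s _ ll2) (hi_s _ lh3)) => [c|[k5 k5t [xk5 fk5]]].
    exact: conn_trans c_l2 (conn_trans c (conn_trans (conn_sym c_h3) final)).
  exfalso; apply: not_all_crossings.
  have sE i : x i <> s -> (x i == s) = false by move/eqP/negbTE.
  exists (fun j => nth 0 [:: 0; ta; k1; h1; k2; l1; k3; h2; k4; l2; k5] j); split => //.
  move=> [|[|[|[|[|[|[|[|[|[|]]]]]]]]]] //= _; rewrite /cross_target /cross_avoid /=.
  - by split; [lia|rewrite lta|move=> i it; split => //; apply: fta; lia].
  - split; [lia|by rewrite xk1|move=> i it; split; first by rewrite sE//; apply: fk1; lia].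
    by apply: fh1; lia.
  - by split; [lia|rewrite lh1|move=> i it; split => //; apply: fh1; lia].
  - split; [lia|by rewrite xk2|move=> i it; split; first by rewrite sE//; apply: fk2; lia].
    by apply: fl1; lia.
  - by split; [lia|rewrite ll1|move=> i it; split => //; apply: fl1; lia].
  - split; [lia|by rewrite xk3|move=> i it; split; first by rewrite sE//; apply: fk3; lia].
    by apply: fh2; lia.
  - by split; [lia|rewrite lh2|move=> i it; split => //; apply: fh2; lia].
  - split; [lia|by rewrite xk4|move=> i it; split; first by rewrite sE//; apply: fk4; lia].
    by apply: fl2; lia.
  - by split; [lia|rewrite ll2|move=> i it; split => //; apply: fl2; lia].
  - split; [lia|by rewrite xk5|move=> i it; split; first by rewrite sE//; apply: fk5; lia].
    by apply: fh3; lia.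
have after t : tK <= t -> m < level (x t).
  move=> tKt; apply: (@walk_stays_above x m tK t wx) => //; first lia.
  move=> i it; apply/eqP => li; apply: no_return.
  have [t' tt' [lt' ft']] := next tK m i ltac:(lia) li.
  exists (fun j => nth 0 [:: 0; tK; t'] j); split => // -[|[|]]//= _; rewrite /at_level /at_level_opt /=.
    split; [lia|by rewrite lK|move=> j jt; split => //]; by rewrite neq_ltn fK//; lia.
  by split; [lia|rewrite lt'|move=> j jt; split => //; exact: ft'].
(* From [tK] on the walk stays above [m], away from [s], and reaches unbounded levels, so the
   component is infinite. *)
have inf t : tK <= t -> component H (x 0) (x t).
  move=> tt; split.
    split; first by exists 0.
    by move=> /= E; have : level (x 0) = level s by [rewrite -E]; lia.
  apply: conn_trans cross _; apply: conn_segment => // k kt; apply: neq_s.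
  by have := after k ltac:(lia); lia.
have [D fD] : exists D, forall v, component H (x 0) v -> level v <= D.
  move/finite_seqP: fin => [l El]; exists (\max_(v <- l) level v) => v cv.
  have : v \in l by have : [set` l] v by rewrite -El.
  by move=> vl; rewrite (big_rem v)//= leq_maxl.
have [t Dt] := unbounded (maxn D K).+1.
have [tt|tt] := leqP tK t; first by have := fD _ (inf t tt); lia.
by have := fK t tt; lia.
Qed.

End NotCutpoint.

Local Open Scope ring_scope.

(** * Resistances of the stages *)

Lemma rate_gt0 k : (0 < rate k)%N. Proof. by rewrite expn_gt0. Qed.
Lemma rateS k : rate k.+1 = (2 * rate k)%N. Proof. by rewrite /rate expnS. Qed.
Lemma ltn_rate k : (k < rate k)%N. Proof. exact: ltn_expl. Qed.

(** [1920 = 2 * 60 * 16]: a grid of [2 * 2 ^ (8 * c) * (60 * c)] steps of [16 * c] levels must fit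
    into [2 ^ (9 * c)] levels. *)
Lemma quadratic_lt_exp c : (32 <= c)%N -> (1920 * c * c + 16 * c < 2 ^ c)%N.
Proof.
move=> /subnKC <-; elim: (c - 32)%N => [|n IH].
  have -> : (2 ^ (32 + 0) = 2 ^ 11 * (2 ^ 11 * 2 ^ 10))%N by rewrite -!expnD.
  have -> : (2 ^ 11 = 2048)%N by [].
  have -> : (2 ^ 10 = 1024)%N by [].
  by lia.
rewrite addnS expnS; move: IH; set e := (2 ^ _)%N; nia.
Qed.

Section Powers.
Variable R : realType.
Local Notation hp n := (2^-1 ^+ n : R).

Lemma hp_gt0 n : 0 < hp n. Proof. by rewrite exprn_gt0// invr_gt0. Qed.
Lemma hp_ge0 n : 0 <= hp n. Proof. exact/ltW/hp_gt0. Qed.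

Lemma hp_le m n : (m <= n)%N -> hp n <= hp m.
Proof. by move=> mn; apply: ler_wiXn2l => //; rewrite ?invr_ge0// invf_le1// ler1n. Qed.

Lemma hpD m n : hp (m + n) = hp m * hp n. Proof. exact: exprD. Qed.

Lemma hp_pow m n : (m <= n)%N -> (2 ^ m)%:R * hp n = hp (n - m).
Proof.
move=> mn; rewrite natrX -{1}(subnKC mn) exprD mulrA -exprMn divff ?expr1n ?mul1r//.
Qed.

Lemma pow_hp m : (2 ^ m)%:R * hp m = 1.
Proof. by rewrite hp_pow// subnn expr0. Qed.

Lemma hpV m : (hp m)^-1 = (2 ^ m)%:R.
Proof. by rewrite exprVn invrK natrX. Qed.

Local Notation rho := (rho R).
Local Notation res := (res R).

Lemma rho_const m n a : (forall j, (m <= j < n)%N -> width j = a) ->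
  rho m n = (n - m)%:R * hp a.
Proof.
move=> H; rewrite /rho (eq_big_nat _ _ (F2 := fun=> hp a)).
  by rewrite big_const_nat iter_addr_0 mulr_natl.
by move=> j Hj; rewrite /res H.
Qed.

Lemma rho_stage k i j : (i <= j <= stage_len k)%N ->
  rho (stage k + i) (stage k + j) = (j - i)%:R * hp (16 * rate k).
Proof.
move=> H; rewrite (@rho_const _ _ (16 * rate k)); first by congr (_%:R * _); lia.
by move=> l Hl; apply: width_in_stage; lia.
Qed.

Lemma rho_full_stage k : rho (stage k) (stage k + stage_len k) = hp k.
Proof.
have := @rho_stage k 0 (stage_len k); rewrite addn0 leq0n leqnn subn0 => ->//.
by rewrite hp_pow; [congr (_ ^+ _)|]; have := ltn_rate k; lia.
Qed.

Lemma rho_widen k : rho (stage k + stage_len k) (stage k.+1) <= 2 * hp (16 * rate k).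
Proof.
have H i : (i <= 16 * rate k)%N ->
    rho (stage k + stage_len k) (stage k + stage_len k + i) = 2 * hp (16 * rate k) - 2 * hp (16 * rate k + i).
  elim: i => [|i IH] Hi; first by rewrite addn0 rhonn addn0 subrr.
  rewrite addnS rhoSr ?leq_addr// IH ?(ltnW Hi)// /res.
  rewrite width_widen ?(ltnW Hi)//; last by apply: width_in_stage; rewrite leq_addr leqnn.
  rewrite addnS exprS; set y := 2^-1 ^+ (_ + _); by lra.
by rewrite /= H//; have := hp_gt0 (16 * rate k + 16 * rate k); lra.
Qed.

(** Stage [k] and its widening levels each add at most [hp k], and
    [4 * hp k - 4 * hp k.+1 = 2 * hp k]. *)
Lemma rho_to_stage k : rho 0 (stage k) <= 8 - 4 * hp k.
Proof.
elim: k => [|k IH].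
  have H i : (i <= 16)%N -> rho 0 i = 2 - 2 * hp i.
    elim: i => [|i IHi] Hi; first by rewrite rhonn expr0 mulr1 subrr.
    rewrite rhoSr// IHi ?(ltnW Hi)// /res width_small ?(ltnW Hi)// exprS.
    by set y := 2^-1 ^+ _; lra.
  by rewrite H//= expr0 mulr1; have := hp_gt0 16; lra.
rewrite (@rho_cat R 0 (stage k)) ?leq_stage2//.
rewrite (@rho_cat R (stage k) (stage k + stage_len k)) ?leq_addr ?stageS//.
rewrite rho_full_stage; have := rho_widen k.
have : 2 * hp (16 * rate k) <= hp k.
  have : hp (16 * rate k) <= hp k.+1 by apply: hp_le; have := ltn_rate k; lia.
  by rewrite exprS; lra.
by rewrite [hp k.+1]exprS; lra.
Qed.

Lemma rho0_le8 n : rho 0 n <= 8.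
Proof.
apply: (@le_trans _ _ (rho 0 (stage n))).
  by apply: le_rho => //; have := leq_stage n; lia.
by have := rho_to_stage n; have := hp_gt0 n; lra.
Qed.

Lemma rho_le8 m n : rho m n <= 8.
Proof. exact: le_trans (le_rho R (leq0n m) (leqnn n)) (rho0_le8 n). Qed.

End Powers.

(** * Zones of constant width that force a meeting *)

Section Zones.
Context {R : realType} {d : measure_display} {Omega : measurableType d}.
Variables (P : probability Omega R) (X : nat -> Omega -> vertex).
Hypothesis srw : simple_random_walk P edge X.
Variable x0 : vertex.
Local Notation hp n := (2^-1 ^+ n : R).

Variables (b c nst K : nat).
Hypothesis c_ge : (32 <= c)%N.
Hypothesis zone : forall j, (b <= j <= b + 2 ^ (9 * c))%N -> width j = (16 * c)%N.
(** By [growth_exp] with [r = 2^-1 ^+ (16 * c)], every [2 * 2 ^ (8 * c)] grid steps double [growth].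
    The [60 * c] doublings outweigh both [2 ^ width nst] and the number of cells, even if the zone
    lies in the previous stage, of half the rate. *)
Let T := (2 * 2 ^ (8 * c) * (60 * c))%N.

Let T_gt1 : (1 < T)%N.
Proof.
have : (0 < 2 ^ (8 * c))%N by rewrite expn_gt0.
by rewrite /T; move: (2 ^ _)%N => e e0; clear -c_ge e0; nia.
Qed.

Let TL : (T * (16 * c) + 1 < 2 ^ (9 * c))%N.
Proof.
have -> : (2 ^ (9 * c) = 2 ^ (8 * c) * 2 ^ c)%N by rewrite -expnD; congr expn; lia.
have := quadratic_lt_exp c_ge; have : (0 < 2 ^ (8 * c))%N by rewrite expn_gt0.
rewrite /T; move: (2 ^ (8 * c))%N (2 ^ c)%N => e f e0 H; clear -e0 H c_ge; nia.
Qed.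

Let growthT : (2 ^ (60 * c))%:R <= growth (hp (16 * c)) T.
Proof.
rewrite natrX; apply: growth_exp.
  rewrite hp_gt0/= exprn_ilt1 ?invr_ge0//; first lia.
  by rewrite invf_lt1// ltr1n.
rewrite -expnD mulrC (_ : (8 * c + 8 * c = 16 * c)%N) ?pow_hp//; lia.
Qed.

Let bound_le : 2 / res R nst * rho R nst K / growth (hp (16 * c)) T
   <= 16 * (2 ^ width nst)%:R * hp (60 * c).
Proof.
have g0 : 0 < ((2 ^ (60 * c))%:R : R) by rewrite ltr0n expn_gt0.
have -> : 2 / res R nst = 2 * (2 ^ width nst)%:R :> R by rewrite /res hpV.
have r8 : rho R nst K <= 8 := rho_le8 R nst K.
have r0 := rho_ge0 R nst K.
have w0 : 0 <= ((2 ^ width nst)%:R : R) by rewrite ler0n.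
apply: (@le_trans _ _ (2 * (2 ^ width nst)%:R * 8 / (2 ^ (60 * c))%:R)).
  apply: ler_pM; rewrite ?invr_ge0 ?mulr_ge0//.
  - exact: le_trans (ltW g0) growthT.
  - by rewrite ler_wpM2l// mulr_ge0.
  - by rewrite lef_pV2// posrE// (lt_le_trans g0 growthT).
have -> : ((2 ^ (60 * c))%:R)^-1 = hp (60 * c) by rewrite -hpV invrK.
move: ((2 ^ width nst)%:R : R) (hp (60 * c)) => A B.
by rewrite le_eqVlt; apply/orP; left; apply/eqP; ring.
Qed.

Lemma misses_below_bound : (b + 2 ^ (9 * c) <= nst)%N -> (nst < K)%N -> (level x0 < b)%N ->
  prob_le P [set w | X 0%N w = x0 /\ (is_walk (X^~ w) /\ misses nst b K (X^~ w))]
    (16 * (2 ^ width nst)%:R * hp (60 * c)).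
Proof.
(* The [- 1] keeps the grid strictly below [nst], which may be the top level of the zone. *)
move=> bn nK xb; pose z i := (b + 2 ^ (9 * c) - 1 - i * (16 * c))%N.
have tl := TL.
have [E [mE pE] sE] := @misses_bound _ _ _ P X srw x0 nst b K T (16 * c)%N z false T_gt1
  ltac:(lia) ltac:(move=> i _; rewrite /z /=; lia) ltac:(rewrite /z /=; lia)
  ltac:(move=> k; rewrite /z /= => hk; apply: zone; lia) ltac:(rewrite /z /=; lia)
  ltac:(rewrite /z /=; lia) nK ltac:(lia) xb.
by exists E => //; split => //; exact: le_trans pE bound_le.
Qed.

Lemma misses_above_bound : nst = b -> (b + 2 ^ (9 * c) < K)%N -> (level x0 < b)%N ->
  prob_le P [set w | X 0%N w = x0 /\ (is_walk (X^~ w) /\ misses nst (b + 2 ^ (9 * c)) K (X^~ w))]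
    (16 * (2 ^ width nst)%:R * hp (60 * c)).
Proof.
move=> bn nK xb; pose z i := (b + 1 + i * (16 * c))%N.
have tl := TL.
have [E [mE pE] sE] := @misses_bound _ _ _ P X srw x0 nst (b + 2 ^ (9 * c))%N K T (16 * c)%N z true T_gt1
  ltac:(lia) ltac:(move=> i _; rewrite /z /=; lia) ltac:(rewrite /z /=; lia)
  ltac:(move=> k; rewrite /z /= => hk; apply: zone; lia) ltac:(rewrite /z /=; lia)
  ltac:(rewrite /z /=; lia) ltac:(lia) nK ltac:(lia).
by exists E => //; split => //; exact: le_trans pE bound_le.
Qed.

End Zones.

(** * The cells of a stage *)

Section ProbLe.
Context {R : realType} {d : measure_display} {Omega : measurableType d}.
Variable P : probability Omega R.

Lemma prob_leW (A A' : set Omega) c c' : prob_le P A c -> A' `<=` A -> c <= c' -> prob_le P A' c'.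
Proof.
move=> [E [mE pE] AE] AA cc; exists E; last exact: subset_trans AA AE.
by split => //; exact: le_trans pE cc.
Qed.

Lemma prob_leU (A A' : set Omega) c c' : prob_le P A c -> prob_le P A' c' ->
  prob_le P (A `|` A') (c + c').
Proof.
move=> [E [mE pE] AE] [E' [mE' pE'] AE']; exists (E `|` E'); last exact: setUSS.
split; first exact: measurableU.
by apply: le_trans (prU P mE mE') _; exact: lerD.
Qed.

Lemma prob_le_seq (I : eqType) (r : seq I) (A : I -> set Omega) c :
  (forall i, i \in r -> prob_le P (A i) c) ->
  prob_le P [set w | exists2 i, i \in r & A i w] ((size r)%:R * c).
Proof.
elim: r => [|i r IH] H.
  by exists set0; [split => //; rewrite pr0 mul0r|move=> w [i]].
have Hi := H i (mem_head _ _).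
have Hr : prob_le P [set w | exists2 i, i \in r & A i w] ((size r)%:R * c).
  by apply: IH => j jr; apply: H; rewrite inE jr orbT.
apply: prob_leW (prob_leU Hi Hr) _ _.
  move=> w [j]; rewrite inE => /orP[/eqP -> Aw|jr Aw]; [by left|by right; exists j].
by rewrite /= -natr1 mulrDl mul1r addrC.
Qed.

Lemma prob_le_seqW (I : eqType) (r : seq I) (A : I -> set Omega) n c :
  (forall i, i \in r -> prob_le P (A i) c) -> (size r <= n)%N -> 0 <= c ->
  prob_le P [set w | exists2 i, i \in r & A i w] (n%:R * c).
Proof.
move=> H rn c0; apply: prob_leW (prob_le_seq H) _ _ => //.
by rewrite ler_wpM2r// ler_nat.
Qed.

End ProbLe.

Definition levels (m n : nat) : seq vertex := flatten [seq level_list l | l <- iota m (n - m)].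

Lemma mem_levels m n v : (v \in levels m n) = (m <= level v < n)%N.
Proof.
apply/flatten_mapP/idP => [[l]|H].
  by rewrite mem_iota mem_level_list => H /eqP ->; lia.
by exists (level v); rewrite ?mem_level_list// mem_iota; lia.
Qed.

Lemma size_levels m n W : (forall l, (m <= l < n)%N -> (width l <= W)%N) ->
  (size (levels m n) <= (n - m) * 2 ^ W)%N.
Proof.
move=> H; rewrite /levels size_flatten /shape -map_comp sumnE big_map.
apply: (@leq_trans (\sum_(l <- iota m (n - m)) 2 ^ W)).
  rewrite big_seq [leqRHS]big_seq; apply: leq_sum => l; rewrite mem_iota => Hl /=.
  by rewrite size_level_list leq_pexp2l// H//; lia.
by rewrite big_const_seq count_predT size_iota iter_addn_0 mulnC.
Qed.

Section Cells.
Variable k : nat.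
Hypothesis k6 : (6 <= k)%N.

Local Notation c := (rate k).
Local Notation c' := (rate k.-1).
Definition cell_len := (2 ^ (9 * rate k))%N.
Definition ncells := (2 ^ (7 * rate k - k))%N.
Local Notation L := cell_len.
Local Notation Q := ncells.

(** The last cell also takes the widening levels. The lower zone of the first cell and the upper
    zone of the last one lie in the adjacent stages, at constant width. *)
Definition cell_n1 i := (stage k + i * L)%N.
Definition cell_n2 i := if (i.+1 < Q)%N then (stage k + i.+1 * L)%N else stage k.+1.
Definition cell_lo i :=
  if i == 0%N then (stage k.-1 + stage_len k.-1 - 2 ^ (9 * rate k.-1))%N else (stage k + i.-1 * L)%N.
Definition cell_hi i :=
  (cell_n2 i + 2 ^ (9 * (if i.+1 < Q then rate k else rate k.+1)))%N.

Lemma rate_pred : c = (2 * c')%N.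
Proof. by rewrite -rateS prednK//; lia. Qed.

Lemma rate_pred_ge : (32 <= c')%N.
Proof. by rewrite (_ : 32%N = 2 ^ 5)%N// leq_exp2l//; lia. Qed.

Lemma kc : (k + 7 <= c)%N.
Proof. by have := rate_pred; have := rate_pred_ge; have := ltn_rate k.-1; lia. Qed.

Lemma kc' : (k <= c')%N. Proof. by have := ltn_rate k.-1; lia. Qed.

Lemma cells_len : (Q * L = stage_len k)%N.
Proof. by rewrite /ncells /cell_len -expnD; congr expn; have := kc; lia. Qed.

Lemma stageSE : stage k.+1 = (stage k + Q * L + 16 * c)%N.
Proof. by rewrite cells_len. Qed.

Lemma stage_pred : stage k = (stage k.-1 + stage_len k.-1 + 16 * c')%N.
Proof. by rewrite -[in LHS](@prednK k)//; lia. Qed.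

Lemma c32_lt_pow n : (32 <= n)%N -> (32 * n < 2 ^ n)%N.
Proof. by move=> /quadratic_lt_exp; nia. Qed.

Lemma pow9_pred_ge : (32 * c < 2 ^ (9 * c'))%N.
Proof.
have h := c32_lt_pow rate_pred_ge; apply: leq_trans (_ : 2 ^ c' * 2 ^ c' <= _)%N.
  by rewrite rate_pred; have := rate_pred_ge; nia.
by rewrite -expnD leq_exp2l//; lia.
Qed.

Lemma cell_len_ge : (2 ^ (9 * c') <= L)%N.
Proof. by rewrite leq_exp2l//; have := rate_pred; lia. Qed.

Lemma stage_len_pred_ge : (2 ^ (9 * c') <= stage_len k.-1)%N.
Proof. by rewrite leq_exp2l//; have := kc'; lia. Qed.

Lemma cell_in i j : (i < Q)%N -> (j <= L)%N -> (i * L + j <= stage_len k)%N.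
Proof.
move=> iQ jL; rewrite -cells_len; have : (i.+1 * L <= Q * L)%N by rewrite leq_mul2r iQ orbT.
by rewrite mulSn; lia.
Qed.

Lemma Q_gt2 : (2 < Q)%N.
Proof.
have : (2 ^ 2 <= Q)%N by rewrite leq_exp2l//; have := kc; lia.
exact: leq_trans.
Qed.

Lemma cell_lo_ge i : (stage k.-1 <= cell_lo i)%N.
Proof.
rewrite /cell_lo; case: ifP => _; first by have := stage_len_pred_ge; lia.
by apply: leq_trans (leq_addr _ _); have := stage_pred; lia.
Qed.

Lemma cell_zone_below i : (i < Q)%N -> exists cz, [/\ (c' <= cz <= c)%N,
   (cell_lo i + 2 ^ (9 * cz) <= cell_n1 i)%N &
   forall j, (cell_lo i <= j <= cell_lo i + 2 ^ (9 * cz))%N -> width j = (16 * cz)%N].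
Proof.
move=> iQ; rewrite /cell_lo /cell_n1; case: eqP => [->|i0].
  exists c'; split; first by have := rate_pred; lia.
    by have := stage_pred; have := stage_len_pred_ge; lia.
  by move=> j Hj; apply: (@width_in_stage k.-1); have := stage_len_pred_ge; lia.
exists c; split; first by have := rate_pred; lia.
  by rewrite -/L -[X in (_ <= _ + X * _)%N](@prednK i) ?mulSn; lia.
move=> j; rewrite -/L => Hj; apply: (@width_in_stage k).
have := @cell_in i.-1 L ltac:(lia) (leqnn _); move: Hj.
by move: (i.-1 * L)%N; lia.
Qed.

Lemma cell_zone_above i : (i < Q)%N -> exists cz, [/\ (cz = c /\ (i.+1 < Q)%N) \/ (cz = rate k.+1 /\ i.+1 = Q),
   cell_hi i = (cell_n2 i + 2 ^ (9 * cz))%N &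
   forall j, (cell_n2 i <= j <= cell_n2 i + 2 ^ (9 * cz))%N -> width j = (16 * cz)%N].
Proof.
move=> iQ; rewrite /cell_hi /cell_n2; case: ltnP => iQ'.
  exists c; split => //; first by left.
  move=> j; rewrite -/L => Hj; apply: (@width_in_stage k).
  have := @cell_in i.+1 L iQ' (leqnn _); move: Hj.
  by move: (i.+1 * L)%N; lia.
exists (rate k.+1); split => //; first by right; split => //; lia.
move=> j Hj; apply: (@width_in_stage k.+1).
have : (2 ^ (9 * rate k.+1) <= stage_len k.+1)%N.
  by rewrite leq_exp2l//; have := ltn_rate k.+1; lia.
by lia.
Qed.

Lemma cell_order i : (i < Q)%N -> [/\ (cell_lo i + 2 ^ (9 * c') <= cell_n1 i)%N,
  (cell_n1 i < cell_n2 i)%N, (cell_n2 i + L <= cell_hi i)%N & (cell_n2 i <= stage k.+1)%N].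
Proof.
move=> iQ; have [cz [h1 h2 h3]] := cell_zone_below iQ.
have L0 : (0 < L)%N by rewrite expn_gt0.
split.
- by apply: leq_trans h2; rewrite leq_add2l leq_exp2l//; lia.
- rewrite /cell_n1 /cell_n2; case: ifP => _; first by rewrite ltn_add2l ltn_mul2r ltnSn L0.
  by rewrite stageSE; have := @cell_in i L iQ (leqnn _); rewrite -cells_len; lia.
- by rewrite /cell_hi leq_add2l; case: ifP => _; rewrite leq_exp2l// rateS; lia.
- rewrite /cell_n2; case: ifP => // h; have := @cell_in i.+1 0 h (leq0n _).
  by have := stageS k; lia.
Qed.

Lemma cell_exists n : (stage k <= n < stage k.+1)%N ->
  exists2 i, (i < Q)%N & (cell_n1 i <= n < cell_n2 i)%N.
Proof.
move=> Hn; have L0 : (0 < L)%N by rewrite expn_gt0.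
have [h|h] := ltnP n (stage k + stage_len k); last first.
  exists Q.-1; first by have := Q_gt2; lia.
  rewrite /cell_n1 /cell_n2 prednK; last by have := Q_gt2; lia.
  rewrite ltnn; have : (Q.-1 * L <= Q * L)%N by rewrite leq_mul2r leq_pred orbT.
  by rewrite cells_len; lia.
pose i := ((n - stage k) %/ L)%N; have := divn_eq (n - stage k) L; rewrite -/i.
have := ltn_pmod (n - stage k) L0 => h1 h2.
have iQ : (i < Q)%N by rewrite ltn_divLR// cells_len; lia.
exists i => //; rewrite /cell_n1 /cell_n2; case: ifP => _; first by rewrite mulSn; lia.
by lia.
Qed.

Section Resistances.
Variable R : realType.
Local Notation rho := (rho R).
Local Notation res := (res R).
Local Notation hp n := (2^-1 ^+ n : R).

Lemma hp_pow97 n : (2 ^ (9 * n))%:R * hp (16 * n) = hp (7 * n).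
Proof. by rewrite hp_pow; [congr (_ ^+ _)|]; lia. Qed.

Lemma rho_le_start m n : (m <= n)%N -> rho m n <= (n - m)%:R * res m.
Proof.
move=> mn; rewrite /rho; apply: (@le_trans _ _ (\sum_(m <= j < n) res m)).
  by rewrite big_nat [leRHS]big_nat; apply: ler_sum => j /andP[mj _]; apply: hp_le; exact: leq_width.
by rewrite big_const_nat iter_addr_0 mulr_natl.
Qed.

Lemma rho_n2_hi i : (i < Q)%N -> rho (cell_n2 i) (cell_hi i).+1 <= 2 * hp (7 * c).
Proof.
move=> iQ; have [cz [h1 -> h3]] := cell_zone_above iQ.
have ccz : (c <= cz)%N by case: h1 => -[-> _] //; rewrite rateS; lia.
apply: le_trans (rho_le_start _) _; first by lia.
rewrite /res h3; last by lia.
have -> : ((cell_n2 i + 2 ^ (9 * cz)).+1 - cell_n2 i = (2 ^ (9 * cz)).+1)%N by lia.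
rewrite -natr1 mulrDl hp_pow97 mul1r.
have : hp (7 * cz) <= hp (7 * c) by apply: hp_le; lia.
have : hp (16 * cz) <= hp (7 * c) by apply: hp_le; lia.
by lra.
Qed.

Lemma width_n1 i : (i < Q)%N -> width (cell_n1 i) = (16 * c)%N.
Proof.
move=> iQ; apply: width_in_stage; rewrite /cell_n1.
by have := @cell_in i 0 iQ (leq0n _); move: (i * L)%N; lia.
Qed.

Lemma rho_n1_n2 i : (i < Q)%N -> rho (cell_n1 i) (cell_n2 i) <= 2 * hp (7 * c).
Proof.
move=> iQ; have [_ h _ _] := cell_order iQ.
apply: le_trans (rho_le_start (ltnW h)) _; rewrite /res width_n1//.
apply: (@le_trans _ _ ((2 * L)%:R * hp (16 * c))).
  rewrite ler_wpM2r ?hp_ge0// ler_nat /cell_n1 /cell_n2.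
  have h32 : (32 * c <= L)%N by apply: leq_trans cell_len_ge; exact: ltnW pow9_pred_ge.
  case: ltnP => iQ'; first by rewrite mulSn; lia.
  have -> : i = Q.-1 by lia.
  rewrite stageSE; have {1}-> : Q = Q.-1.+1 by have := Q_gt2; lia.
  by rewrite mulSn; lia.
by rewrite natrM -mulrA hp_pow97.
Qed.

Lemma rho_lo_n1 i : (i < Q)%N -> rho (cell_lo i) (cell_n1 i) <=
  if i == 0%N then 2 * hp (7 * c') else hp (7 * c).
Proof.
move=> iQ; have [h _ _ _] := cell_order iQ.
have [cz [h1 h2 h3]] := cell_zone_below iQ.
apply: le_trans (rho_le_start _) _; first lia.
rewrite /cell_lo /cell_n1; case: eqP => [->|i0].
  rewrite /res (@width_in_stage k.-1); last by have := stage_len_pred_ge; lia.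
  apply: (@le_trans _ _ ((2 * 2 ^ (9 * c'))%:R * hp (16 * c'))).
    rewrite ler_wpM2r ?hp_ge0// ler_nat; have := stage_pred; have := pow9_pred_ge.
    by have := rate_pred; have := stage_len_pred_ge; lia.
  by rewrite natrM -mulrA hp_pow97.
rewrite /res (@width_in_stage k); last first.
  by have := @cell_in i.-1 0 ltac:(lia) (leq0n _); move: (i.-1 * L)%N; lia.
have -> : (stage k + i * L - (stage k + i.-1 * L) = L)%N.
  by rewrite -{1}(@prednK i) ?mulSn; lia.
by rewrite hp_pow97.
Qed.

Lemma rho_lo_hi i : (i < Q)%N -> rho (cell_lo i) (cell_hi i).+1 <=
  8 * hp (7 * (if i == 0%N then c' else c)).
Proof.
move=> iQ; have [h1 h2 h3 _] := cell_order iQ.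
rewrite (@rho_cat R _ (cell_n1 i)); last by lia.
rewrite (@rho_cat R (cell_n1 i) (cell_n2 i)); last by lia.
have := rho_lo_n1 iQ; have := rho_n1_n2 iQ; have := rho_n2_hi iQ.
have := hp_gt0 R (7 * c); case: ifP => _; last by lra.
have : hp (7 * c) <= hp (7 * c') by apply: hp_le; have := rate_pred; lia.
by lra.
Qed.

Lemma rho_n1_hi i : (i < Q)%N -> rho (cell_n1 i) (cell_hi i) <= 8 * hp (7 * c).
Proof.
move=> iQ; have [h1 h2 h3 _] := cell_order iQ.
apply: (@le_trans _ _ (rho (cell_n1 i) (cell_hi i).+1)); first by rewrite le_rho.
rewrite (@rho_cat R (cell_n1 i) (cell_n2 i)); last by lia.
have := rho_n1_n2 iQ; have := rho_n2_hi iQ; have := hp_gt0 R (7 * c); lra.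
Qed.

Lemma rho_tail_ge l K : (l <= stage k.+1)%N -> (stage k.+2 <= K)%N -> hp k.+1 <= rho l K.
Proof.
move=> lk kK; rewrite -(rho_full_stage R k.+1) le_rho//.
by apply: leq_trans kK; exact: stageS.
Qed.

End Resistances.

End Cells.

(** * Cutpoints in one stage *)

(** Each of the [t] dyadic blocks of indices above [2 ^ c] contributes at least [2 ^ c / 3]. *)
Lemma dyadic_harmonic (R : realType) (c t : nat) :
  (t * 2 ^ c)%:R / 3 <= \sum_(1 <= e < (2 ^ (c + t)).+1) (2 ^ c)%:R / (e + 2 ^ c)%:R :> R.
Proof.
elim: t => [|t IH]; first by rewrite mul0n mul0r sumr_ge0// => i _; rewrite divr_ge0.
have h : (2 ^ (c + t) <= 2 ^ (c + t.+1))%N by rewrite leq_exp2l//; lia.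
rewrite (big_cat_nat _ (n := (2 ^ (c + t)).+1))//=.
rewrite mulSn addnC natrD mulrDl; apply: lerD => //.
set A := (2 ^ (c + t))%N in h *; set B := (2 ^ (c + t.+1))%N in h *.
have BA : B = (A + A)%N by rewrite /B addnS expnS; lia.
have cA : (2 ^ c <= A)%N by rewrite leq_exp2l//; lia.
have A0 : (0 < A)%N by rewrite expn_gt0.
apply: (@le_trans _ _ (\sum_(A.+1 <= e < B.+1) (2 ^ c)%:R / (3 * A)%:R)).
  rewrite big_const_nat iter_addr_0 (_ : B.+1 - A.+1 = A)%N; last lia.
  have A1 : (A%:R : R) != 0 by rewrite pnatr_eq0 -lt0n.
  rewrite natrM -[leRHS]mulr_natr; move: (A%:R) ((2 ^ c)%:R) A1 => y z y0.
  by rewrite (_ : z / (3 * y) * y = z / 3)//; field.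
rewrite [leLHS]big_nat [leRHS]big_nat; apply: ler_sum => e /andP[_ eB].
rewrite ler_wpM2l// lef_pV2 ?posrE ?ltr0n ?ler_nat; lia.
Qed.

Section Stage.
Context {R : realType} {d : measure_display} {Omega : measurableType d}.
Variables (P : probability Omega R) (X : nat -> Omega -> vertex).
Hypothesis srw : simple_random_walk P edge X.
Variable x0 : vertex.
Variables k K : nat.
Hypothesis k6 : (6 <= k)%N.
Hypothesis kK : (stage k.+2 < K)%N.
Hypothesis x0k : (level x0 < stage k.-1)%N.

Local Notation c := (rate k).
Local Notation c' := (rate k.-1).
Local Notation L := (cell_len k).
Local Notation Q := (ncells k).
Local Notation lo := (cell_lo k).
Local Notation n1 := (cell_n1 k).
Local Notation n2 := (cell_n2 k).
Local Notation hi := (cell_hi k).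
Local Notation rho := (rho R).
Local Notation hp n := (2^-1 ^+ n : R).

Definition event (E : (nat -> vertex) -> Prop) : set Omega :=
  [set w | X 0%N w = x0 /\ (is_walk (X^~ w) /\ E (X^~ w))].

Lemma event_union (I : eqType) (r : seq I) (E : I -> (nat -> vertex) -> Prop) n e :
  (forall i, i \in r -> prob_le P (event (E i)) e) -> (size r <= n)%N -> 0 <= e ->
  prob_le P (event (fun x => exists2 i, i \in r & E i x)) (n%:R * e).
Proof.
move=> H rn e0; apply: prob_leW (prob_le_seqW H rn e0) _ _ => //.
by move=> w [X0 [wx [i ir Ei]]]; exists i.
Qed.

Lemma event_phases S F n e : prob_le P [set w | X 0%N w = x0 /\ phases S F n (X^~ w)] e ->
  prob_le P (event (phases S F n)) e.
Proof. by move=> H; apply: prob_leW H _ _ => // w [X0 [_ h]]. Qed.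

Lemma hi_lt i : (i < Q)%N -> ((hi i).+1 < K)%N.
Proof.
move=> iQ; have [cz [h1 -> h3]] := cell_zone_above k6 iQ.
have [_ _ _ h4] := cell_order k6 iQ.
have h : (stage k.+1 + 2 ^ (9 * rate k.+1) < stage k.+2)%N.
  have : (2 ^ (9 * rate k.+1) <= stage_len k.+1)%N.
    by rewrite leq_exp2l//; have := ltn_rate k.+1; lia.
  have -> : stage k.+2 = (stage k.+1 + stage_len k.+1 + 16 * rate k.+1)%N by [].
  by have := rate_gt0 k.+1; lia.
have : (2 ^ (9 * cz) <= 2 ^ (9 * rate k.+1))%N.
  by rewrite leq_exp2l//; case: h1 => -[-> _]; rewrite ?rateS; lia.
lia.
Qed.

Lemma n1_le i : (i < Q)%N -> (n1 i < n2 i <= stage k.+1)%N.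
Proof. by move=> iQ; have [_ h2 _ h4] := cell_order k6 iQ; rewrite h2 h4. Qed.

Lemma lo_lt i : (level x0 < lo i)%N.
Proof. by apply: leq_trans x0k (cell_lo_ge k6 i). Qed.

Lemma stage_lt : (stage k.+1 < K)%N.
Proof. by apply: leq_ltn_trans kK; exact: leq_stage2. Qed.

Lemma cell_miss_sum : Q%:R * (16 * hp (14 * c)) <= hp k.
Proof.
have -> : 16 = (2 ^ 4)%:R :> R by rewrite natrX; ring.
have := kc k6 => kc; rewrite hp_pow; last lia.
by rewrite hp_pow; [apply: hp_le|]; lia.
Qed.

Lemma misses_below_all :
  prob_le P (event (fun x => exists2 i, i \in iota 0 Q & misses (n1 i) (lo i) K x)) (hp k).
Proof.
apply: (@prob_leW _ _ _ _ _ _ (Q%:R * (16 * hp (14 * c)))) _ cell_miss_sum; last exact: subset_refl.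
apply: event_union.
- move=> i; rewrite mem_iota /= add0n => iQ.
  have [cz [h1 h2 h3]] := cell_zone_below k6 iQ.
  have cz32 : (32 <= cz)%N by have := rate_pred_ge k6; lia.
  have n1K : (n1 i < K)%N by have := n1_le iQ; have := stage_lt; lia.
  apply: prob_leW (misses_below_bound srw cz32 h3 h2 n1K (lo_lt i)) _ _ => //.
  rewrite width_n1// -mulrA ler_wpM2l//.
  (* [cz >= c'] leaves at least half of the exponent [60 * c]; the width of level [n1 i] takes
     [16 * c] of it, and the [Q] cells later take about [7 * c]. *)
  apply: (@le_trans _ _ ((2 ^ (16 * c))%:R * hp (30 * c))).
    by rewrite ler_wpM2l//; apply: hp_le; have := rate_pred k6; lia.
  by rewrite hp_pow; [apply: hp_le|]; lia.
- by rewrite size_iota.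
- by rewrite mulr_ge0// hp_ge0.
Qed.

Lemma misses_above_all :
  prob_le P (event (fun x => exists2 i, i \in iota 0 Q & misses (n2 i) (hi i) K x)) (hp k).
Proof.
apply: (@prob_leW _ _ _ _ _ _ (Q%:R * (16 * hp (14 * c)))) _ cell_miss_sum; last exact: subset_refl.
apply: event_union.
- move=> i; rewrite mem_iota /= add0n => iQ.
  have [cz [h1 h2 h3]] := cell_zone_above k6 iQ.
  have ccz : (c <= cz)%N by case: h1 => -[-> _] //; rewrite rateS; lia.
  have cz32 : (32 <= cz)%N by have := rate_pred_ge k6; have := rate_pred k6; lia.
  have hK := hi_lt iQ; rewrite h2 in hK.
  have x0n2 : (level x0 < n2 i)%N.
    by have := lo_lt i; have [? ? _ _] := cell_order k6 iQ; lia.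
  have := @misses_above_bound _ _ _ P X srw x0 (n2 i) cz (n2 i) K cz32 h3 erefl ltac:(lia) x0n2.
  rewrite -h2 => H; apply: prob_leW H _ _ => //.
  rewrite h3; last lia.
  rewrite -mulrA ler_wpM2l// hp_pow; last lia.
  by apply: hp_le; lia.
- by rewrite size_iota.
- by rewrite mulr_ge0// hp_ge0.
Qed.

Lemma crossings_cell i s : (i < Q)%N -> (n1 i <= level s < n2 i)%N ->
  prob_le P (event (phases (cross_target s (lo i) (hi i)) (cross_avoid (lo i) (hi i)) 10))
   ((2 ^ 20)%:R * hp (21 * c + 14 * (if i == 0%N then c' else c))).
Proof.
move=> iQ /andP[sn1 sn2]; have [h1 h2 h3 h4] := cell_order k6 iQ.
have hwid l : (l <= stage k.+1)%N -> (width l <= 32 * c)%N.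
  by move=> /leq_width; rewrite width_stage rateS; lia.
have p9 := pow9_pred_ge k6; have Lge := cell_len_ge k6.
have far1 : (lo i <= window_start (level s))%N.
  by rewrite /window_start; have := hwid (level s) ltac:(lia); lia.
have far2 : (level s <= window_start (hi i))%N.
  have [cz [z1 z2 z3]] := cell_zone_above k6 iQ.
  have : (width (hi i) <= 32 * c)%N.
    by rewrite z2 z3 ?leqnn ?andbT ?leq_addr//; case: z1 => -[-> _]; rewrite ?rateS; lia.
  by rewrite /window_start; lia.
have losh : (lo i < level s < hi i)%N by lia.
apply: prob_leW (event_phases (crossings_bound srw (lo_lt i) losh far1 far2)) _ _ => //.
set g := (if _ then _ else _).
have u1 : 2 * rho (level s) (hi i) <= 16 * hp (7 * c).
  have : rho (level s) (hi i) <= rho (n1 i) (hi i) by rewrite le_rho.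
  have := rho_n1_hi k6 R iQ; lra.
have e1 : 2 * rho (lo i) (level s) <= 16 * hp (7 * g).
  have : rho (lo i) (level s) <= rho (lo i) (hi i).+1 by rewrite le_rho//; lia.
  have := rho_lo_hi k6 R iQ; rewrite -/g; lra.
have -> : (2 ^ 20)%:R * hp (21 * c + 14 * g) = (16 * hp (7 * c)) ^+ 3 * (16 * hp (7 * g)) ^+ 2.
  rewrite hpD (_ : 21 * c = 7 * c + (7 * c + 7 * c))%N; last lia.
  rewrite (_ : 14 * g = 7 * g + 7 * g)%N; last lia.
  rewrite !hpD natrX (_ : 16 = 2 ^+ 4 :> R); last by ring.
  by move: (hp (7 * c)) (hp (7 * g)) => y z; ring.
have rho2 m n : 0 <= 2 * rho m n by rewrite mulr_ge0// rho_ge0.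
apply: ler_pM; rewrite ?exprn_ge0//; apply: lerXn2r; rewrite ?nnegrE//.
Qed.

Let crossed i s := phases (cross_target s (lo i) (hi i)) (cross_avoid (lo i) (hi i)) 10.

Lemma crossings_all :
  prob_le P (event (fun x => exists2 i, i \in iota 0 Q &
     exists2 s, s \in levels (n1 i) (n2 i) & crossed i s x)) (hp k).
Proof.
have kc1 := kc k6; have cc := rate_pred k6; have c32 := rate_pred_ge k6.
have P0 n : 0 <= (2 ^ 20)%:R * hp n by rewrite mulr_ge0// hp_ge0.
(* The lower zone of cell 0 has the larger resistance of the previous stage, and its exponent
   [28 * c] faces the [2 ^ (25 * c)] vertices of a single cell. Elsewhere [35 * c] faces at most
   [2 ^ (32 * c)] vertices, or [2 ^ (33 * c)] on the widening levels. *)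
pose e0 := (2 ^ 20)%:R * hp (21 * c + 14 * c').
pose e1 := (2 ^ 20)%:R * hp (21 * c + 14 * c).
have Q2 := Q_gt2 k6.
have H0 : prob_le P (event (fun x => exists2 s, s \in levels (n1 0) (n2 0) & crossed 0 s x))
    ((2 ^ (25 * c))%:R * e0).
  apply: event_union => //; last exact: P0.
    move=> s; rewrite mem_levels => hs; apply: prob_leW (crossings_cell _ hs) _ _ => //; lia.
  apply: leq_trans (size_levels (W := 16 * c) _) _.
    move=> l hl; rewrite (@width_in_stage k)//; move: hl; rewrite /cell_n1 /cell_n2.
    rewrite (_ : (1 < Q)%N); last lia.
    by have := @cell_in k k6 1 0 ltac:(lia) (leq0n _); lia.
  rewrite /cell_n1 /cell_n2 (_ : (1 < Q)%N); last lia.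
  rewrite (_ : stage k + 1 * L - (stage k + 0 * L) = L)%N; last lia.
  by rewrite -expnD leq_exp2l//; lia.
have H1 i : i \in iota 1 Q.-1 -> prob_le P (event (fun x =>
    exists2 s, s \in levels (n1 i) (n1 i + L) & (level s < n2 i)%N /\ crossed i s x)) ((2 ^ (25 * c))%:R * e1).
  rewrite mem_iota => Hi; have iQ : (i < Q)%N by lia.
  apply: event_union => //; last exact: P0.
    move=> s; rewrite mem_levels => hs.
    have [hs2|hs2] := ltnP (level s) (n2 i); last first.
      exists set0; first by split => //; rewrite pr0 P0.
      by move=> w [_ [_ [h _]]]; lia.
    have hs3 : (n1 i <= level s < n2 i)%N by lia.
    apply: prob_leW (crossings_cell iQ hs3) _ _; first by move=> w [? [? []]].
    by have /negbTE -> : i != 0%N by lia.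
  apply: leq_trans (size_levels (W := 16 * c) _) _.
    move=> l hl; rewrite (@width_in_stage k)//; move: hl; rewrite /cell_n1.
    by have := @cell_in k k6 i L iQ (leqnn _); move: (i * L)%N; lia.
  by rewrite addKn -expnD leq_exp2l//; lia.
have H1' : prob_le P (event (fun x => exists2 i, i \in iota 1 Q.-1 &
    exists2 s, s \in levels (n1 i) (n1 i + L) & (level s < n2 i)%N /\ crossed i s x))
    ((2 ^ (7 * c))%:R * ((2 ^ (25 * c))%:R * e1)).
  apply: event_union H1 _ _; last by rewrite mulr_ge0//; exact: P0.
  by rewrite size_iota; apply: leq_trans (leq_pred _) _; rewrite leq_exp2l//; lia.
have H2 : prob_le P (event (fun x => exists2 s, s \in levels (stage k + stage_len k) (stage k.+1) &
    (n1 Q.-1 <= level s < n2 Q.-1)%N /\ crossed Q.-1 s x)) ((2 ^ (33 * c))%:R * e1).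
  apply: event_union => //; last exact: P0.
    move=> s _; have [hs2|hs2] := boolP (n1 Q.-1 <= level s < n2 Q.-1)%N; last first.
      exists set0; first by split => //; rewrite pr0 P0.
      by move=> w [_ [_ []]].
    have iQ : (Q.-1 < Q)%N by lia.
    apply: prob_leW (crossings_cell iQ hs2) _ _; first by move=> w [? [? []]].
    by have /negbTE -> : Q.-1 != 0%N by lia.
  apply: leq_trans (size_levels (W := 32 * c) _) _.
    by move=> l /andP[_ /ltnW/leq_width]; rewrite width_stage rateS; lia.
  have -> : (stage k.+1 - (stage k + stage_len k) = 16 * c)%N by rewrite addKn.
  have -> : (33 * c = c + 32 * c)%N by lia.
  rewrite expnD leq_mul2r; apply/orP; right; have := @c32_lt_pow k k6 c ltac:(lia); lia.
apply: prob_leW (prob_leU H0 (prob_leU H1' H2)) _ _.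
  move=> w [X0 [wx [i]]]; rewrite mem_iota /= add0n => iQ [s].
  rewrite mem_levels => hs cs; have [i0|i0] := posnP i.
    rewrite i0 in hs cs; left; split => //; split => //; exists s => //.
    by rewrite mem_levels.
  right; have [sL|sL] := ltnP (level s) (n1 i + L).
    left; split => //; split => //; exists i; first by rewrite mem_iota; lia.
    by exists s; [rewrite mem_levels; lia|split => //; lia].
  have iE : i = Q.-1.
    apply/eqP; rewrite eqn_leq; apply/andP; split; first lia.
    rewrite leqNgt; apply/negP => iQ'; move: hs sL; rewrite /cell_n1 /cell_n2.
    by rewrite (_ : (i.+1 < Q)%N) ?mulSn; lia.
  right; split => //; split => //; exists s; last by rewrite -iE.
  have := n1_le iQ; rewrite mem_levels => h.
  have eL : (n1 i + L = stage k + stage_len k)%N.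
    by rewrite /cell_n1 iE -addnA -mulSnr prednK ?cells_len//; lia.
  rewrite eL in sL; apply/andP; split => //.
  by case/andP: h => _ h; case/andP: hs => _ hs; exact: leq_trans hs h.
rewrite /e0 /e1 !mulrA -!natrM -!expnD !hp_pow; try lia.
have : hp (21 * c + 14 * c' - (25 * c + 20)) <= hp k.+2 by apply: hp_le; lia.
have : hp (21 * c + 14 * c - (7 * c + 25 * c + 20)) <= hp k.+2 by apply: hp_le; lia.
have : hp (21 * c + 14 * c - (33 * c + 20)) <= hp k.+2 by apply: hp_le; lia.
by rewrite !exprS; have := hp_gt0 R k; lra.
Qed.

(** * Single returns and escapes *)

Local Notation J := (2 ^ (3 * c))%N.
Local Notation h := (2 ^ c)%N.

(** The [J = h ^ 3] indices after a central one supply [2 * c] dyadic blocks to the harmonic sum.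
    Only about [J] cells are not central, few enough for a union bound. *)
Definition central i := (0 < i)%N && (i + J + h <= Q)%N.
Definition cell_q i := if central i then (stage k + (i.-1 + h) * L)%N else (hi i).+1.

Lemma h_ge8 : (8 <= h)%N.
Proof. by rewrite (_ : 8%N = 2 ^ 3)%N// leq_exp2l//; have := kc k6; lia. Qed.

Lemma central_lt i : central i -> (i.+1 < Q)%N.
Proof. by move=> /andP[_]; have := h_ge8; lia. Qed.

Lemma central_lo i : central i -> lo i = (stage k + i.-1 * L)%N.
Proof. by move=> /andP[i0 _]; rewrite /cell_lo; have /negbTE -> : i != 0%N by lia. Qed.

Lemma central_hi i : central i -> hi i = (stage k + i.+2 * L)%N.
Proof.
move=> ci; have iQ := central_lt ci; rewrite /cell_hi /cell_n2 iQ -/L.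
by rewrite (mulSn i.+1) (addnC L) addnA.
Qed.

Lemma L_gt0 : (0 < L)%N. Proof. by rewrite expn_gt0. Qed.

Lemma hi_lt_q i : (i < Q)%N -> (hi i < cell_q i < K)%N.
Proof.
move=> iQ; rewrite /cell_q; case: ifP => [ci|_]; last by rewrite ltnSn hi_lt.
apply/andP; split.
  rewrite central_hi// ltn_add2l ltn_mul2r L_gt0/=.
  by have := h_ge8; have /andP[i0 _] := ci; lia.
apply: leq_ltn_trans stage_lt; apply: leq_trans (stageS k).
rewrite leq_add2l -cells_len// leq_mul2r; apply/orP; right.
by have /andP[i0 iQ'] := ci; lia.
Qed.

Lemma lo_lt_hi i : (i < Q)%N -> (lo i < hi i)%N.
Proof. by move=> iQ; have [h1 h2 h3 _] := cell_order k6 iQ; lia. Qed.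

Lemma lo_le_stage i : (i < Q)%N -> (lo i <= stage k.+1)%N.
Proof. by move=> iQ; have [h1 h2 h3 h4] := cell_order k6 iQ; lia. Qed.

Lemma rho_lo_K i : (i < Q)%N -> 0 < rho (lo i) K /\ (rho (lo i) K)^-1 <= (2 ^ k.+1)%:R.
Proof.
move=> iQ; have h1 := rho_tail_ge R (lo_le_stage iQ) (ltnW kK).
have h0 := lt_le_trans (hp_gt0 R k.+1) h1; split => //.
by rewrite -(hpV R k.+1) lef_pV2// posrE// hp_gt0.
Qed.

Lemma rho_in_stage i j : (i <= j <= Q)%N ->
  rho (stage k + i * L) (stage k + j * L) = (j - i)%:R * hp (7 * c).
Proof.
move=> /andP[ij jQ]; rewrite (@rho_stage R k); last first.
  by rewrite -cells_len// !leq_mul2r ij jQ !orbT.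
by rewrite -mulnBl natrM -mulrA (hp_pow97 k6).
Qed.

Lemma escape_le i x : (i < Q)%N -> 0 <= x -> x <= rho (lo i) (hi i).+1 ->
  x / rho (lo i) K <= 16 * (2 ^ k)%:R * hp (7 * (if i == 0%N then c' else c)).
Proof.
move=> iQ x0' xr; have [h0 h1] := rho_lo_K iQ.
apply: (@le_trans _ _ (8 * hp (7 * (if i == 0%N then c' else c)) * (2 ^ k.+1)%:R)).
  apply: ler_pM => //; first by rewrite invr_ge0 ltW.
  exact: le_trans xr (rho_lo_hi k6 R iQ).
by rewrite expnS natrM; move: ((2 ^ k)%:R : R) (hp _) => y z; rewrite le_eqVlt; apply/orP; left; apply/eqP; ring.
Qed.

Definition single_return i :=
  phases (at_level [:: hi i; cell_q i; lo i; hi i; K])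
    (at_level_opt [:: None; Some (lo i); None; None; Some (lo i)]) 5.

Lemma single_return_le i : (i < Q)%N -> prob_le P (event (single_return i))
  (rho (lo i) (hi i) / rho (lo i) (cell_q i) * (rho (lo i) (hi i) / rho (lo i) K)).
Proof.
move=> iQ; have /andP[hq qK] := hi_lt_q iQ.
exact: event_phases (single_return_bound srw (lo_lt i) (lo_lt_hi iQ) hq qK).
Qed.

Lemma central_ratio i : central i -> rho (lo i) (cell_q i) = hp (6 * c).
Proof.
move=> ci; have iQ := central_lt ci; have /andP[i0 iQ'] := ci.
rewrite /cell_q ci central_lo// rho_in_stage; last by lia.
rewrite addKn hp_pow; last by lia.
by congr (_ ^+ _); lia.
Qed.

(** The climb from [hi] to [q] before [lo] has probability of order [1 / h], and the final escape
    gives the rest; [hp (8 * c)] then outweighs the number [Q] of cells. *)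
Lemma central_single_return i : central i ->
  prob_le P (event (single_return i)) (2 ^+ k * 128 * hp (8 * c)).
Proof.
move=> ci; have iQ := ltnW (central_lt ci).
apply: prob_leW (single_return_le iQ) (@subset_refl _ _) _.
have i0 : (i == 0%N) = false by have /andP[] := ci; case: i {iQ ci}.
have hr : rho (lo i) (hi i) <= rho (lo i) (hi i).+1 by rewrite le_rho.
have := escape_le iQ (rho_ge0 R _ _) hr; rewrite i0.
rewrite central_ratio// => h2.
apply: (@le_trans _ _ (8 * hp (7 * c) / hp (6 * c) * (16 * (2 ^ k)%:R * hp (7 * c)))).
  apply: ler_pM => //.
  - by rewrite divr_ge0 ?rho_ge0 ?hp_ge0.
  - by rewrite divr_ge0 ?rho_ge0.
  - rewrite ler_pM2r ?invr_gt0 ?hp_gt0//; apply: le_trans hr _.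
    by have := rho_lo_hi k6 R iQ; rewrite i0.
rewrite hpV -(mulrA 8) [hp (7 * c) * _]mulrC hp_pow; last lia.
have -> : (7 * c - 6 * c = c)%N by lia.
have -> : (8 * c = c + 7 * c)%N by lia.
rewrite hpD natrX; move: (2 ^+ k : R) (hp c) (hp (7 * c)) => x y z.
by rewrite le_eqVlt; apply/orP; left; apply/eqP; ring.
Qed.

Lemma border_single_return i : (i < Q)%N ->
  prob_le P (event (single_return i)) (16 * (2 ^ k)%:R * hp (7 * (if i == 0%N then c' else c))).
Proof.
move=> iQ; apply: prob_leW (single_return_le iQ) (@subset_refl _ _) _.
have hr : rho (lo i) (hi i) <= rho (lo i) (hi i).+1 by rewrite le_rho.
apply: le_trans _ (escape_le iQ (rho_ge0 R _ _) hr).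
have [h0 _] := rho_lo_K iQ; have /andP[hq qK] := hi_lt_q iQ.
rewrite ler_piMl ?divr_ge0 ?rho_ge0//.
rewrite ler_pdivrMr ?mul1r ?le_rho// ?(ltnW hq)//.
by apply: rho_gt0; apply: ltn_trans hq; exact: lo_lt_hi.
Qed.

Lemma border_escape i : (i < Q)%N -> ~~ central i ->
  prob_le P (event (escapes (lo i) (cell_q i) K)) (16 * (2 ^ k)%:R * hp (7 * (if i == 0%N then c' else c))).
Proof.
move=> iQ ci; have /andP[hq qK] := hi_lt_q iQ; have lh := lo_lt_hi iQ.
have lq := ltn_trans lh hq.
apply: prob_leW (event_phases (cut_bound srw (ltn_trans (lo_lt i) lq) lq qK)) (@subset_refl _ _) _.
by apply: escape_le; rewrite ?rho_ge0// /cell_q (negbTE ci).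
Qed.

Let border i x := single_return i x \/ (~~ central i /\ escapes (lo i) (cell_q i) K x).

Lemma border_le i : (i < Q)%N -> ~~ central i ->
  prob_le P (event (border i)) (32 * (2 ^ k)%:R * hp (7 * (if i == 0%N then c' else c))).
Proof.
move=> iQ ci.
apply: prob_leW (prob_leU (border_single_return iQ) (border_escape iQ ci)) _ _.
  by move=> w [X0 [wx [b|[_ b]]]]; [left|right].
by move: ((2 ^ k)%:R : R) (hp _) => x y; lra.
Qed.

Lemma border_all : prob_le P (event (fun x => exists2 i, i \in iota 0 Q & border i x)) (2 * hp k).
Proof.
have kc1 := kc k6; have cc := rate_pred k6; have c32 := rate_pred_ge k6; have kc2 := kc' k6.
have Q2 := Q_gt2 k6; have h8 := h_ge8.
have hJ : (h <= J)%N by rewrite leq_exp2l//; lia.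
have p0 n : 0 <= 2 ^+ k * 128 * hp n by rewrite !mulr_ge0 ?exprn_ge0 ?hp_ge0.
have p0' n : 0 <= 32 * (2 ^ k)%:R * hp n by rewrite !mulr_ge0 ?hp_ge0.
have H1 : prob_le P (event (fun x => exists2 i, i \in [seq i <- iota 0 Q | central i] & single_return i x))
    (Q%:R * (2 ^+ k * 128 * hp (8 * c))).
  apply: event_union => //; last by rewrite size_filter -[leqRHS](size_iota 0) count_size.
  by move=> i; rewrite mem_filter => /andP[ci _]; exact: central_single_return.
have H2 : prob_le P (event (border 0)) (32 * (2 ^ k)%:R * hp (7 * c')).
  by apply: border_le => //; lia.
(* The cells above cell 0 that are not central; the list overshoots by one index, whence [i < Q]. *)
have H3 : prob_le P (event (fun x => exists2 i, i \in iota (Q - (J + h)).+1 (J + h) & (i < Q)%N /\ border i x))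
    ((2 ^ (3 * c).+1)%:R * (32 * (2 ^ k)%:R * hp (7 * c))).
  apply: event_union; rewrite ?size_iota//; last by rewrite expnS; lia.
  move=> i; rewrite mem_iota => hi_; have [iQ|iQ] := ltnP i Q; last first.
    exists set0; first by split => //; rewrite pr0.
    by move=> w [_ [_ [h _]]]; lia.
  have ci : ~~ central i by rewrite /central; lia.
  have := border_le iQ ci; have -> : (i == 0%N) = false by lia.
  by move=> H; apply: prob_leW H _ _ => // w [? [? []]].
apply: prob_leW (prob_leU H1 (prob_leU H2 H3)) _ _.
  move=> w [X0 [wx [i]]]; rewrite mem_iota /= add0n => iQ b.
  have [ci|ci] := boolP (central i).
    left; split => //; split => //; exists i; first by rewrite mem_filter ci mem_iota.
    by case: b => // -[]; rewrite ci.
  right; have [i0|i0] := posnP i; first by left; split => //; split => //; rewrite -i0.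
  right; split => //; split => //; exists i; last by [].
  by move: ci; rewrite /central mem_iota; lia.
have e32 : 32 = (2 ^ 5)%:R :> R by rewrite natrX; ring.
have e128 : 128 = (2 ^ 7)%:R :> R by rewrite natrX; ring.
rewrite e32 e128 -natrX !mulrA -!natrM -!expnD !hp_pow; try lia.
set t1 := 2^-1 ^+ _; set t2 := 2^-1 ^+ _; set t3 := 2^-1 ^+ _.
have h1 : t1 <= hp k by apply: hp_le; lia.
have h2 : t2 <= hp k.+1 by apply: hp_le; lia.
have h3 : t3 <= hp k.+1 by apply: hp_le; lia.
by move: h2 h3; rewrite !exprS; lra.
Qed.

Lemma central_escape_all :
  prob_le P (event (fun x => exists2 i, central i & escapes (lo i) (cell_q i) K x)) (4 * hp k).
Proof.
have kc1 := kc k6; have h8 := h_ge8; have L0 := L_gt0.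
have JhQ : (J + h <= Q)%N.
  apply: (@leq_trans (2 ^ (3 * c).+1)%N).
    by rewrite expnS mul2n -addnn leq_add2l leq_exp2l//; lia.
  by rewrite leq_exp2l//; lia.
pose M := (Q - J - h)%N; pose N := (Q - h)%N.
pose p j := (stage k + j.-1 * L)%N; pose q j := (stage k + (j + h - 1) * L)%N.
(* The escape probability, at most [h * hp (7 * c) * 2 ^ k.+1], over the lower bound [2 * c * h / 3]
   of the harmonic sum, rounded up. The factors [h] cancel, and the [c] in the denominator is the
   gain [2 ^ k]. *)
pose sg : R := 4 * (2 ^ k)%:R * hp (7 * c) / c%:R.
have c0 : 0 < (c%:R : R) by rewrite ltr0n rate_gt0.
have sg0 : 0 <= sg by rewrite divr_ge0// !mulr_ge0// hp_ge0.
have q_lt j : (j < N)%N -> (q j < q j.+1)%N.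
  by move=> _; rewrite /q ltn_add2l ltn_mul2r L0/=; lia.
have p_le i j : (0 < i <= j)%N -> (j <= M)%N -> (p i <= p j)%N.
  by move=> ij _; rewrite /p leq_add2l leq_mul2r; apply/orP; right; lia.
have pq j : (0 < j <= M)%N -> (p j < q j)%N.
  by move=> jM; rewrite /p /q ltn_add2l ltn_mul2r L0/=; lia.
have qK : (q N < K)%N.
  apply: leq_ltn_trans stage_lt; apply: leq_trans (stageS k).
  by rewrite leq_add2l -cells_len// leq_mul2r; apply/orP; right; rewrite /N; lia.
have x0q : (level x0 < q 1)%N.
  apply: leq_trans x0k (leq_trans _ (leq_addr _ _)); exact: leq_stage2 (leq_pred k).
have rpq b j : (0 < b <= M)%N -> (b <= j <= N)%N ->
    rho (p b) (q j) = (j - b + h)%:R * hp (7 * c).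
  move=> bM jN; rewrite rho_in_stage; last by rewrite /N in jN; lia.
  by congr (_%:R * _); lia.
have sgP b : (0 < b <= M)%N ->
  rho (p b) (q b) / rho (p b) K <=
  sg * (1 + \sum_(b.+1 <= j < (b + J).+1) rho (p b) (q b) / rho (p b) (q j)).
  move=> bM.
  have bJ : (b + J <= N)%N by rewrite /M /N in bM *; lia.
  have hp0 := hp_gt0 R (7 * c).
  have -> : \sum_(b.+1 <= j < (b + J).+1) rho (p b) (q b) / rho (p b) (q j) =
      \sum_(1 <= e < J.+1) h%:R / (e + h)%:R.
    rewrite -[b.+1]add1n big_addn (_ : (b + J).+1 - b = J.+1)%N; last lia.
    rewrite big_nat [RHS]big_nat; apply: eq_bigr => e he.
    rewrite !rpq//; try lia.
    rewrite subnn addnK add0n.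
    have : ((e + h)%:R : R) != 0 by rewrite pnatr_eq0; lia.
    move: (h%:R : R) ((e + h)%:R : R) (hp (7 * c)) hp0 => y z t t0 z0.
    by field; rewrite z0 gt_eqF.
  have := dyadic_harmonic R c (2 * c); rewrite (_ : c + 2 * c = 3 * c)%N; last lia.
  set S := \sum_(_ <= _ < _) _ => hS.
  rewrite rpq//; last by move: bJ; lia.
  rewrite subnn add0n.
  have iQ : (b < Q)%N by rewrite /M in bM; lia.
  have cb : central b by rewrite /central /M in bM *; lia.
  have := rho_lo_K iQ; rewrite central_lo// -/(p b) => -[r0 r1].
  apply: (@le_trans _ _ (h%:R * hp (7 * c) * (2 ^ k.+1)%:R)).
    by rewrite ler_wpM2l// mulr_ge0// ltW.
  apply: (@le_trans _ _ (sg * ((2 * c * h)%:R / 3))); last first.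
    by rewrite ler_wpM2l//; apply: le_trans hS _; rewrite lerDr ler01.
  rewrite /sg expnS !natrM.
  have y0 : 0 <= (h%:R : R) by [].
  have -> : ((2 ^ k)%:R : R) = c%:R by [].
  move: (h%:R : R) (hp (7 * c)) (c%:R : R) hp0 c0 y0 => y t z t0 z0 y0.
  have -> : 4 * z * t / z * (2 * z * y / 3) = (8 / 3) * (y * t * z) by field; rewrite gt_eqF.
  have : 0 <= y * t * z by rewrite !mulr_ge0// ltW.
  by rewrite (_ : y * t * (2 * z) = 2 * (y * t * z)); [lra|ring].
have MJN : (M + J <= N)%N by rewrite /M /N; lia.
have H := some_escape_bound srw MJN q_lt p_le pq qK x0q sg0 sgP.
apply: prob_leW H _ _.
  move=> w [X0 [wx [i ci esc]]]; split => //; split => //.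
  have iM : (0 < i <= M)%N by move: ci; rewrite /central /M; lia.
  exists i => //; move: esc; rewrite central_lo// /cell_q ci.
  by rewrite /p /q (_ : i + h - 1 = i.-1 + h)%N//; lia.
apply: (@le_trans _ _ (sg * Q%:R)); first by rewrite ler_wpM2l// ler_nat /N leq_subr.
have E : (2 ^ k)%:R * (hp (7 * c) * Q%:R) = 1 :> R.
  rewrite mulrCA -natrM -expnD subnKC; last lia.
  by rewrite mulrC pow_hp.
have -> : hp k = (c%:R)^-1 by rewrite natrX exprVn.
rewrite /sg; have -> : 4 * (2 ^ k)%:R * hp (7 * c) / c%:R * Q%:R =
  4 / c%:R * ((2 ^ k)%:R * (hp (7 * c) * Q%:R)) by field; rewrite gt_eqF.
by rewrite E mulr1.
Qed.

Definition comes_back := phases (at_level [:: K; stage k.+1]) (at_level_opt [:: None; None]) 2.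

(** The five families of exceptional events cost [1 + 1 + 1 + 2 + 4] times [hp k]; outside them
    [not_cutpoint] applies to the cell of [s]. The event [comes_back] is estimated separately, by
    taking [K] large. *)
Lemma stage_cutpoints_le :
  prob_le P (event (fun x => [/\ forall n, exists t, (n <= level (x t))%N, ~ comes_back x &
    exists w s, [/\ x = X^~ w, (stage k <= level s < stage k.+1)%N &
      cutpoint (walk_path X w) (X 0%N w) s]])) (9 * hp k).
Proof.
have H := prob_leU (prob_leU misses_below_all misses_above_all)
  (prob_leU crossings_all (prob_leU border_all central_escape_all)).
apply: prob_leW H _ _; last by have := hp_gt0 R k; lra.
move=> w [X0 [wx [unb ncb [w' [s [xw sk cs]]]]]]; apply: contrapT => good.
have [i iQ sn] := cell_exists k6 sk; have ii : i \in iota 0 Q by rewrite mem_iota.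
have [h1 h2 h3 h4] := cell_order k6 iQ; have /andP[hq qK] := hi_lt_q iQ.
have p9 : (0 < 2 ^ (9 * c'))%N by rewrite expn_gt0.
have x0E : X 0%N w' = x0 by rewrite -X0; have := congr1 (fun x => x 0%N) xw.
have sing : ~ single_return i (X^~ w).
  by move=> S; apply: good; right; right; left; split => //; split => //; exists i => //; left.
have esc : ~ escapes (lo i) (cell_q i) K (X^~ w).
  move=> S; apply: good; right; right; have [ci|ci] := boolP (central i).
    by right; split => //; split => //; exists i.
  by left; split => //; split => //; exists i => //; right.
have cr : ~ crossed i s (X^~ w).
  move=> S; apply: good; right; left; split => //; split => //; exists i => //.
  by exists s; rewrite ?mem_levels.
have mb : ~ misses (n1 i) (lo i) K (X^~ w).
  by move=> S; apply: good; left; left; split => //; split => //; exists i.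
have ma : ~ misses (n2 i) (hi i) K (X^~ w).
  by move=> S; apply: good; left; right; split => //; split => //; exists i.
rewrite xw in wx unb ncb sing esc cr mb ma.
apply: (@not_cutpoint _ _ X w' wx s (lo i) (n1 i) (n2 i) (hi i) (lo i) (cell_q i) K (stage k.+1)) => //.
- by rewrite x0E; exact: lo_lt.
- by lia.
- by case/andP: sn.
- by case/andP: sn.
- by have := L_gt0; lia.
- by case/andP: sk => _ /ltnW.
- exact: stage_lt.
- by move=> n; have [t nt] := unb n; exists t; have /= <- := congr1 (fun x => x t) xw.
Qed.

End Stage.

(** * Borel-Cantelli and transience *)

Section SmallSets.
Context {R : realType} {d : measure_display} {Omega : measurableType d}.
Variable P : probability Omega R.
Local Notation hp n := (2^-1 ^+ n : R).

Lemma hp_small (e : R) : 0 < e -> exists n, hp n <= e.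
Proof.
move=> e0; exists (Num.truncn e^-1).+1; rewrite -[leRHS]invrK -[hp _]invrK hpV.
rewrite lef_pV2 ?posrE ?invr_gt0 ?ltr0n ?expn_gt0//.
apply: (@le_trans _ _ (Num.truncn e^-1).+1%:R); first exact/ltW/truncnS_gt.
by rewrite ler_nat ltnW// ltn_expl.
Qed.

Lemma negligible_small (A : set Omega) : (forall n, prob_le P A (hp n)) -> P.-negligible A.
Proof.
move=> H; have /choice[E HE] : forall n, exists E, [/\ measurable E, prob P E <= hp n & A `<=` E].
  by move=> n; have [E [? ?] ?] := H n; exists E.
exists (\bigcap_n E n); split.
- by apply: bigcapT_measurable => n; have [] := HE n.
- have mI : measurable (\bigcap_n E n) by apply: bigcapT_measurable => n; have [] := HE n.
  rewrite (prE _ mI); congr EFin; apply/eqP; rewrite eq_le pr_ge0 andbT.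
  rewrite leNgt; apply/negP => /hp_small[n hn].
  have [mE pE _] := HE n.+1.
  have : prob P (\bigcap_n E n) <= hp n.+1.
    by apply: le_trans pE; apply: le_pr => // w; apply.
  by move=> h; have := le_trans hn h; rewrite exprS; have := hp_gt0 R n; lra.
by move=> w Aw n _; have [_ _] := HE n; apply.
Qed.

Lemma prob_le_tail (A : nat -> set Omega) (c : R) : 0 <= c ->
  (forall n, prob_le P (A n) (c * hp n)) ->
  forall m, prob_le P (\bigcup_(n in [set n | (m <= n)%N]) A n) (2 * c * hp m).
Proof.
move=> c0 H m; have /choice[E HE] : forall n, exists E,
    [/\ measurable E, prob P E <= c * hp n & A n `<=` E].
  by move=> n; have [E [? ?] ?] := H n; exists E.
have mE n : measurable (E n) by have [] := HE n.
pose U N := \big[setU/set0]_(m <= n < N) E n.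
have mU N : measurable (U N) by apply: bigsetU_measurable.
have UE N w : U N w <-> exists2 n, (m <= n < N)%N & E n w.
  rewrite /U -bigcup_seq; split=> -[n /=]; last first.
    by move=> mn Ew; exists n => //=; rewrite mem_index_iota.
  by rewrite mem_index_iota => mn Ew; exists n.
exists (\bigcup_N U N); first split.
- exact: bigcupT_measurable.
- apply: pr_sup => //.
    by move=> i j ij w /UE[n mn Ew]; apply/UE; exists n => //; lia.
  move=> N; apply: le_trans (pr_bigU P _ mE) _.
  apply: (@le_trans _ _ (\sum_(m <= n < N) c * hp n)).
    by apply: ler_sum => n _; have [] := HE n.
  rewrite -mulr_sumr [2 * c]mulrC -mulrA ler_wpM2l//.
  have [Nm|mN] := leqP N m; first by rewrite big_geq// mulr_ge0// hp_ge0.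
  suff : \sum_(m <= n < N) hp n = 2 * hp m - 2 * hp N by move=> ->; have := hp_gt0 R N; lra.
  move: mN => /ltnW/subnKC <-; elim: (N - m)%N => [|i IH]; first by rewrite addn0 big_geq// subrr.
  by rewrite addnS big_nat_recr ?leq_addr//= IH exprS; move: (hp (m + i)) => y; lra.
move=> w [n /= mn An]; exists n.+1 => //; apply/UE; exists n; first by rewrite mn ltnSn.
by have [_ _] := HE n; apply.
Qed.

End SmallSets.

(** * Resistance to infinity *)

Section Total.
Variable R : realType.
Local Notation rho := (rho R).

(* [total n] is the limit of [rho n m] as [m] goes to infinity. *)
Definition total (n : nat) : R := sup (range (rho 0)) - rho 0 n.

Lemma has_sup_rho : has_sup (range (rho 0)).
Proof.
split; first by exists (rho 0 0), 0%N.
by exists 8 => _ [n _ <-]; exact: rho0_le8.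
Qed.

Lemma rho_le_sup n : rho 0 n <= sup (range (rho 0)).
Proof. by apply: sup_ubound; [exact: has_sup_rho.2|exists n]. Qed.

Lemma total_gt0 n : 0 < total n.
Proof.
have := rho_le_sup n.+1; rewrite rhoSr// /total; have := res_gt0 R n; lra.
Qed.

Lemma total_small (e : R) : 0 < e -> exists N, forall n, (N <= n)%N -> total n <= e.
Proof.
move=> e0; have [_ [N _ <-] hN] := sup_adherent e0 has_sup_rho.
exists N => n Nn; rewrite /total; have := le_rho R (leqnn 0) Nn; lra.
Qed.

Lemma totalS n : total n - total n.+1 = res R n.
Proof. by rewrite /total rhoSr//; ring. Qed.

Lemma total_superharmonic v :
  \sum_(y <- nbrs v) total (level y) <= (size (nbrs v))%:R * total (level v).
Proof.
apply: (@sum_level_le0 R total v 1) => //; first by rewrite totalS mul1r.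
by move=> v0; have E : (level v).-1.+1 = level v by [lia]; rewrite -{2}E totalS mul1r.
Qed.

End Total.

(** * Almost sure finiteness of the set of cutpoints *)

Section Walk.
Context {R : realType} {d : measure_display} {Omega : measurableType d}.
Variables (P : probability Omega R) (X : nat -> Omega -> vertex).
Hypothesis srw : simple_random_walk P edge X.
Local Notation hp n := (2^-1 ^+ n : R).

(** Since [ndown] is at most 2, the level drifts upwards, and its square increases by at least 1 on
    average. *)
Lemma sum_level_sqr v : (size (nbrs v))%:R * ((level v)%:R ^+ 2 + 1) <=
  \sum_(y <- nbrs v) (level y)%:R ^+ 2 :> R.
Proof.
rewrite (sum_level (fun n => n%:R ^+ 2)) size_nbrs natrD.
case: (level v) => [|n]; first by rewrite /= mulr0n !addr0 expr0n /= add0r expr1n mulr1.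
have : ((ndown n.+1)%:R : R) <= 2 by rewrite ler_nat ndown_le2.
rewrite [n.+1.-1]/= -[n.+2%:R]natr1 -[n.+1%:R]natr1 -(mulr_natr (n%:R ^+ 2)) mulr2n.
have : 0 <= (n%:R : R) by [].
move: (n%:R : R) ((ndown n.+1)%:R : R) => y D y0 D2; nra.
Qed.

(** By [sum_level_sqr], [K ^ 2] minus the squared level plus the time is a supermartingale, so
    staying below [K] for [N] steps has probability at most [(K ^ 2 + 1) / N]; [N] makes this
    [2 ^- j]. *)
Lemma bounded_negligible x0 K :
  P.-negligible [set w | X 0%N w = x0 /\ forall t, (level (X t w) < K)%N].
Proof.
have [xK|Kx] := ltnP (level x0) K; last first.
  rewrite (_ : [set _ | _] = set0); first exact: negligible_set0.
  by apply/seteqP; split => w //= [X0 /(_ 0%N)]; rewrite X0; lia.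
apply: negligible_small => j.
pose N := (2 ^ j * (K ^ 2 + 1))%N.
pose step (q : option nat) (y : vertex) := if q is Some i then (if (K <= level y)%N then None else Some i.+1) else None.
pose bad (q : option nat) (v : vertex) := q = Some N.
pose Inv (q : option nat) v := if q is Some _ then (level v < K)%N else true.
pose phi (q : option nat) v : R := if q is Some i then ((K ^ 2)%:R - (level v)%:R ^+ 2 + i%:R) / N%:R else 0.
have N0 : 0 < (N%:R : R) by rewrite ltr0n muln_gt0 expn_gt0 addn1.
have sq v : (level v <= K)%N -> 0 <= (K ^ 2)%:R - (level v)%:R ^+ 2 :> R.
  by move=> vK; rewrite subr_ge0 -natrX ler_nat leq_exp2r.
have [|||||mE prE] := @machine_bound _ _ _ P X srw _ step (Some 0%N) bad Inv phi x0.
- by rewrite /Inv /step leqNgt xK.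
- move=> [i|] v y //= _ _ _; case: leqP => //=.
- move=> [i|] v //= vK; rewrite divr_ge0 ?(ltW N0)//.
  by apply: addr_ge0 => //; exact: sq (ltnW vK).
- move=> [i|] v //= vK [->]; rewrite ler_pdivlMr// mul1r lerDr.
  exact: sq (ltnW vK).
- move=> [i|] v /=; last by move=> _ _; rewrite mulr0 big1.
  move=> vK _.
  apply: (@le_trans _ _ (\sum_(y <- nbrs v) ((K ^ 2)%:R - (level y)%:R ^+ 2 + i.+1%:R) / N%:R)).
    apply: sum_nbrs_le => y /level_nbrs ly; case: leqP => // Ky /=.
    by rewrite divr_ge0 ?(ltW N0)//; apply: addr_ge0 => //; apply: sq; lia.
  rewrite -mulr_suml mulrA ler_pM2r ?invr_gt0//.
  rewrite (eq_bigr (fun y => ((K ^ 2)%:R + i.+1%:R) - (level y)%:R ^+ 2)); last by move=> y _; ring.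
  rewrite sumrB sum_nbrs_const; have := sum_level_sqr v.
  rewrite -[i.+1%:R]natr1; set S := \sum_(_ <- _) _.
  by move: ((size (nbrs v))%:R : R) S => D S; lra.
eexists; first split; first exact: mE.
  move: prE; rewrite /step leqNgt xK /= => prE; apply: le_trans prE _.
  apply: (@le_trans _ _ ((K ^ 2 + 1)%:R / N%:R)).
    rewrite ler_pM2r ?invr_gt0// natrD lerD2r lerBlDr lerDl exprn_ge0//.
  rewrite /N natrM invfM mulrCA divff ?mulr1; last by rewrite pnatr_eq0 addn1.
  by rewrite -hpV invrK.
move=> w /= [X0 H]; split => //; exists (N.-1); rewrite /bad.
suff S t : state step (Some 0%N) (X^~ w) t = Some t.+1.
  by rewrite S prednK//; move: N0; rewrite ltr0n.
by elim: t => [|t IH] /=; [rewrite leqNgt H|rewrite IH /= leqNgt H].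
Qed.

Let goodw w := is_walk (X^~ w) /\ forall n, exists t, (n <= level (X t w))%N.

Lemma stage_bound x0 k : (6 <= k)%N -> (level x0 < stage k.-1)%N ->
  prob_le P [set w | X 0%N w = x0 /\ (goodw w /\ exists s,
      (stage k <= level s < stage k.+1)%N /\ cutpoint (walk_path X w) (X 0%N w) s)]
    (10 * hp k).
Proof.
(* [2 * k + 1 = k + k.+1]: the resistance beyond [K] must be at most [hp k] times the resistance
   beyond [stage k.+1], itself at least [hp k.+1]. *)
move=> k6 x0k; have [N hN] := total_small (hp_gt0 R (2 * k + 1)).
pose K := (N + (stage k.+2).+1 + level x0).+1.
have kK : (stage k.+2 < K)%N by rewrite /K; lia.
have xK : (level x0 < K)%N by rewrite /K; lia.
have NK : (N <= K)%N by rewrite /K; lia.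
have back := return_bound srw (@rho_le_sup R) xK (m := stage k.+1).
have t0 := total_gt0 R (stage k.+1); have t0lt : rho R 0 (stage k.+1) < sup (range (rho R 0)) by rewrite -subr_gt0.
have {}back := back t0lt.
have H := prob_leU back (stage_cutpoints_le srw k6 kK x0k); apply: prob_leW H _ _.
  move=> w /= [X0 [[wx unb] [s [sk cs]]]].
  have [cb|ncb] := pselect (comes_back k K (X^~ w)); [left|right]; split => //.
  by split => //; split => //; exists w, s.
suff : total R K / total R (stage k.+1) <= hp k by rewrite /total; lra.
rewrite ler_pdivrMr//; apply: le_trans (hN _ NK) _.
have : hp k.+1 <= total R (stage k.+1).
  apply: le_trans (rho_tail_ge R (leqnn (stage k.+1)) (leqnn (stage k.+2))) _.
  have := rho_le_sup R (stage k.+2); rewrite (@rho_cat R 0 (stage k.+1)) ?leq_stage2//.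
  by rewrite /total; lra.
move/(ler_wpM2l (hp_ge0 R k)); apply: le_trans; rewrite -exprD.
by rewrite (_ : k + k.+1 = 2 * k + 1)%N//; lia.
Qed.

Lemma stage_index m l : (stage m <= l)%N -> exists2 k, (m <= k)%N & (stage k <= l < stage k.+1)%N.
Proof.
move=> ml; have ex : exists k, (l < stage k)%N by exists l; have := leq_stage l; lia.
case: (ex_minnP ex) => k lk km; have mk : (m < k)%N.
  by rewrite ltnNge; apply/negP => /leq_stage2; lia.
exists k.-1; first lia; rewrite prednK ?lk ?andbT//; last lia.
by rewrite leqNgt; apply/negP => /km; lia.
Qed.

Lemma infinite_cutpoints_negligible x0 :
  P.-negligible [set w | X 0%N w = x0 /\ (goodw w /\ forall k, exists s,
    (stage k <= level s)%N /\ cutpoint (walk_path X w) (X 0%N w) s)].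
Proof.
apply: negligible_small => j; pose k0 := (level x0 + 7)%N.
pose A k := [set w | X 0%N w = x0 /\ (goodw w /\ exists s,
  (stage k <= level s < stage k.+1)%N /\ cutpoint (walk_path X w) (X 0%N w) s)].
have H n : prob_le P (A (k0 + n)%N) (10 * hp n).
  have H0 : (level x0 < stage (k0 + n).-1)%N by have := leq_stage (k0 + n).-1; lia.
  have k6 : (6 <= k0 + n)%N by lia.
  apply: prob_leW (stage_bound k6 H0) _ _ => //.
  by rewrite ler_wpM2l// hp_le// leq_addl.
(* The tail costs [20 * hp (j + 5)], and [20 <= 2 ^ 5]. *)
have T := prob_le_tail (ler0n R 10) H (j + 5); apply: prob_leW T _ _.
  move=> w /= [X0 [gw /(_ (k0 + (j + 5))%N)[s [ls cs]]]].
  have [k mk lk] := stage_index ls.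
  exists (k - k0)%N; first by rewrite /=; lia.
  have -> : (k0 + (k - k0) = k)%N by lia.
  by split => //; split => //; exists s.
rewrite exprD (_ : 2^-1 ^+ 5 = 32^-1); last by rewrite exprVn -natrX.
by have := hp_ge0 R j; lra.
Qed.

(** The law of [X 0] is arbitrary, so the null sets are united over all starting points and heights
    [K], enumerated by [pickle]. *)
Lemma cutpoints_finite :
  {ae P, forall w, finite_set [set x | cutpoint (walk_path X w) (X 0%N w) x]}.
Proof.
have N1 := negligible_not_walk (nb := nbrs) (fun v w => erefl) uniq_nbrs size_nbrs_gt0 srw.
pose A n : set Omega := if choice.unpickle n : option (vertex * nat)%type is Some (x0, K)
  then [set w | X 0%N w = x0 /\ forall t, (level (X t w) < K)%N] else set0.
pose B n : set Omega := if choice.unpickle n : option vertex is Some x0 then [set w | X 0%N w = x0 /\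
  (goodw w /\ forall k, exists s,
    (stage k <= level s)%N /\ cutpoint (walk_path X w) (X 0%N w) s)] else set0.
have nA : P.-negligible (\bigcup_n A n).
  apply: negligible_bigcup => n; rewrite /A; case: choice.unpickle => [[x0 K]|].
    exact: bounded_negligible.
  exact: negligible_set0.
have nB : P.-negligible (\bigcup_n B n).
  apply: negligible_bigcup => n; rewrite /B; case: choice.unpickle => [x0|].
    exact: infinite_cutpoints_negligible.
  exact: negligible_set0.
apply: negligibleS (negligibleU N1 (negligibleU nA nB)) => w /= infin.
apply: contrapT => H; apply: infin.
have wx : is_walk (X^~ w).
  by move=> t; apply: contrapT => /negP tn; apply: H; left; exists t.
have unb n : exists t, (n <= level (X t w))%N.
  apply: contrapT => nt; apply: H; right; left; exists (choice.pickle (X 0%N w, n)) => //.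
  rewrite /A choice.pickleK; split => // t; rewrite ltnNge; apply/negP => tn.
  by apply: nt; exists t.
have [k Hk] : exists k, ~ exists s, (stage k <= level s)%N /\ cutpoint (walk_path X w) (X 0%N w) s.
  apply: contrapT => nk; apply: H; right; right; exists (choice.pickle (X 0%N w)) => //.
  rewrite /B choice.pickleK; split => //; split => // k; apply: contrapT => nk'.
  by apply: nk; exists k.
apply: sub_finite_set (finite_seq (levels 0 (stage k))) => s /= cs.
rewrite mem_levels /= ltnNge; apply/negP => ks.
by apply: Hk; exists s.
Qed.

End Walk.

Section Transience.
Context {R : realType} {d : measure_display} {Omega : measurableType d}.
Variables (P : probability Omega R) (X : nat -> Omega -> vertex).
Hypothesis srw : simple_random_walk P edge X.

(** [z] is superharmonic away from [x] and bounds the chance of ever hitting [x]. It is below 1 at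
    the upper neighbours of [x], so its mean [z1] over all neighbours is below 1. *)
Lemma never_returns x : P (X 0%N @^-1` [set x]) = 1%E ->
  (P [set w | exists2 t, (0 < t)%N & X t w = x] < 1)%E.
Proof.
move=> P1; pose z v : R := Num.min 1 (total R (level v) / total R (level x)).
pose z1 : R := (size (nbrs x))%:R^-1 * \sum_(y <- nbrs x) z y.
(* State 1 is the start at [x] and state 2 any later time, so that only a return is bad. *)
pose step (q : nat) (y : vertex) := minn q.+1 2.
pose bad (q : nat) v := q = 2%N /\ v = x.
pose Inv (q : nat) v := q = 2%N \/ (q = 1%N /\ v = x).
pose phi (q : nat) v := if q == 1%N then z1 else z v.
have tx := total_gt0 R (level x).
have D0 v : 0 < ((size (nbrs v))%:R : R) by rewrite ltr0n size_nbrs_gt0.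
have zge v : 0 <= z v by rewrite /z le_min ler01 divr_ge0 ?(ltW (total_gt0 _ _)).
have zle v : z v <= 1 by rewrite /z ge_min lexx.
have zup y : level y = (level x).+1 -> z y < 1.
  move=> ly; rewrite /z ly gt_min; apply/orP; right.
  by rewrite ltr_pdivrMr// mul1r -subr_gt0 totalS res_gt0.
have [|||||mE pE] := @machine_bound _ _ _ P X srw _ step 0%N bad Inv phi x.
- by right.
- by move=> q v y [->|[-> _]] _ _; left.
- by move=> q v _; rewrite /phi; case: ifP => // _; rewrite mulr_ge0 ?invr_ge0 ?sumr_ge0.
- by move=> q v _ [-> ->]; rewrite /phi /= /z divff ?gt_eqF// minxx.
- move=> q v [->|[-> ->]] nb; rewrite /phi /=; last first.
    by rewrite /z1 mulrA divff ?mul1r// gt_eqF.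
  rewrite {2}/z; case: (leP 1 (total R (level v) / total R (level x))) => _.
    by rewrite -sum_nbrs_const; apply: ler_sum.
  rewrite mulrA ler_pdivlMr//; apply: le_trans (total_superharmonic R v).
  rewrite mulr_suml; apply: ler_sum => y _.
  by rewrite -ler_pdivlMr// /z ge_min lexx orbT.
have z1lt : z1 < 1.
  rewrite /z1 mulrC ltr_pdivrMr// mul1r -(mulr1 (size _)%:R) -sum_nbrs_const.
  rewrite -subr_gt0 -sumrB.
  have [u ux lu] : exists2 u, u \in nbrs x & level u = (level x).+1.
    exists (up x false); last by [].
    by rewrite nbrsE mem_cat mem_head.
  rewrite (big_rem u)//= ltr_pwDl ?subr_gt0 ?zup// sumr_ge0// => y _.
  by rewrite subr_ge0.
set E := [set w | _ /\ _] in mE pE.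
set F := [set w | exists2 t, _ & _].
have mF : measurable F.
  rewrite (_ : F = \bigcup_(t in [set t | (0 < t)%N]) (X t @^-1` [set x])).
    by apply: bigcup_measurable => t _; exact: srw.1.
  by apply/seteqP; split => w [t t0 Xt]; exists t.
have mX0 : measurable (X 0%N @^-1` [set x]) by exact: srw.1.
have mC : measurable (~` (X 0%N @^-1` [set x])) by exact: measurableC.
have C0 : prob P (~` (X 0%N @^-1` [set x])) = 0.
  by rewrite /prob probability_setC// P1 subee.
have FE : F `<=` E `|` ~` (X 0%N @^-1` [set x]).
  move=> w [t t0 Xt]; have [X0|X0] := pselect (X 0%N w = x); [left|by right].
  split => //; exists t; split => //; move: t0; clear Xt.
  elim: t => // -[|t] IH _ /=; first by [].
  by rewrite /= in IH; rewrite IH.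
rewrite (prE _ mF) lte_fin.
have := le_pr P mF (measurableU _ _ mE mC) FE.
have := prU P mE mC; rewrite C0 => h1 h2.
have h3 : phi (step 0%N x) x = z1 by [].
rewrite h3 in pE.
lra.
Qed.

End Transience.

(** * Elementary properties of the graph *)

Lemma edge_sym : symmetric edge.
Proof. by move=> u v; exact: nbrs_sym. Qed.

Lemma edge_irr : irreflexive edge.
Proof. by move=> v; apply/negbTE/negP => /level_nbrs; lia. Qed.

(** Every vertex descends to level 0, whose only vertex carries the empty word. *)
Lemma edge_connected : connected_graph (graph_of_rel edge).
Proof.
have up1 v : (0 < level v)%N -> exists2 u, edge u v & level v = (level u).+1.
  move=> v0; have : (0 < size (downs v))%N by rewrite size_downs ndown_gt0.
  case E: (downs v) => [//|u s] _; have ud : u \in downs v by rewrite E mem_head.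
  by exists u; [rewrite /edge nbrs_sym nbrsE mem_cat ud orbT|exact: level_downs].
have root u v : level u = 0%N -> level v = 0%N -> u = v.
  move=> lu lv; apply: vertex_eq; first by rewrite lu.
  have := size_word u; have := size_word v; rewrite lu lv /=.
  by case: (word u) => //; case: (word v).
have down v : exists2 r, level r = 0%N &
    clos_refl_trans vertex edge r v /\ clos_refl_trans vertex edge v r.
  elim: (level v) {-2}v (erefl (level v)) => [|n IH] {}v lv.
    by exists v => //; split; exact: rt_refl.
  have [|u uv ll] := up1 v; first by rewrite lv.
  have [|r r0 [ru ur]] := IH u; first by lia.
  exists r => //; split; first by apply: rt_trans ru _; exact: rt_step.
  by apply: rt_trans ur; apply: rt_step; rewrite edge_sym.
split; first by have [r _ _] := down (@mkvertex 0 [::] erefl); exists r.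
move=> u v _ _; split => //.
have [r r0 [_ ur]] := down u; have [r' r0' [rv _]] := down v.
by apply: rt_trans ur _; rewrite (root r r').
Qed.

Lemma edge_degree v : degree edge v = size (nbrs v).
Proof. exact: (degreeE (nb := nbrs) (fun _ _ => erefl) uniq_nbrs). Qed.

Lemma edge_bounded_degree : bounded_degree edge.
Proof.
exists 4%N => v; split; last by rewrite edge_degree size_nbrs; have := ndown_le2 (level v); lia.
by rewrite (neighborsE (nb := nbrs) (fun _ _ => erefl)).
Qed.

Theorem theorem1 (R : realType) :
  exists (V : countType) (e : rel V),
    [/\ symmetric e /\ irreflexive e,
        connected_graph (graph_of_rel e),
        bounded_degree e /\ (forall x, (0 < degree e x)%N),
        transient R e &
        forall (d : measure_display) (Omega : measurableType d)
          (P : probability Omega R) (X : nat -> Omega -> V),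
          simple_random_walk P e X ->
          {ae P, forall w,
            finite_set [set x | cutpoint (walk_path X w) (X 0%N w) x]}].
Proof.
exists vertex, edge; split.
- by split; [exact: edge_sym|exact: edge_irr].
- exact: edge_connected.
- by split; [exact: edge_bounded_degree|move=> v; rewrite edge_degree size_nbrs_gt0].
- by move=> x d Omega P X srw; exact: never_returns.
- by move=> d Omega P X; exact: cutpoints_finite.
Qed.
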